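(* There is an isomorphism of rings $H^*(\mathbb{S}^1,\mathbb{Z}) \cong \mathbb{Z}[X]/(X^2)$.
   Context: The setting is Homotopy Type Theory / cubical type theory (univalence and higher inductive types); spaces are types. The circle $\mathbb{S}^1$ is the higher inductive type generated by a point $\mathsf{base}$ and a path $\mathsf{loop} : \mathsf{base} = \mathsf{base}$. Cohomology: for an abelian group $G$, $K(G,n)$ is the $n$th Eilenberg–MacLane space, with $K(G,0)=G$. For a type $X$, $H^n(X,G) = \lVert X \to K(G,n)\rVert_0$ (set truncation), an abelian group under the operation induced pointwise by the addition of $K(G,n)$. For a ring $R$, the cup product $\smile_h : H^n(X,R)\to H^m(X,R)\to H^{n+m}(X,R)$ is induced pointwise by the standard cup product $\smile_k : K(R,n)\to K(R,m)\to K(R,n+m)$ coming from the multiplication of $R$: the pointed map $K(R,n)\to_* (K(R,m)\to_* K(R,n+m))$ which for $n=0$ sends $r$ to the map induced by left multiplication by $r$ and for $n\ge 1$ induces on $n$-fold loop spaces the map sending $r$ to the map $K(R,m)\to_* K(R,m)$ induced by left multiplication by $r$. It satisfies the graded ring laws with unit $1_h = |\lambda x.\,1_R| : H^0(X,R)$. The cohomology ring is $H^*(X,R) = \bigoplus_{i:\mathbb{N}} H^i(X,R)$, with product induced by $\smile_h$ on homogeneous elements. The direct sum of abelian groups $(G_i)_{i:\mathbb{N}}$ is the set-truncated higher inductive type generated by $0$, homogeneous elements $\mathsf{base}\,n\,x$ ($x:G_n$) and sums, with paths making it a commutative monoid and identifying $\mathsf{base}\,n\,0$ with $0$ and $\mathsf{base}\,n\,x+\mathsf{base}\,n\,y$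 with $\mathsf{base}\,n\,(x+y)$. Polynomial rings are defined by the same construction (monomials being homogeneous elements), and isomorphisms are of (ungraded) rings. *)

(* Defs.v *)
From Stdlib Require Import List Arith.
Import ListNotations.

(** Rocq's own identity type cannot play the role of the path type: it is
    compatible with uniqueness of identity proofs, a standard axiom that refutes
    univalence.  So Homotopy Type Theory is given below as an object language, in the style of "Book HoTT" (a cumulative hierarchy of
    univalent universes, higher inductive types whose eliminators compute on
    point constructors), presented as a pure type system with untyped conversion.
    A statement of HoTT is a closed type; it is a theorem when it has a closed
    inhabitant. *)

(** * Raw syntax *)

Inductive cst : Type :=
| cEmpty | cEmptyInd
| cUnit | cTT | cUnitInd
| cSum | cInl | cInr | cSumInd
| cSig | cPair | cSigInd
| cNat | cO | cS | cNatInd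
| cId | cRefl | cJ
| cFunext | cUA
| cCirc | cBase | cLoop | cCircInd | cCircIndLoop
| cTr | cTrIn | cTrLevel | cTrInd
| cQuot | cQuotIn | cQuotEq | cQuotSet | cQuotInd
| cDS | cDSZero | cDSBase | cDSAdd | cDSAssoc | cDSComm | cDSUnit
| cDSBaseZero | cDSBaseAdd | cDSSet | cDSInd.

(** [Var] is a de Bruijn index. *)
Inductive term : Type :=
| Var (n : nat)
| Sort (i : nat)
| Pi (A B : term)
| Lam (A t : term)
| App (t u : term)
| Cst (c : cst).

Definition upren (r : nat -> nat) (n : nat) : nat :=
  match n with 0 => 0 | S m => S (r m) end.

Fixpoint rename (r : nat -> nat) (t : term) : term :=
  match t with
  | Var n => Var (r n)
  | Sort i => Sort i
  | Pi A B => Pi (rename r A) (rename (upren r) B)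
  | Lam A t => Lam (rename r A) (rename (upren r) t)
  | App t u => App (rename r t) (rename r u)
  | Cst c => Cst c
  end.

Definition up (s : nat -> term) (n : nat) : term :=
  match n with 0 => Var 0 | S m => rename S (s m) end.

Fixpoint subst (s : nat -> term) (t : term) : term :=
  match t with
  | Var n => s n
  | Sort i => Sort i
  | Pi A B => Pi (subst s A) (subst (up s) B)
  | Lam A t => Lam (subst s A) (subst (up s) t)
  | App t u => App (subst s t) (subst s u)
  | Cst c => Cst c
  end.

Definition subst1 (u t : term) : term :=
  subst (fun n => match n with 0 => u | S m => Var m end) t.

(** * Higher-order notation for raw terms

    An [hterm] is a raw term waiting for the number of binders above it; the
    variable bound under [l] binders is then [Var (d - l - 1)] at depth [d]. *)

Definition hterm : Type := nat -> term.

Definition hpi (A : hterm) (B : hterm -> hterm) : hterm :=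
  fun d => Pi (A d) (B (fun d' => Var (d' - S d)) (S d)).
Definition hlam (A : hterm) (t : hterm -> hterm) : hterm :=
  fun d => Lam (A d) (t (fun d' => Var (d' - S d)) (S d)).
Definition happ (t u : hterm) : hterm := fun d => App (t d) (u d).
Definition U (i : nat) : hterm := fun _ => Sort i.
Definition hcst (c : cst) : hterm := fun _ => Cst c.
Coercion hcst : cst >-> hterm.

Definition close (t : hterm) : term := t 0.

Declare Scope hott_scope.
Delimit Scope hott_scope with hott.
Bind Scope hott_scope with hterm.
Local Open Scope hott_scope.

Notation "t @ u" := (happ t u) (at level 20, left associativity) : hott_scope.
Notation "'Π' x : A , B" := (hpi A (fun x => B))
  (at level 200, x name, A at level 99, B at level 200) : hott_scope.
Notation "'λ' x : A , t" := (hlam A (fun x => t))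
  (at level 200, x name, A at level 99, t at level 200) : hott_scope.
Notation "A ⇒ B" := (hpi A (fun _ => B))
  (at level 90, right associativity, B at level 200) : hott_scope.

(** * Basic constructions

    Some definitions below have the shape [(λ x : A, t) @ u]; the β-redex only
    keeps [u] from being copied at each occurrence of [x]. *)

Definition Id (A x y : hterm) : hterm := cId @ A @ x @ y.
Definition refl (A x : hterm) : hterm := cRefl @ A @ x.
Definition J (A x P d y p : hterm) : hterm := cJ @ A @ x @ P @ d @ y @ p.

Definition transport (A P x y p u : hterm) : hterm :=
  J A x (λ y' : A, λ _ : Id A x y', P @ y') u y p.
Definition apd (A P f x y p : hterm) : hterm :=
  J A x (λ y' : A, λ q : Id A x y', Id (P @ y') (transport A P x y' q (f @ x)) (f @ y'))
    (refl (P @ x) (f @ x)) y p.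
Definition ap (A B f x y p : hterm) : hterm :=
  J A x (λ y' : A, λ _ : Id A x y', Id B (f @ x) (f @ y')) (refl B (f @ x)) y p.
Definition concat (A x y z p q : hterm) : hterm :=
  J A y (λ z' : A, λ _ : Id A y z', Id A x z') p z q.

Definition Sig (A B : hterm) : hterm := cSig @ A @ B.
Notation "'Σ' x : A , B" := (Sig A (hlam A (fun x => B)))
  (at level 200, x name, A at level 99, B at level 200) : hott_scope.
Notation "A × B" := (Sig A (hlam A (fun _ => B)))
  (at level 80, right associativity) : hott_scope.
Definition pair (A B a b : hterm) : hterm := cPair @ A @ B @ a @ b.
Definition fst (A B p : hterm) : hterm :=
  cSigInd @ A @ B @ (λ _ : Sig A B, A) @ (λ a : A, λ _ : B @ a, a) @ p.
Definition snd (A B p : hterm) : hterm :=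
  cSigInd @ A @ B @ (λ q : Sig A B, B @ fst A B q) @ (λ a : A, λ b : B @ a, b) @ p.

Definition isContr (A : hterm) : hterm := Σ c : A, Π x : A, Id A c x.
Definition isProp (A : hterm) : hterm := Π x : A, Π y : A, Id A x y.
Definition isSet (A : hterm) : hterm := Π x : A, Π y : A, isProp (Id A x y).

Definition fib (A B f y : hterm) : hterm := Σ x : A, Id B (f @ x) y.
Definition isEquiv (A B f : hterm) : hterm := Π y : B, isContr (fib A B f y).
Definition equiv (A B : hterm) : hterm := Σ f : A ⇒ B, isEquiv A B f.
Definition equivInv (A B f e y : hterm) : hterm :=
  (λ A : U 0, λ B : U 0, λ f : A ⇒ B, λ e : isEquiv A B f, λ y : B,
    let F := fib A B f y in
    fst A (λ x : A, Id B (f @ x) y)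
      (fst F (λ c : F, Π c' : F, Id F c c') (e @ y))) @ A @ B @ f @ e @ y.

Definition idEquiv (A : hterm) : hterm :=
  let id := λ x : A, x in
  pair (A ⇒ A) (λ f : A ⇒ A, isEquiv A A f) id
    (λ y : A,
      let F := fib A A id y in
      let c := pair A (λ x : A, Id A (id @ x) y) y (refl A y) in
      pair F (λ c : F, Π c' : F, Id F c c') c
        (λ c' : F,
          cSigInd @ A @ (λ x : A, Id A (id @ x) y) @ (λ c' : F, Id F c c')
            @ (λ x : A, λ p : Id A x y,
                J A x
                  (λ y' : A, λ q : Id A x y',
                    Id (fib A A id y')
                      (pair A (λ z : A, Id A (id @ z) y') y' (refl A y'))
                      (pair A (λ z : A, Id A (id @ z) y') x q))
                  (refl (fib A A id x)
                    (pair A (λ z : A, Id A (id @ z) x) x (refl A x)))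
                  y p)
            @ c')).

(** Canonical maps that function extensionality and univalence (for [U i])
    assert to be equivalences. *)
Definition happly (A B f g : hterm) : hterm :=
  λ p : Id (Π x : A, B @ x) f g,
    J (Π x : A, B @ x) f
      (λ g' : (Π x : A, B @ x), λ _ : Id (Π x : A, B @ x) f g',
        Π x : A, Id (B @ x) (f @ x) (g' @ x))
      (λ x : A, refl (B @ x) (f @ x)) g p.
Definition idToEquiv (i : nat) (A B : hterm) : hterm :=
  λ p : Id (U i) A B,
    J (U i) A (λ X : U i, λ _ : Id (U i) A X, equiv A X) (idEquiv A) B p.

(** h-levels, counted from 0 for contractible types, so that the n-types of the
    HoTT Book are the types of h-level n+2. *)
Definition hlevel (i : nat) (n A : hterm) : hterm :=
  cNatInd @ (λ _ : cNat, U i ⇒ U i)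
    @ (λ X : U i, isContr X)
    @ (λ _ : cNat, λ r : U i ⇒ U i, λ X : U i, Π x : X, Π y : X, r @ Id X x y)
    @ n @ A.

(** * Types of the constants, with constructors and parameters in [U i] and
    motives of eliminators in [U j]

    [cTr @ n] is truncation to h-level n+1, i.e. the truncation written
    ‖-‖_{n-1}: [cTr @ 0] is propositional and [cTr @ 1] is set truncation. *)

Definition ctype (c : cst) (i j : nat) : hterm :=
  match c with
  | cEmpty => U 0
  | cEmptyInd => Π P : cEmpty ⇒ U j, Π x : cEmpty, P @ x
  | cUnit => U 0
  | cTT => cUnit
  | cUnitInd => Π P : cUnit ⇒ U j, P @ cTT ⇒ Π x : cUnit, P @ x
  | cSum => U i ⇒ U i ⇒ U i
  | cInl => Π A : U i, Π B : U i, A ⇒ cSum @ A @ B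
  | cInr => Π A : U i, Π B : U i, B ⇒ cSum @ A @ B
  | cSumInd =>
      Π A : U i, Π B : U i, Π P : cSum @ A @ B ⇒ U j,
      (Π a : A, P @ (cInl @ A @ B @ a)) ⇒
      (Π b : B, P @ (cInr @ A @ B @ b)) ⇒
      Π x : cSum @ A @ B, P @ x
  | cSig => Π A : U i, (A ⇒ U i) ⇒ U i
  | cPair => Π A : U i, Π B : A ⇒ U i, Π a : A, B @ a ⇒ Sig A B
  | cSigInd =>
      Π A : U i, Π B : A ⇒ U i, Π P : Sig A B ⇒ U j,
      (Π a : A, Π b : B @ a, P @ (pair A B a b)) ⇒ Π p : Sig A B, P @ p
  | cNat => U 0
  | cO => cNat
  | cS => cNat ⇒ cNat
  | cNatInd =>
      Π P : cNat ⇒ U j, P @ cO ⇒ (Π n : cNat, P @ n ⇒ P @ (cS @ n)) ⇒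
      Π n : cNat, P @ n
  | cId => Π A : U i, A ⇒ A ⇒ U i
  | cRefl => Π A : U i, Π x : A, Id A x x
  | cJ =>
      Π A : U i, Π x : A, Π P : (Π y : A, Id A x y ⇒ U j),
      P @ x @ refl A x ⇒ Π y : A, Π p : Id A x y, P @ y @ p
  | cFunext =>
      Π A : U i, Π B : A ⇒ U i, Π f : (Π x : A, B @ x), Π g : (Π x : A, B @ x),
      isEquiv (Id (Π x : A, B @ x) f g) (Π x : A, Id (B @ x) (f @ x) (g @ x))
        (happly A B f g)
  | cUA =>
      Π A : U i, Π B : U i, isEquiv (Id (U i) A B) (equiv A B) (idToEquiv i A B)
  | cCirc => U 0
  | cBase => cCirc
  | cLoop => Id cCirc cBase cBase
  | cCircInd =>
      Π P : cCirc ⇒ U j, Π b : P @ cBase,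
      Id (P @ cBase) (transport cCirc P cBase cBase cLoop b) b ⇒
      Π x : cCirc, P @ x
  | cCircIndLoop =>
      Π P : cCirc ⇒ U j, Π b : P @ cBase,
      Π l : Id (P @ cBase) (transport cCirc P cBase cBase cLoop b) b,
      Id (Id (P @ cBase) (transport cCirc P cBase cBase cLoop b) b)
        (apd cCirc P (cCircInd @ P @ b @ l) cBase cBase cLoop) l
  | cTr => cNat ⇒ U i ⇒ U i
  | cTrIn => Π n : cNat, Π A : U i, A ⇒ cTr @ n @ A
  | cTrLevel => Π n : cNat, Π A : U i, hlevel i (cS @ n) (cTr @ n @ A)
  | cTrInd =>
      Π n : cNat, Π A : U i, Π P : cTr @ n @ A ⇒ U j,
      (Π x : cTr @ n @ A, hlevel j (cS @ n) (P @ x)) ⇒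
      (Π a : A, P @ (cTrIn @ n @ A @ a)) ⇒
      Π x : cTr @ n @ A, P @ x
  | cQuot => Π A : U i, (A ⇒ A ⇒ U i) ⇒ U i
  | cQuotIn => Π A : U i, Π R : A ⇒ A ⇒ U i, A ⇒ cQuot @ A @ R
  | cQuotEq =>
      Π A : U i, Π R : A ⇒ A ⇒ U i, Π x : A, Π y : A, R @ x @ y ⇒
      Id (cQuot @ A @ R) (cQuotIn @ A @ R @ x) (cQuotIn @ A @ R @ y)
  | cQuotSet => Π A : U i, Π R : A ⇒ A ⇒ U i, isSet (cQuot @ A @ R)
  | cQuotInd =>
      Π A : U i, Π R : A ⇒ A ⇒ U i, Π P : cQuot @ A @ R ⇒ U j,
      (Π q : cQuot @ A @ R, isSet (P @ q)) ⇒
      Π f : (Π a : A, P @ (cQuotIn @ A @ R @ a)),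
      (Π x : A, Π y : A, Π r : R @ x @ y,
        Id (P @ (cQuotIn @ A @ R @ y))
          (transport (cQuot @ A @ R) P (cQuotIn @ A @ R @ x) (cQuotIn @ A @ R @ y)
            (cQuotEq @ A @ R @ x @ y @ r) (f @ x))
          (f @ y)) ⇒
      Π q : cQuot @ A @ R, P @ q
  | cDS =>
      Π G : cNat ⇒ U i, (Π n : cNat, G @ n) ⇒ (Π n : cNat, G @ n ⇒ G @ n ⇒ G @ n) ⇒
      U i
  | cDSZero =>
      Π G : cNat ⇒ U i, Π z : (Π n : cNat, G @ n),
      Π a : (Π n : cNat, G @ n ⇒ G @ n ⇒ G @ n), cDS @ G @ z @ a
  | cDSBase =>
      Π G : cNat ⇒ U i, Π z : (Π n : cNat, G @ n),
      Π a : (Π n : cNat, G @ n ⇒ G @ n ⇒ G @ n),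
      Π n : cNat, G @ n ⇒ cDS @ G @ z @ a
  | cDSAdd =>
      Π G : cNat ⇒ U i, Π z : (Π n : cNat, G @ n),
      Π a : (Π n : cNat, G @ n ⇒ G @ n ⇒ G @ n),
      cDS @ G @ z @ a ⇒ cDS @ G @ z @ a ⇒ cDS @ G @ z @ a
  | cDSAssoc =>
      Π G : cNat ⇒ U i, Π z : (Π n : cNat, G @ n),
      Π a : (Π n : cNat, G @ n ⇒ G @ n ⇒ G @ n),
      let D := cDS @ G @ z @ a in
      let plus x y := cDSAdd @ G @ z @ a @ x @ y in
      Π x : D, Π y : D, Π w : D, Id D (plus x (plus y w)) (plus (plus x y) w)
  | cDSComm =>
      Π G : cNat ⇒ U i, Π z : (Π n : cNat, G @ n),
      Π a : (Π n : cNat, G @ n ⇒ G @ n ⇒ G @ n),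
      let D := cDS @ G @ z @ a in
      let plus x y := cDSAdd @ G @ z @ a @ x @ y in
      Π x : D, Π y : D, Id D (plus x y) (plus y x)
  | cDSUnit =>
      Π G : cNat ⇒ U i, Π z : (Π n : cNat, G @ n),
      Π a : (Π n : cNat, G @ n ⇒ G @ n ⇒ G @ n),
      let D := cDS @ G @ z @ a in
      let zero := cDSZero @ G @ z @ a in
      let plus x y := cDSAdd @ G @ z @ a @ x @ y in
      Π x : D, Id D (plus x zero) x
  | cDSBaseZero =>
      Π G : cNat ⇒ U i, Π z : (Π n : cNat, G @ n),
      Π a : (Π n : cNat, G @ n ⇒ G @ n ⇒ G @ n),
      Π n : cNat,
      Id (cDS @ G @ z @ a) (cDSBase @ G @ z @ a @ n @ (z @ n)) (cDSZero @ G @ z @ a)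
  | cDSBaseAdd =>
      Π G : cNat ⇒ U i, Π z : (Π n : cNat, G @ n),
      Π a : (Π n : cNat, G @ n ⇒ G @ n ⇒ G @ n),
      let base n x := cDSBase @ G @ z @ a @ n @ x in
      Π n : cNat, Π x : G @ n, Π y : G @ n,
      Id (cDS @ G @ z @ a) (cDSAdd @ G @ z @ a @ base n x @ base n y)
        (base n (a @ n @ x @ y))
  | cDSSet =>
      Π G : cNat ⇒ U i, Π z : (Π n : cNat, G @ n),
      Π a : (Π n : cNat, G @ n ⇒ G @ n ⇒ G @ n), isSet (cDS @ G @ z @ a)
  | cDSInd =>
      Π G : cNat ⇒ U i, Π z : (Π n : cNat, G @ n),
      Π a : (Π n : cNat, G @ n ⇒ G @ n ⇒ G @ n),
      let D := cDS @ G @ z @ a in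
      let zero := cDSZero @ G @ z @ a in
      let base n x := cDSBase @ G @ z @ a @ n @ x in
      let plus x y := cDSAdd @ G @ z @ a @ x @ y in
      Π P : D ⇒ U j,
      (Π x : D, isSet (P @ x)) ⇒
      Π pz : P @ zero,
      Π pb : (Π n : cNat, Π x : G @ n, P @ base n x),
      Π pa : (Π x : D, Π y : D, P @ x ⇒ P @ y ⇒ P @ plus x y),
      (Π x : D, Π y : D, Π w : D, Π u : P @ x, Π v : P @ y, Π t : P @ w,
        Id (P @ plus (plus x y) w)
          (transport D P (plus x (plus y w)) (plus (plus x y) w)
            (cDSAssoc @ G @ z @ a @ x @ y @ w)
            (pa @ x @ plus y w @ u @ (pa @ y @ w @ v @ t)))
          (pa @ plus x y @ w @ (pa @ x @ y @ u @ v) @ t)) ⇒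
      (Π x : D, Π y : D, Π u : P @ x, Π v : P @ y,
        Id (P @ plus y x)
          (transport D P (plus x y) (plus y x) (cDSComm @ G @ z @ a @ x @ y)
            (pa @ x @ y @ u @ v))
          (pa @ y @ x @ v @ u)) ⇒
      (Π x : D, Π u : P @ x,
        Id (P @ x)
          (transport D P (plus x zero) x (cDSUnit @ G @ z @ a @ x)
            (pa @ x @ zero @ u @ pz))
          u) ⇒
      (Π n : cNat,
        Id (P @ zero)
          (transport D P (base n (z @ n)) zero (cDSBaseZero @ G @ z @ a @ n)
            (pb @ n @ (z @ n)))
          pz) ⇒
      (Π n : cNat, Π x : G @ n, Π y : G @ n,
        Id (P @ base n (a @ n @ x @ y))
          (transport D P (plus (base n x) (base n y)) (base n (a @ n @ x @ y))
            (cDSBaseAdd @ G @ z @ a @ n @ x @ y)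
            (pa @ base n x @ base n y @ (pb @ n @ x) @ (pb @ n @ y)))
          (pb @ n @ (a @ n @ x @ y))) ⇒
      Π x : D, P @ x
  end.

(** * Conversion and typing *)

Definition apps (c : cst) (l : list term) : term := fold_left App l (Cst c).

Inductive iota : term -> term -> Prop :=
| iota_unit P d : iota (apps cUnitInd [P; d; Cst cTT]) d
| iota_inl A B P f g A' B' a :
    iota (apps cSumInd [A; B; P; f; g; apps cInl [A'; B'; a]]) (App f a)
| iota_inr A B P f g A' B' b :
    iota (apps cSumInd [A; B; P; f; g; apps cInr [A'; B'; b]]) (App g b)
| iota_sig A B P f A' B' a b :
    iota (apps cSigInd [A; B; P; f; apps cPair [A'; B'; a; b]]) (App (App f a) b)
| iota_O P z s : iota (apps cNatInd [P; z; s; Cst cO]) z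
| iota_S P z s n :
    iota (apps cNatInd [P; z; s; App (Cst cS) n])
      (App (App s n) (apps cNatInd [P; z; s; n]))
| iota_J A x P d y A' x' : iota (apps cJ [A; x; P; d; y; apps cRefl [A'; x']]) d
| iota_base P b l : iota (apps cCircInd [P; b; l; Cst cBase]) b
| iota_tr n A P h f n' A' a :
    iota (apps cTrInd [n; A; P; h; f; apps cTrIn [n'; A'; a]]) (App f a)
| iota_quot A R P h f e A' R' a :
    iota (apps cQuotInd [A; R; P; h; f; e; apps cQuotIn [A'; R'; a]]) (App f a)
| iota_ds_zero G z a P s pz pb pa h1 h2 h3 h4 h5 G' z' a' :
    iota
      (apps cDSInd [G; z; a; P; s; pz; pb; pa; h1; h2; h3; h4; h5;
        apps cDSZero [G'; z'; a']])
      pz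
| iota_ds_base G z a P s pz pb pa h1 h2 h3 h4 h5 G' z' a' n x :
    iota
      (apps cDSInd [G; z; a; P; s; pz; pb; pa; h1; h2; h3; h4; h5;
        apps cDSBase [G'; z'; a'; n; x]])
      (App (App pb n) x)
| iota_ds_add G z a P s pz pb pa h1 h2 h3 h4 h5 G' z' a' x y :
    let ind := apps cDSInd [G; z; a; P; s; pz; pb; pa; h1; h2; h3; h4; h5] in
    iota (App ind (apps cDSAdd [G'; z'; a'; x; y]))
      (App (App (App (App pa x) y) (App ind x)) (App ind y)).

Inductive conv : term -> term -> Prop :=
| conv_refl t : conv t t
| conv_sym t u : conv t u -> conv u t
| conv_trans t u v : conv t u -> conv u v -> conv t v
| conv_beta A t u : conv (App (Lam A t) u) (subst1 u t)
| conv_eta A t : conv (Lam A (App (rename S t) (Var 0))) t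
| conv_iota t u : iota t u -> conv t u
| conv_Pi A A' B B' : conv A A' -> conv B B' -> conv (Pi A B) (Pi A' B')
| conv_Lam A A' t t' : conv A A' -> conv t t' -> conv (Lam A t) (Lam A' t')
| conv_App t t' u u' : conv t t' -> conv u u' -> conv (App t u) (App t' u').

(** [typ Γ t A] reads Γ ⊢ t : A.  Entry [n] of the context is the type of
    [Var n], in the context formed by the entries after it. *)
Inductive typ : list term -> term -> term -> Prop :=
| typ_Var Γ n A :
    nth_error Γ n = Some A -> typ Γ (Var n) (rename (fun m => S n + m) A)
| typ_Sort Γ i : typ Γ (Sort i) (Sort (S i))
| typ_Pi Γ A B i :
    typ Γ A (Sort i) -> typ (A :: Γ) B (Sort i) -> typ Γ (Pi A B) (Sort i)
| typ_Lam Γ A B t i :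
    typ Γ A (Sort i) -> typ (A :: Γ) t B -> typ Γ (Lam A t) (Pi A B)
| typ_App Γ A B t u :
    typ Γ t (Pi A B) -> typ Γ u A -> typ Γ (App t u) (subst1 u B)
| typ_Cst Γ c i j : typ Γ (Cst c) (close (ctype c i j))
| typ_cumul Γ A i j : typ Γ A (Sort i) -> i <= j -> typ Γ A (Sort j)
| typ_conv Γ t A B i : typ Γ t A -> conv A B -> typ Γ B (Sort i) -> typ Γ t B.

Definition hott_theorem (A : hterm) : Prop :=
  exists t : term, typ [] t (close A).

(** * Rings *)

Record rawRing : Type := RawRing {
  carrier : hterm;
  zero : hterm;
  one : hterm;
  addition : hterm;
  multiplication : hterm
}.

Definition add (R : rawRing) (x y : hterm) : hterm := addition R @ x @ y.
Definition mul (R : rawRing) (x y : hterm) : hterm := multiplication R @ x @ y.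

Definition shareRing (P : rawRing -> hterm) (R : rawRing) : hterm :=
  (λ C : U 0, λ z : C, λ u : C, λ a : C ⇒ C ⇒ C, λ m : C ⇒ C ⇒ C,
    P (RawRing C z u a m))
    @ carrier R @ zero R @ one R @ addition R @ multiplication R.

Definition isRing : rawRing -> hterm := shareRing (fun R =>
  let C := carrier R in
  isSet C
  × (Π x : C, Π y : C, Π z : C, Id C (add R x (add R y z)) (add R (add R x y) z))
  × (Π x : C, Π y : C, Id C (add R x y) (add R y x))
  × (Π x : C, Id C (add R x (zero R)) x)
  × (Π x : C, Σ y : C, Id C (add R x y) (zero R))
  × (Π x : C, Π y : C, Π z : C, Id C (mul R x (mul R y z)) (mul R (mul R x y) z))
  × (Π x : C, Id C (mul R (one R) x) x)
  × (Π x : C, Id C (mul R x (one R)) x)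
  × (Π x : C, Π y : C, Π z : C,
      Id C (mul R x (add R y z)) (add R (mul R x y) (mul R x z)))
  × (Π x : C, Π y : C, Π z : C,
      Id C (mul R (add R x y) z) (add R (mul R x z) (mul R y z)))).

Definition ringIso (R S : rawRing) : hterm :=
  shareRing (fun R => shareRing (fun S =>
  Σ f : carrier R ⇒ carrier S,
    isEquiv (carrier R) (carrier S) f
    × Id (carrier S) (f @ one R) (one S)
    × (Π x : carrier R, Π y : carrier R,
        Id (carrier S) (f @ add R x y) (add S (f @ x) (f @ y)))
    × (Π x : carrier R, Π y : carrier R,
        Id (carrier S) (f @ mul R x y) (mul S (f @ x) (f @ y)))) S) R.

Definition plus (m n : hterm) : hterm :=
  cNatInd @ (λ _ : cNat, cNat) @ n @ (λ _ : cNat, λ r : cNat, cS @ r) @ m.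

(** The integers: [pos n] is n and [neg n] is -(n+1). *)
Definition Zcar : hterm := cSum @ cNat @ cNat.
Definition pos (n : hterm) : hterm := cInl @ cNat @ cNat @ n.
Definition neg (n : hterm) : hterm := cInr @ cNat @ cNat @ n.
Definition Zcase (f g x : hterm) : hterm :=
  cSumInd @ cNat @ cNat @ (λ _ : Zcar, Zcar) @ f @ g @ x.
Definition Ziter (f x n : hterm) : hterm :=
  cNatInd @ (λ _ : cNat, Zcar) @ x @ (λ _ : cNat, f) @ n.
Definition natCase (z s n : hterm) : hterm :=
  cNatInd @ (λ _ : cNat, Zcar) @ z @ (λ m : cNat, λ _ : Zcar, s @ m) @ n.

Definition Zsucc : hterm :=
  λ x : Zcar,
    Zcase (λ n : cNat, pos (cS @ n))
      (λ n : cNat, natCase (pos cO) (λ m : cNat, neg m) n) x.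
Definition Zpred : hterm :=
  λ x : Zcar,
    Zcase (λ n : cNat, natCase (neg cO) (λ m : cNat, pos m) n)
      (λ n : cNat, neg (cS @ n)) x.
Definition Zopp : hterm :=
  λ x : Zcar,
    Zcase (λ n : cNat, natCase (pos cO) (λ m : cNat, neg m) n)
      (λ n : cNat, pos (cS @ n)) x.
Definition Zadd : hterm :=
  λ x : Zcar, λ y : Zcar,
    Zcase (λ n : cNat, Ziter Zsucc x n) (λ n : cNat, Ziter Zpred x (cS @ n)) y.
Definition Zmul : hterm :=
  λ x : Zcar, λ y : Zcar,
    Zcase (λ n : cNat, Ziter (Zadd @ y) (pos cO) n)
      (λ n : cNat, Zopp @ Ziter (Zadd @ y) (pos cO) (cS @ n)) x.

Definition ZRing : rawRing := {|
  carrier := Zcar;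
  zero := pos cO;
  one := pos (cS @ cO);
  addition := Zadd;
  multiplication := Zmul
|}.

(** * Pointed types (in [U 0]) and loop spaces *)

Definition Ptd : hterm := Σ A : U 0, A.
Definition mkPtd (A a : hterm) : hterm := pair (U 0) (λ A : U 0, A) A a.
Definition ty (X : hterm) : hterm := fst (U 0) (λ A : U 0, A) X.
Definition pt (X : hterm) : hterm := snd (U 0) (λ A : U 0, A) X.

Definition isPtdMap (X Y : hterm) : hterm :=
  λ f : ty X ⇒ ty Y, Id (ty Y) (f @ pt X) (pt Y).
Definition pmap (X Y : hterm) : hterm :=
  (λ X : Ptd, λ Y : Ptd, Sig (ty X ⇒ ty Y) (isPtdMap X Y)) @ X @ Y.
Definition mkPmap (X Y f p : hterm) : hterm :=
  (λ X : Ptd, λ Y : Ptd, cPair @ (ty X ⇒ ty Y) @ isPtdMap X Y) @ X @ Y @ f @ p.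
Definition pfun (X Y f : hterm) : hterm :=
  (λ X : Ptd, λ Y : Ptd, λ f : pmap X Y, fst (ty X ⇒ ty Y) (isPtdMap X Y) f)
    @ X @ Y @ f.
Definition ppt (X Y f : hterm) : hterm :=
  (λ X : Ptd, λ Y : Ptd, λ f : pmap X Y, snd (ty X ⇒ ty Y) (isPtdMap X Y) f)
    @ X @ Y @ f.
Definition isPtdEquiv (X Y f : hterm) : hterm :=
  (λ A : U 0, λ B : U 0, λ f : A ⇒ B, isEquiv A B f) @ ty X @ ty Y @ pfun X Y f.
Definition pmapPtd (X Y : hterm) : hterm :=
  (λ X : Ptd, λ Y : Ptd,
    mkPtd (pmap X Y) (mkPmap X Y (λ _ : ty X, pt Y) (refl (ty Y) (pt Y)))) @ X @ Y.

Definition Loop (X : hterm) : hterm :=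
  (λ X : Ptd, mkPtd (Id (ty X) (pt X) (pt X)) (refl (ty X) (pt X))) @ X.

(** Conjugation by a path q : y = y', written as a transport. *)
Definition conjLoop (A y y' q p : hterm) : hterm :=
  transport A (λ x : A, Id A x x) y y' q p.
Definition conjRefl (A y y' q : hterm) : hterm :=
  J A y
    (λ x : A, λ q : Id A y x, Id (Id A x x) (conjLoop A y x q (refl A y)) (refl A x))
    (refl (Id A y y) (refl A y)) y' q.

(** On loops, a pointed map (f, q) acts by p ↦ q⁻¹ ∙ ap f p ∙ q. *)
Definition loopMap (X Y f : hterm) : hterm :=
  (λ X : Ptd, λ Y : Ptd, λ f : pmap X Y,
    (λ A : U 0, λ a : A, λ B : U 0, λ b : B, λ f : A ⇒ B, λ q : Id B (f @ a) b,
      mkPmap (Loop (mkPtd A a)) (Loop (mkPtd B b))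
        (λ p : Id A a a, conjLoop B (f @ a) b q (ap A B f a a p))
        (conjRefl B (f @ a) b q))
      @ ty X @ pt X @ ty Y @ pt Y @ pfun X Y f @ ppt X Y f) @ X @ Y @ f.

Definition Loops (n X : hterm) : hterm :=
  cNatInd @ (λ _ : cNat, Ptd ⇒ Ptd)
    @ (λ X : Ptd, X)
    @ (λ _ : cNat, λ r : Ptd ⇒ Ptd, λ X : Ptd, r @ Loop X)
    @ n @ X.

Definition loopsMap (n X Y f : hterm) : hterm :=
  cNatInd
    @ (λ n : cNat, Π X : Ptd, Π Y : Ptd, pmap X Y ⇒ pmap (Loops n X) (Loops n Y))
    @ (λ X : Ptd, λ Y : Ptd, λ f : pmap X Y, f)
    @ (λ n : cNat,
       λ r : (Π X : Ptd, Π Y : Ptd, pmap X Y ⇒ pmap (Loops n X) (Loops n Y)),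
       λ X : Ptd, λ Y : Ptd, λ f : pmap X Y, r @ Loop X @ Loop Y @ loopMap X Y f)
    @ n @ X @ Y @ f.
Definition loopsFun (n X Y f : hterm) : hterm :=
  (λ n : cNat, λ X : Ptd, λ Y : Ptd, λ f : pmap X Y,
    pfun (Loops n X) (Loops n Y) (loopsMap n X Y f)) @ n @ X @ Y @ f.

(** The map F 0 → Ωⁿ (F n) iterated from pointed maps s n : F n → Ω (F (n+1)). *)
Definition iterLoop (F s n : hterm) : hterm :=
  (λ F : cNat ⇒ Ptd, λ s : (Π n : cNat, pmap (F @ n) (Loop (F @ (cS @ n)))),
    cNatInd @ (λ n : cNat, ty (F @ cO) ⇒ ty (Loops n (F @ n)))
      @ (λ x : ty (F @ cO), x)
      @ (λ n : cNat, λ r : ty (F @ cO) ⇒ ty (Loops n (F @ n)), λ x : ty (F @ cO),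
          loopsFun n (F @ n) (Loop (F @ (cS @ n))) (s @ n) @ (r @ x)))
    @ F @ s @ n.

(** * Eilenberg-MacLane spaces and the cup product

    An Eilenberg-MacLane space being determined by its connectivity,
    truncation level and loop space, results
    are stated for every family of such spaces and every cup product on it.
    [K] is the sequence of pointed types K(R,n), [susp n] the pointed equivalence
    K(R,n) → Ω K(R,n+1), [suspE] the proof that it is an equivalence, and [cup]
    the cup product. *)

Record EMdata : Type := mkEMdata {
  K : hterm;
  susp : hterm;
  suspE : hterm;
  cup : hterm
}.

(** K(R,0) is R itself, by computation. *)
Definition EMspace (R : rawRing) (K' : hterm) : hterm :=
  λ n : cNat,
    cNatInd @ (λ _ : cNat, Ptd) @ mkPtd (carrier R) (zero R)
      @ (λ n : cNat, λ _ : Ptd, K' @ n) @ n.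

Definition suspFun (K susp n : hterm) : hterm :=
  pfun (K @ n) (Loop (K @ (cS @ n))) (susp @ n).

(** r : R ↦ the corresponding element of Ωⁿ K(R,n). *)
Definition emLoop (K susp n r : hterm) : hterm := iterLoop K susp n @ r.

(** The identification K(R,m) → Ωⁿ K(R,n+m). *)
Definition emShift (K susp n m x : hterm) : hterm :=
  iterLoop (λ n : cNat, K @ plus n m) (λ n : cNat, susp @ plus n m) n @ x.

Definition cupType (K : hterm) : hterm :=
  Π n : cNat, Π m : cNat, pmap (K @ n) (pmapPtd (K @ m) (K @ plus n m)).
Definition cupMap (K cup n m x : hterm) : hterm :=
  pfun (K @ n) (pmapPtd (K @ m) (K @ plus n m)) (cup @ n @ m) @ x.
Definition cupK (K cup n m x y : hterm) : hterm :=
  (λ K : cNat ⇒ Ptd, λ cup : cupType K,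
   λ n : cNat, λ m : cNat, λ x : ty (K @ n), λ y : ty (K @ m),
    pfun (K @ m) (K @ plus n m) (cupMap K cup n m x) @ y) @ K @ cup @ n @ m @ x @ y.

(** The pointed map x ↦ x ⌣ y. *)
Definition cupLeft (K cup n m y : hterm) : hterm :=
  (λ K : cNat ⇒ Ptd, λ cup : cupType K, λ n : cNat, λ m : cNat, λ y : ty (K @ m),
    let Kn := K @ n in
    let Km := K @ m in
    let Knm := K @ plus n m in
    let M := pmapPtd Km Knm in
    mkPmap Kn Knm (λ x : ty Kn, cupK K cup n m x y)
      (ap (ty M) (ty Knm) (λ f : ty M, pfun Km Knm f @ y)
        (cupMap K cup n m (pt Kn)) (pt M) (ppt Kn M (cup @ n @ m))))
    @ K @ cup @ n @ m @ y.

(** A pointed map f : K(R,m) → K(R,m) is induced by left multiplication by r. *)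
Definition inducedByMul (R : rawRing) (K susp m r f : hterm) : hterm :=
  Π g : carrier R,
    Id (ty (Loops m (K @ m)))
      (loopsFun m (K @ m) (K @ m) f @ emLoop K susp m g)
      (emLoop K susp m (mul R r g)).

Definition isCupZero (R : rawRing) (K susp cup : hterm) : hterm :=
  Π m : cNat, Π r : carrier R,
    inducedByMul R K susp m r (cupMap K cup cO m r).

(** A loop of pointed maps K(R,m) → K(R,n+m) is read as a map K(R,m) → Ω K(R,n+m)
    by evaluating at y : K(R,m), and likewise for n-fold loops.  The case n = 0 says
    nothing; it is covered by [isCupZero]. *)
Definition isCupLoops (R : rawRing) (K susp cup : hterm) : hterm :=
  Π n : cNat, Π m : cNat, Π r : carrier R, Π y : ty (K @ m),
    Id (ty (Loops n (K @ plus n m)))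
      (loopsFun n (K @ n) (K @ plus n m) (cupLeft K cup n m y) @ emLoop K susp n r)
      (emShift K susp n m (cupK K cup cO m r y)).

(** For all Eilenberg-MacLane spaces and cup products over R: K(R,n) is
    (n-1)-connected and n-truncated, the equivalences K(R,n) ≃ Ω K(R,n+1) are
    pointed, and R → Ω K(R,1) is a homomorphism. *)
Definition forallEM (R : rawRing) (P : EMdata -> hterm) : hterm :=
  Π K' : cNat ⇒ Ptd,
  let K := EMspace R K' in
  (Π n : cNat, isContr (cTr @ n @ ty (K @ n))) ⇒
  (Π n : cNat, hlevel 0 (cS @ (cS @ n)) (ty (K @ n))) ⇒
  Π susp : (Π n : cNat, pmap (K @ n) (Loop (K @ (cS @ n)))),
  Π suspE : (Π n : cNat,
    isPtdEquiv (K @ n) (Loop (K @ (cS @ n))) (susp @ n)),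
  (Π x : carrier R, Π y : carrier R,
    let K1 := K @ (cS @ cO) in
    Id (ty (Loop K1)) (suspFun K susp cO @ add R x y)
      (concat (ty K1) (pt K1) (pt K1) (pt K1)
        (suspFun K susp cO @ x) (suspFun K susp cO @ y))) ⇒
  Π cup : cupType K,
  isCupZero R K susp cup ⇒
  isCupLoops R K susp cup ⇒
  P (mkEMdata K susp suspE cup).

(** Addition on K(R,n), transferred from composition of loops in K(R,n+1). *)
Definition addK (E : EMdata) (n x y : hterm) : hterm :=
  (λ X : Ptd, λ Y : Ptd, λ s : pmap X (Loop Y), λ e : isPtdEquiv X (Loop Y) s,
   λ x : ty X, λ y : ty X,
    equivInv (ty X) (ty (Loop Y)) (pfun X (Loop Y) s) e
      (concat (ty Y) (pt Y) (pt Y) (pt Y)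
        (pfun X (Loop Y) s @ x) (pfun X (Loop Y) s @ y)))
    @ (K E @ n) @ (K E @ (cS @ n)) @ (susp E @ n) @ (suspE E @ n) @ x @ y.

(** * Cohomology *)

Definition setTr (A : hterm) : hterm := cTr @ (cS @ cO) @ A.
Definition setIn (A a : hterm) : hterm := cTrIn @ (cS @ cO) @ A @ a.
Definition setRec (A B f x : hterm) : hterm :=
  cTrInd @ (cS @ cO) @ A @ (λ _ : setTr A, setTr B)
    @ (λ _ : setTr A, cTrLevel @ (cS @ cO) @ B) @ f @ x.
Definition setMap2 (A B C : hterm) (f : hterm -> hterm -> hterm) (x y : hterm) : hterm :=
  setRec A C (λ a : A, setRec B C (λ b : B, setIn C (f a b)) y) x.

Definition cochain (E : EMdata) (X n : hterm) : hterm := X ⇒ ty (K E @ n).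
Definition H (E : EMdata) (X n : hterm) : hterm := setTr (cochain E X n).
Definition zeroH (E : EMdata) (X n : hterm) : hterm :=
  setIn (cochain E X n) (λ _ : X, pt (K E @ n)).
Definition addH (E : EMdata) (X n a b : hterm) : hterm :=
  setMap2 (cochain E X n) (cochain E X n) (cochain E X n)
    (fun f g => λ x : X, addK E n (f @ x) (g @ x)) a b.
Definition cupH (E : EMdata) (X n m a b : hterm) : hterm :=
  setMap2 (cochain E X n) (cochain E X m) (cochain E X (plus n m))
    (fun f g => λ x : X, cupK (K E) (cup E) n m (f @ x) (g @ x)) a b.
Definition oneH (R : rawRing) (E : EMdata) (X : hterm) : hterm :=
  setIn (cochain E X cO) (λ _ : X, one R).

(** * Direct sum rings

    Given groups [G n] with an element [u] of degree 0 and products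
    [m k l : G k → G l → G (k+l)], the product of the direct sum is determined by its
    values on homogeneous elements. *)

Record gradedData : Type := mkGraded {
  G : hterm;
  G0 : hterm;
  Gadd : hterm;
  Gone : hterm;
  Gmul : hterm -> hterm -> hterm -> hterm -> hterm
}.

Definition shareGraded (P : gradedData -> hterm) (D : gradedData) : hterm :=
  (λ G : cNat ⇒ U 0, λ z : (Π n : cNat, G @ n),
   λ a : (Π n : cNat, G @ n ⇒ G @ n ⇒ G @ n), λ u : G @ cO,
   λ m : (Π k : cNat, Π l : cNat, G @ k ⇒ G @ l ⇒ G @ plus k l),
    P (mkGraded G z a u (fun k l x y => m @ k @ l @ x @ y)))
    @ G D @ G0 D @ Gadd D @ Gone D
    @ (λ k : cNat, λ l : cNat, λ x : G D @ k, λ y : G D @ l, Gmul D k l x y).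

Definition dsCar (D : gradedData) : hterm := cDS @ G D @ G0 D @ Gadd D.
Definition dsBase (D : gradedData) (n x : hterm) : hterm :=
  cDSBase @ G D @ G0 D @ Gadd D @ n @ x.
Definition dsRing (D : gradedData) (mult : hterm) : rawRing := {|
  carrier := dsCar D;
  zero := cDSZero @ G D @ G0 D @ Gadd D;
  one := dsBase D cO (Gone D);
  addition := cDSAdd @ G D @ G0 D @ Gadd D;
  multiplication := mult
|}.

(** There is a (necessarily unique) ring structure on the direct sum with the
    prescribed products of homogeneous elements, and that ring satisfies [P]. *)
Definition theDirectSumRing (D : gradedData) (P : rawRing -> hterm) : hterm :=
  Σ mult : dsCar D ⇒ dsCar D ⇒ dsCar D,
    isRing (dsRing D mult)
    × (Π n : cNat, Π m : cNat, Π x : G D @ n, Π y : G D @ m,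
        Id (dsCar D) (mult @ dsBase D n x @ dsBase D m y)
          (dsBase D (plus n m) (Gmul D n m x y)))
    × P (dsRing D mult).

Definition cohomologyGraded (R : rawRing) (E : EMdata) (X : hterm) : gradedData := {|
  G := λ n : cNat, H E X n;
  G0 := λ n : cNat, zeroH E X n;
  Gadd := λ n : cNat, λ a : H E X n, λ b : H E X n, addH E X n a b;
  Gone := oneH R E X;
  Gmul := cupH E X
|}.

(** In R[X], [dsBase n r] is the monomial r Xⁿ. *)
Definition polyGraded (R : rawRing) : gradedData := {|
  G := λ _ : cNat, carrier R;
  G0 := λ _ : cNat, zero R;
  Gadd := λ _ : cNat, addition R;
  Gone := one R;
  Gmul := fun _ _ x y => mul R x y
|}.

Definition polyX (R : rawRing) : hterm := dsBase (polyGraded R) (cS @ cO) (one R).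

Definition theCohomologyRing (R : rawRing) (E : EMdata) (X : hterm)
    (P : rawRing -> hterm) : hterm :=
  shareGraded (fun D => theDirectSumRing D P) (cohomologyGraded R E X).
Definition thePolynomialRing (R : rawRing) (P : rawRing -> hterm) : hterm :=
  theDirectSumRing (polyGraded R) P.

(** * Quotient of a commutative ring by a principal ideal *)

(** x - y lies in the ideal (p). *)
Definition idealRel (R : rawRing) (p : hterm) : hterm :=
  λ x : carrier R, λ y : carrier R,
    cTr @ cO @ (Σ q : carrier R, Id (carrier R) x (add R y (mul R q p))).
Definition quotCar (R : rawRing) (p : hterm) : hterm :=
  cQuot @ carrier R @ idealRel R p.
Definition quotIn (R : rawRing) (p x : hterm) : hterm :=
  cQuotIn @ carrier R @ idealRel R p @ x.
Definition quotRing (R : rawRing) (p plusQ multQ : hterm) : rawRing := {|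
  carrier := quotCar R p;
  zero := quotIn R p (zero R);
  one := quotIn R p (one R);
  addition := plusQ;
  multiplication := multQ
|}.

(** There is a (necessarily unique) ring structure on the quotient making the
    projection a homomorphism, and that ring satisfies [P]. *)
Definition theQuotientRing (R : rawRing) (p : hterm) (P : rawRing -> hterm) : hterm :=
  let C := carrier R in
  let Q := quotCar R p in
  Σ plusQ : Q ⇒ Q ⇒ Q, Σ multQ : Q ⇒ Q ⇒ Q,
    isRing (quotRing R p plusQ multQ)
    × (Π x : C, Π y : C,
        Id Q (plusQ @ quotIn R p x @ quotIn R p y) (quotIn R p (add R x y)))
    × (Π x : C, Π y : C,
        Id Q (multQ @ quotIn R p x @ quotIn R p y) (quotIn R p (mul R x y)))
    × P (quotRing R p plusQ multQ).

(* Main.v *)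
From Stdlib Require Import List Arith Lia Bool PArith FMapPositive.
Require Import Defs.
Import ListNotations.

(** Write a map from the circle to A as a point of A with a loop at it.  In a connected
    type the point can be moved to the base point a, so that every class in
    ‖S¹ → A‖₀ comes from a loop at a ([circSurj]); the loop is determined by the class
    when loops at a commute ([circInj]).
    - K(ℤ,1) is connected with loop space ℤ, a commutative group, so that H¹ is ℤ
      through a winding number ([winding]), and pointwise addition of two maps becomes
      concatenation of loops, that is addition of integers ([circOp], [windingAdd]).
    - For n ≥ 2 the loop space K(ℤ,n-1) of K(ℤ,n) is itself connected, all loops are
      merely equal and Hⁿ = 0 ([circTriv]).
    - ℤ is a set, so that maps S¹ → ℤ are constant and H⁰ is ℤ by evaluation at the
      base point ([evalBaseK]).
    The defining equations of the cup product say that multiplication by a class of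
    degree 0 multiplies the winding number by an integer, on either side ([cup01],
    [cup10]); the product of two classes of degree 1 lies in H² = 0.

    Hence an element of the cohomology ring is a pair of integers (x₀, x₁), with the
    operations of the dual numbers ℤ[ε]/(ε²).  The same is true of ℤ[X]/(X²), where the
    pair consists of the coefficients of degree 0 and 1.  Such a description ([IsDual])
    of the operations of a set implies the ring axioms, since they hold for pairs
    ([dualRing]), and two rings with such a description are isomorphic ([dualIso]).
    The lemma [grIso] reduces the theorem to the facts above about H⁰, H¹ and Hⁿ.

    The theorem asks for a closed term of the object language and a derivation of its
    typing judgement.  The term is built as a list of definitions, each with a type and
    a body that may name the earlier ones.  They are written with implicit arguments and
    holes, which the function [elab] fills in by unification.  Nothing is proved about [elab]:
    its output is a fully explicit term, and a type checker [infer], sound for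
    the judgement [typ] ([infer_sound]), validates the whole list by computation.
    Substituting the definitions into one another then gives the closed term
    ([library_theorem]). *)

(** * Renaming and substitution in raw terms *)

Lemma rename_ext r r' t : (forall n, r n = r' n) -> rename r t = rename r' t.
Proof.
  revert r r'; induction t; intros r r' E; simpl; f_equal; auto;
    apply IHt2; intros [|n]; simpl; congruence.
Qed.

Lemma subst_ext s s' t : (forall n, s n = s' n) -> subst s t = subst s' t.
Proof.
  revert s s'; induction t; intros s s' E; simpl; f_equal; auto;
    apply IHt2; intros [|n]; simpl; congruence.
Qed.

Fixpoint closedn (k : nat) (t : term) : Prop :=
  match t with
  | Var n => n < k
  | Sort _ | Cst _ => True
  | Pi A B | Lam A B => closedn k A /\ closedn (S k) B
  | App t u => closedn k t /\ closedn k u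
  end.

Lemma rename_closed t k r : closedn k t -> (forall n, n < k -> r n = n) -> rename r t = t.
Proof.
  revert k r; induction t; simpl; intros k r C E; f_equal; try apply E; try easy;
    try (eapply IHt1; [apply C|exact E]); try (eapply IHt2; [apply C|]); try exact E;
    intros [|m] L; simpl; auto; rewrite E; lia.
Qed.

Lemma subst_closed t k s : closedn k t -> (forall n, n < k -> s n = Var n) -> subst s t = t.
Proof.
  revert k s; induction t; simpl; intros k s C E; try (f_equal; easy); try (apply E; easy);
    f_equal; try (eapply IHt1; [apply C|exact E]); try (eapply IHt2; [apply C|]); try exact E;
    intros [|m] L; simpl; auto; rewrite E; simpl; auto; lia.
Qed.

Lemma typ_closed Γ t A : typ Γ t A -> closedn (length Γ) t.
Proof.
  induction 1; simpl in *; auto.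
  apply nth_error_Some; congruence.
Qed.

Lemma typ_weaken Γ Δ t A : typ Γ t A -> typ (Γ ++ Δ) t A.
Proof.
  induction 1; try (econstructor; eauto; fail).
  constructor. rewrite nth_error_app1; [assumption|].
  apply nth_error_Some; congruence.
Qed.

Lemma subst_rename_id t s r : (forall n, s (r n) = Var n) -> subst s (rename r t) = t.
Proof.
  revert s r; induction t; intros s r E; simpl; auto; f_equal; auto;
    apply IHt2; intros [|n]; simpl; auto; rewrite E; auto.
Qed.

(** By η, a λ-abstraction is convertible to one with any other annotation, so that a
    conversion test need not look at annotations. *)
Lemma conv_Lam_any A A' t t' : conv t t' -> conv (Lam A t) (Lam A' t').
Proof.
  intros H.
  apply conv_trans with (Lam A t'). { apply conv_Lam; [apply conv_refl|assumption]. }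
  apply conv_trans with (Lam A (App (rename S (Lam A' t')) (Var 0))); [|apply conv_eta].
  apply conv_Lam; [apply conv_refl|].
  apply conv_sym. simpl.
  eapply conv_trans; [apply conv_beta|].
  unfold subst1. rewrite subst_rename_id; [apply conv_refl|]. intros [|n]; reflexivity.
Qed.

Lemma rename_rename r r' t : rename r (rename r' t) = rename (fun n => r (r' n)) t.
Proof.
  revert r r'; induction t; intros r r'; simpl; f_equal; auto;
    rewrite IHt2; apply rename_ext; intros [|n]; reflexivity.
Qed.

Lemma subst_rename s r t : subst s (rename r t) = subst (fun n => s (r n)) t.
Proof.
  revert s r; induction t; intros s r; simpl; f_equal; auto;
    rewrite IHt2; apply subst_ext; intros [|n]; reflexivity.
Qed.

Lemma rename_subst r s t : rename r (subst s t) = subst (fun n => rename r (s n)) t.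
Proof.
  revert s r; induction t; intros s r; simpl; f_equal; auto;
    rewrite IHt2; apply subst_ext; intros [|n]; simpl; auto;
    rewrite !rename_rename; reflexivity.
Qed.

Lemma subst_subst s s' t : subst s (subst s' t) = subst (fun n => subst s (s' n)) t.
Proof.
  revert s s'; induction t; intros s s'; simpl; f_equal; auto;
    rewrite IHt2; apply subst_ext; intros [|n]; simpl; auto;
    rewrite subst_rename, rename_subst; reflexivity.
Qed.

Lemma rename_id t r : (forall n, r n = n) -> rename r t = t.
Proof.
  revert r; induction t; intros r E; simpl; f_equal; auto;
    apply IHt2; intros [|n]; simpl; auto.
Qed.

Lemma rename_as_subst r t : rename r t = subst (fun n => Var (r n)) t.
Proof.
  revert r; induction t; intros r; simpl; f_equal; auto;
    rewrite IHt2; apply subst_ext; intros [|n]; reflexivity.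
Qed.

Lemma subst_up_rename s t : subst (up s) (rename S t) = rename S (subst s t).
Proof. rewrite subst_rename, rename_subst. reflexivity. Qed.

Lemma subst_subst1 s u t : subst s (subst1 u t) = subst1 (subst s u) (subst (up s) t).
Proof.
  unfold subst1. rewrite !subst_subst. apply subst_ext. intros [|n]; simpl; auto.
  symmetry. apply subst_rename_id. reflexivity.
Qed.

Lemma iota_subst s t u : iota t u -> iota (subst s t) (subst s u).
Proof. destruct 1; cbn; constructor. Qed.

Lemma conv_subst s t u : conv t u -> conv (subst s t) (subst s u).
Proof.
  intros H. revert s. induction H; intros s; simpl.
  - apply conv_refl.
  - apply conv_sym; auto.
  - eapply conv_trans; auto.
  - rewrite subst_subst1. apply conv_beta.
  - rewrite subst_up_rename. apply conv_eta.
  - apply conv_iota, iota_subst. assumption.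
  - apply conv_Pi; auto.
  - apply conv_Lam; auto.
  - apply conv_App; auto.
Qed.

Lemma ctype_subst s c i j : subst s (close (ctype c i j)) = close (ctype c i j).
Proof. destruct c; reflexivity. Qed.

Lemma typ_rename Γ t A : typ Γ t A -> forall Δ r,
  (forall n B, nth_error Γ n = Some B -> exists B', nth_error Δ (r n) = Some B' /\
     rename (fun m => S (r n) + m) B' = rename r (rename (fun m => S n + m) B)) ->
  typ Δ (rename r t) (rename r A).
Proof.
  induction 1; intros Δ r R; cbn [rename].
  - destruct (R _ _ H) as (B' & E & <-). now apply typ_Var.
  - apply typ_Sort.
  - apply typ_Pi; [apply IHtyp1, R|apply IHtyp2].
    intros [|n] C E; simpl in *.
    + injection E as <-. eexists; split; [reflexivity|]. rewrite !rename_rename. reflexivity.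
    + destruct (R _ _ E) as (B' & E' & E2). exists B'; split; [exact E'|].
      apply (f_equal (rename S)) in E2. rewrite !rename_rename in *. exact E2.
  - eapply typ_Lam; [apply IHtyp1, R|apply IHtyp2].
    intros [|n] C E; simpl in *.
    + injection E as <-. eexists; split; [reflexivity|]. rewrite !rename_rename. reflexivity.
    + destruct (R _ _ E) as (B' & E' & E2). exists B'; split; [exact E'|].
      apply (f_equal (rename S)) in E2. rewrite !rename_rename in *. exact E2.
  - replace (rename r (subst1 u B)) with (subst1 (rename r u) (rename (upren r) B)).
    + eapply typ_App; [apply IHtyp1, R|apply IHtyp2, R].
    + rewrite !rename_as_subst. rewrite subst_subst1. f_equal.
      apply subst_ext. intros [|n]; reflexivity.
  - rewrite rename_as_subst, ctype_subst. apply typ_Cst.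
  - eapply typ_cumul; [apply IHtyp, R|assumption].
  - eapply typ_conv; [apply IHtyp1, R| |apply IHtyp2, R].
    rewrite !rename_as_subst. now apply conv_subst.
Qed.

Lemma typ_shift Γ A t B : typ Γ t B -> typ (A :: Γ) (rename S t) (rename S B).
Proof.
  intros H. apply (typ_rename _ _ _ H). intros n C E. exists C. split; [exact E|].
  rewrite rename_rename. reflexivity.
Qed.

Lemma typ_subst Γ t A : typ Γ t A -> forall Δ s,
  (forall n B, nth_error Γ n = Some B -> typ Δ (s n) (subst s (rename (fun m => S n + m) B))) ->
  typ Δ (subst s t) (subst s A).
Proof.
  assert (U : forall Γ Δ s A,
    (forall n B, nth_error Γ n = Some B -> typ Δ (s n) (subst s (rename (fun m => S n + m) B))) ->
    forall n B, nth_error (A :: Γ) n = Some B ->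
      typ (subst s A :: Δ) (up s n) (subst (up s) (rename (fun m => S n + m) B))).
  { clear. intros Γ Δ s A R [|n] B E; simpl in E.
    - injection E as ->. rewrite subst_up_rename. apply (typ_Var _ 0). reflexivity.
    - apply R in E. apply (typ_shift _ (subst s A)) in E. rewrite <- subst_up_rename in E.
      rewrite rename_rename in E. exact E. }
  induction 1; intros Δ s R; simpl; try (econstructor; eauto; fail).
  - apply R. assumption.
  - rewrite subst_subst1. eapply typ_App; eauto.
  - rewrite ctype_subst. apply typ_Cst.
  - eapply typ_conv; eauto. now apply conv_subst.
Qed.

Lemma typ_subst1 Γ A B u i :
  typ (A :: Γ) B (Sort i) -> typ Γ u A -> typ Γ (subst1 u B) (Sort i).
Proof.
  intros HB Hu. apply (typ_subst _ _ _ HB). intros [|n] C E; simpl in E.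
  - injection E as <-. rewrite subst_rename_id; [exact Hu|reflexivity].
  - rewrite subst_rename.
    change (typ Γ (Var n) (subst (fun m => Var (S n + m)) C)).
    rewrite <- rename_as_subst. now apply typ_Var.
Qed.

Lemma Pi_inv Γ A B T : typ Γ (Pi A B) T ->
  exists i, typ Γ A (Sort i) /\ typ (A :: Γ) B (Sort i).
Proof.
  intros H. remember (Pi A B) as P eqn:E. revert A B E.
  induction H; intros A' B' E; try discriminate; eauto.
  injection E as <- <-. eauto.
Qed.

(** * Terms with names *)

(** Raw terms extended with names: [tGlob k] is the definition number [k] and
    [tMeta k] an argument still to be found. *)
Inductive tm : Type :=
| tVar (n : nat)
| tSort (i : nat)
| tPi (A B : tm)
| tLam (A t : tm)
| tApp (t u : tm)
| tCst (c : cst)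
| tGlob (k : nat)
| tMeta (k : positive).

Fixpoint emb (t : term) : tm :=
  match t with
  | Var n => tVar n
  | Sort i => tSort i
  | Pi A B => tPi (emb A) (emb B)
  | Lam A t => tLam (emb A) (emb t)
  | App t u => tApp (emb t) (emb u)
  | Cst c => tCst c
  end.

Fixpoint lift (c d : nat) (t : tm) : tm :=
  match t with
  | tVar n => tVar (if c <=? n then d + n else n)
  | tPi A B => tPi (lift c d A) (lift (S c) d B)
  | tLam A t => tLam (lift c d A) (lift (S c) d t)
  | tApp t u => tApp (lift c d t) (lift c d u)
  | _ => t
  end.

Definition lift0 (k : nat) (u : tm) : tm := match k with 0 => u | _ => lift 0 k u end.

(** Substitutes the entries of [l] for the variables [k], [k + 1], … at once; the
    substituted terms are lifted only when they go below a binder. *)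
Fixpoint instl (l : list tm) (k : nat) (t : tm) : tm :=
  match t with
  | tVar n => if n <? k then t else
      match nth_error l (n - k) with Some u => lift0 k u | None => tVar (n - length l) end
  | tPi A B => tPi (instl l k A) (instl l (S k) B)
  | tLam A B => tLam (instl l k A) (instl l (S k) B)
  | tApp A B => tApp (instl l k A) (instl l k B)
  | _ => t
  end.

Section Erasure.
Variable I : nat -> term.
Hypothesis I_closed : forall k, closedn 0 (I k).

(** Names become closed terms, which no substitution affects.  The image of a metavariable
    is arbitrary. *)
Fixpoint erase (t : tm) : term :=
  match t with
  | tVar n => Var n
  | tSort i => Sort i
  | tPi A B => Pi (erase A) (erase B)
  | tLam A t => Lam (erase A) (erase t)
  | tApp t u => App (erase t) (erase u)
  | tCst c => Cst c
  | tGlob k => I k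
  | tMeta _ => Sort 0
  end.

Lemma erase_emb t : erase (emb t) = t.
Proof. induction t; simpl; congruence. Qed.

Lemma erase_lift m d t :
  erase (lift m d t) = rename (fun n => if m <=? n then d + n else n) (erase t).
Proof.
  revert m; induction t; intros m; simpl; f_equal; auto.
  - rewrite IHt2. apply rename_ext. intros [|n]; simpl; auto. destruct (m <=? n); lia.
  - rewrite IHt2. apply rename_ext. intros [|n]; simpl; auto. destruct (m <=? n); lia.
  - symmetry. apply rename_closed with 0; auto. lia.
Qed.

Lemma erase_lift0 d t : erase (lift 0 d t) = rename (fun n => d + n) (erase t).
Proof. apply erase_lift. Qed.

Definition subst_list (l : list term) (n : nat) : term :=
  match nth_error l n with Some u => u | None => Var (n - length l) end.

Fixpoint ups (k : nat) (s : nat -> term) : nat -> term :=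
  match k with 0 => s | S k => up (ups k s) end.

Lemma ups_subst_list k l n : ups k (subst_list l) n =
  if n <? k then Var n else
  match nth_error l (n - k) with Some u => rename (fun m => k + m) u | None => Var (n - length l) end.
Proof.
  revert n; induction k; intros n; simpl.
  - rewrite Nat.sub_0_r. unfold subst_list. destruct (nth_error l n); auto.
    symmetry. apply rename_id. reflexivity.
  - destruct n as [|n]; simpl; auto. rewrite IHk. change (S n <? S k) with (n <? k).
    destruct (n <? k) eqn:E; auto. apply Nat.ltb_ge in E.
    destruct (nth_error l (n - k)) eqn:En; simpl; [apply rename_rename|].
    f_equal. apply nth_error_None in En. destruct (length l); lia.
Qed.

Lemma erase_instl l k t : erase (instl l k t) = subst (ups k (subst_list (map erase l))) (erase t).
Proof.
  revert k; induction t; intros k'; simpl; f_equal; auto.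
  - rewrite ups_subst_list, nth_error_map, length_map. destruct (n <? k'); auto.
    destruct (nth_error l (n - k')); simpl; auto.
    destruct k'; simpl; [symmetry; apply rename_id; reflexivity|apply erase_lift0].
  - symmetry. apply subst_closed with 0; auto. lia.
Qed.

Lemma subst1_up a s t : subst1 a (subst (up s) t) = subst (fun n => match n with 0 => a | S n => s n end) t.
Proof.
  unfold subst1. rewrite subst_subst. apply subst_ext. intros [|n]; simpl; auto.
  apply subst_rename_id. reflexivity.
Qed.

(** Consecutive single substitutions, as produced by typing a chain of applications,
    amount to one simultaneous substitution. *)
Lemma erase_instl_cons a l t :
  subst1 (erase a) (subst (up (subst_list (map erase l))) (erase t)) = erase (instl (a :: l) 0 t).
Proof. rewrite subst1_up, erase_instl. apply subst_ext. intros [|n]; reflexivity. Qed.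

Lemma erase_instl_nil t : erase (instl [] 0 t) = erase t.
Proof.
  rewrite erase_instl. rewrite <- (rename_id (erase t) (fun n => n)) at 1 by reflexivity.
  apply subst_rename_id. intros n. unfold subst_list. simpl. destruct n; simpl; f_equal; lia.
Qed.
End Erasure.

(** * A type checker *)

(** Call by value would evaluate both arguments of [andb]. *)
Notation "a &&& b" := (if a then b else false) (at level 40, left associativity).

Definition mkapps (h : tm) (l : list tm) : tm := fold_left tApp l h.

Fixpoint splitat (k : nat) (l : list tm) : option (list tm * tm * list tm) :=
  match l with
  | [] => None
  | x :: r =>
      match k with
      | 0 => Some ([], x, r)
      | S k => match splitat k r with
               | Some (a, y, b) => Some (x :: a, y, b) | None => None end
      end
  end.

Definition elim_pos (c : cst) : option nat :=
  match c with
  | cUnitInd => Some 2 | cSumInd => Some 5 | cSigInd => Some 4 | cNatInd => Some 3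
  | cJ => Some 5 | cCircInd => Some 3 | cTrInd => Some 5 | cQuotInd => Some 6
  | cDSInd => Some 13 | _ => None
  end.

Definition istep (c : cst) (pre : list tm) (c' : cst) (l : list tm) : option (tm * list tm) :=
  match c with
  | cUnitInd => match pre, c', l with
      | [_; d], cTT, [] => Some (d, []) | _, _, _ => None end
  | cSumInd => match pre, c', l with
      | [_; _; _; f; _], cInl, [_; _; a] => Some (f, [a])
      | [_; _; _; _; g], cInr, [_; _; b] => Some (g, [b])
      | _, _, _ => None end
  | cSigInd => match pre, c', l with
      | [_; _; _; f], cPair, [_; _; a; b] => Some (f, [a; b]) | _, _, _ => None end
  | cNatInd => match pre, c', l with
      | [_; z; _], cO, [] => Some (z, [])
      | [P; z; s], cS, [n] => Some (s, [n; mkapps (tCst cNatInd) [P; z; s; n]])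
      | _, _, _ => None end
  | cJ => match pre, c', l with
      | [_; _; _; d; _], cRefl, [_; _] => Some (d, []) | _, _, _ => None end
  | cCircInd => match pre, c', l with
      | [_; b; _], cBase, [] => Some (b, []) | _, _, _ => None end
  | cTrInd => match pre, c', l with
      | [_; _; _; _; f], cTrIn, [_; _; a] => Some (f, [a]) | _, _, _ => None end
  | cQuotInd => match pre, c', l with
      | [_; _; _; _; f; _], cQuotIn, [_; _; a] => Some (f, [a]) | _, _, _ => None end
  | cDSInd => match pre with
      | [_; _; _; _; _; pz; pb; pa; _; _; _; _; _] =>
          match c', l with
          | cDSZero, [_; _; _] => Some (pz, [])
          | cDSBase, [_; _; _; n; x] => Some (pb, [n; x])
          | cDSAdd, [_; _; _; x; y] =>
              let ind := mkapps (tCst cDSInd) pre in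
              Some (pa, [x; y; tApp ind x; tApp ind y])
          | _, _ => None end
      | _ => None end
  | _ => None
  end.

Scheme Boolean Equality for cst.

Fixpoint tm_eqb (t u : tm) : bool :=
  match t, u with
  | tVar m, tVar n | tSort m, tSort n | tGlob m, tGlob n => m =? n
  | tPi A B, tPi A' B' | tLam A B, tLam A' B' | tApp A B, tApp A' B' => tm_eqb A A' &&& tm_eqb B B'
  | tCst c, tCst c' => cst_beq c c'
  | _, _ => false
  end.

(** Contracts as many β-redexes as possible with a single traversal of the body. *)
Fixpoint betas (l : list tm) (f : tm) (args : list tm) : tm * list tm :=
  match f, args with
  | tLam _ b, a :: r => betas (a :: l) b r
  | _, _ => (instl l 0 f, args)
  end.

Section Reduction.
Variable G : nat -> option (tm * tm).
Variable M : positive -> option tm.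

(** Weak head normal form of [h] applied to [args].  Names in head position are unfolded
    only if [δ] is set, but always when they block an eliminator. *)
Fixpoint whnf (δ : bool) (n : nat) (h : tm) (args : list tm) : tm * list tm :=
  match n with
  | 0 => (h, args)
  | S n =>
      match h with
      | tApp f a => whnf δ n f (a :: args)
      | tLam _ b => match args with
                    | a :: r => let (f, r) := betas [a] b r in whnf δ n f r | [] => (h, args) end
      | tCst c =>
          match elim_pos c with
          | None => (h, args)
          | Some k =>
              match splitat k args with
              | None => (h, args)
              | Some (pre, s, post) =>
                  match whnf true n s [] with
                  | (tCst c', l) =>
                      match istep c pre c' l with
                      | Some (g, l') => whnf δ n g (l' ++ post)
                      | None => (h, args)
                      end
                  | _ => (h, args)
                  end
              end
          end
      | tGlob k => if δ then match G k with
                             | Some (b, _) => whnf δ n b args | None => (h, args) end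
                   else (h, args)
      | tMeta k => match M k with Some b => whnf δ n b args | None => (h, args) end
      | _ => (h, args)
      end
  end.

(** Bounds the depth of recursion; a computation that exhausts it is rejected. *)
Definition fuel : nat := Nat.pow 2 14.
Definition whd_full (t : tm) : tm * list tm := whnf true fuel t [].

Fixpoint all2 (p : tm -> tm -> bool) (l l' : list tm) : bool :=
  match l, l' with
  | [], [] => true
  | x :: l, y :: l' => p x y &&& all2 p l l'
  | _, _ => false
  end.

Definition head_eq (h h' : tm) : bool :=
  match h, h' with
  | tVar m, tVar n | tGlob m, tGlob n => m =? n
  | tCst c, tCst c' => cst_beq c c'
  | _, _ => false
  end.

Definition body (k : nat) : option tm :=
  match G k with Some (b, _) => Some b | None => None end.

(** Of two names the later one is unfolded, since the earlier one may occur in its body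
    but not conversely. *)
Definition unfold2 (h h' : tm) : option (tm * tm) :=
  match h, h' with
  | tGlob k, tGlob k' =>
      if k' <=? k then match body k with Some b => Some (b, h') | None => None end
      else match body k' with Some b => Some (h, b) | None => None end
  | tGlob k, _ => match body k with Some b => Some (b, h') | None => None end
  | _, tGlob k' => match body k' with Some b => Some (h, b) | None => None end
  | _, _ => None
  end.

(** Names are compared before they are unfolded: equal names with convertible arguments
    settle the question without the cost of expanding the bodies. *)
Fixpoint convb (n : nat) (t u : tm) : bool :=
  match n with
  | 0 => false
  | S n =>
      if tm_eqb t u then true else
      match whnf false fuel t [], whnf false fuel u [] with
      | (h, l), (h', l') =>
          match h, l, h', l' with
          | tLam _ b, [], tLam _ b', [] => convb n b b'
          | tLam _ b, [], _, _ => convb n b (tApp (lift 0 1 (mkapps h' l')) (tVar 0))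
          | _, _, tLam _ b', [] => convb n (tApp (lift 0 1 (mkapps h l)) (tVar 0)) b'
          | tPi A B, [], tPi A' B', [] => convb n A A' &&& convb n B B'
          | tSort i, [], tSort j, [] => i =? j
          | _, _, _, _ =>
              if head_eq h h' &&& all2 (convb n) l l' then true
              else match unfold2 h h' with
                   | Some (g, g') => convb n (mkapps g l) (mkapps g' l')
                   | None => false
                   end
          end
      end
  end.

(** The judgement [typ] allows a constant at all levels [i] and [j].  Suitable levels are
    the universes of the arguments at these positions, the first list for [i] and the
    second for [j]. *)
Definition level_args (c : cst) : list nat * list nat :=
  match c with
  | cEmptyInd | cUnitInd | cNatInd | cCircInd | cCircIndLoop => ([], [0])
  | cSum | cInl | cInr | cSig | cPair | cFunext | cUA
  | cQuot | cQuotIn | cQuotEq | cQuotSet => ([0; 1], [])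
  | cSumInd | cSigInd | cQuotInd => ([0; 1], [2])
  | cId | cRefl => ([0], [])
  | cJ => ([0], [2])
  | cTr | cTrIn | cTrLevel => ([1], [])
  | cTrInd => ([1], [2])
  | cDS | cDSZero | cDSBase | cDSAdd | cDSAssoc | cDSComm | cDSUnit
  | cDSBaseZero | cDSBaseAdd | cDSSet => ([0], [])
  | cDSInd => ([0], [3])
  | _ => ([], [])
  end.

(** The universe in which a type family, or a type, takes its values. *)
Fixpoint cod_sort (n : nat) (T : tm) : nat :=
  match n with
  | 0 => 0
  | S n => match whd_full T with
           | (tPi _ B, []) => cod_sort n B
           | (tSort i, []) => i
           | _ => 0
           end
  end.

Definition arg_level (tys : list tm) (ps : list nat) : nat :=
  fold_right (fun p m => match nth_error tys p with
                         | Some T => Nat.max (cod_sort 10 T) m | None => m end) 0 ps.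

Fixpoint unapp (t : tm) (l : list tm) : tm * list tm :=
  match t with tApp f a => unapp f (a :: l) | _ => (t, l) end.

Definition levels_ok (v : bool) (i j : nat) : bool :=
  if v then true else (i <=? 1) &&& (j <=? 2).

(** The conversion rule requires its target to be a type.  With [v] set, this is checked
    at each conversion.  Otherwise it is left to the invariant that inferred types are
    types, which holds as soon as the types of the constants are types; the levels are
    then restricted to a finite range, in which the latter can be verified beforehand. *)
Section Infer.
Variable v : bool.
Variable rec : list tm -> tm -> option tm.

Definition sortof (Γ : list tm) (A : tm) : option nat :=
  match rec Γ A with
  | Some T => match whd_full T with (tSort i, []) => Some i | _ => None end
  | None => None
  end.

(** Cumulativity moves a type to a higher universe, but it does not move a family
    A → U i to A → U k.  If the family is given by a λ-abstraction, its body can be moved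
    instead; [raise] returns the type that the family then has. *)
Fixpoint raise (Γ : list tm) (a : tm) (i : nat) : option tm :=
  match a with
  | tLam A b =>
      match sortof Γ A, raise (A :: Γ) b i with
      | Some _, Some T => Some (tPi A T) | _, _ => None end
  | _ => match sortof Γ a with
         | Some k => if k <=? i then Some (tSort i) else None | None => None end
  end.

Definition checkb (Γ : list tm) (a ta A : tm) : bool :=
  if tm_eqb ta A then true else
  match A with
  | tSort i => match whd_full ta with (tSort k, []) => k <=? i | _ => false end
  | _ => if (if v then match sortof Γ A with Some _ => true | None => false end else true) then
             if convb fuel ta A then true else
             match raise Γ a (cod_sort 10 A) with
             | Some T => convb fuel T A | None => false end
         else false
  end.

Definition as_pi (Γ : list tm) (T : tm) : option (tm * tm) :=
  match T with
  | tPi A B => Some (A, B)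
  | _ => match whd_full T with
         | (tPi A B, []) => match sortof Γ (tPi A B) with
                            | Some _ => Some (A, B) | None => None end
         | _ => None
         end
  end.

Fixpoint infer_list (Γ : list tm) (l : list tm) : option (list tm) :=
  match l with
  | [] => Some []
  | a :: l => match rec Γ a, infer_list Γ l with
              | Some T, Some r => Some (T :: r) | _, _ => None end
  end.

(** The type of an application to the arguments [l], of types [tys]; the substitution
    [e] into the type [T] is delayed until all arguments are used. *)
Fixpoint spine (Γ : list tm) (T : tm) (e : list tm) (l tys : list tm) : option tm :=
  match l, tys with
  | [], _ => Some (instl e 0 T)
  | a :: l, ta :: tys =>
      match T with
      | tPi A B => if checkb Γ a ta (instl e 0 A) then spine Γ B (a :: e) l tys else None
      | _ =>
      match as_pi Γ (instl e 0 T) with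
      | Some (A, B) => if checkb Γ a ta A then spine Γ B [a] l tys else None
      | None => None
      end end
  | _, _ => None
  end.
End Infer.

Fixpoint infer (v : bool) (n : nat) (Γ : list tm) (t : tm) : option tm :=
  match n with
  | 0 => None
  | S n =>
      let rec := infer v n in
      match t with
      | tVar k => match nth_error Γ k with Some A => Some (lift 0 (S k) A) | None => None end
      | tSort i => Some (tSort (S i))
      | tPi A B => match sortof rec Γ A, sortof rec (A :: Γ) B with
                   | Some i, Some j => Some (tSort (Nat.max i j)) | _, _ => None end
      | tLam A b => match sortof rec Γ A, rec (A :: Γ) b with
                    | Some _, Some B => Some (tPi A B) | _, _ => None end
      | tGlob k => match G k with Some (_, T) => Some T | None => None end
      | tMeta _ => None
      | tCst c => Some (emb (close (ctype c 0 0)))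
      | tApp _ _ =>
          let (h, l) := unapp t [] in
          match infer_list rec Γ l with
          | None => None
          | Some tys =>
              match h with
              | tCst c =>
                  let (ps, qs) := level_args c in
                  let i := arg_level tys ps in let j := arg_level tys qs in
                  if levels_ok v i j then spine v rec Γ (emb (close (ctype c i j))) [] l tys
                  else None
              | _ => match rec Γ h with Some T => spine v rec Γ T [] l tys | None => None end
              end
          end
      end
  end.
End Reduction.

(** * Soundness of the type checker *)

Lemma cst_beq_true c c' : cst_beq c c' = true -> c = c'.
Proof. destruct c, c'; reflexivity || discriminate. Qed.

Lemma tm_eqb_true t u : tm_eqb t u = true -> t = u.
Proof.
  revert u; induction t; intros []; simpl; intros E; try discriminate;
    try (apply andb_true_iff in E as [E1 E2]);
    try (apply Nat.eqb_eq in E; congruence); f_equal; auto.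
  now apply cst_beq_true.
Qed.

Lemma splitat_eq k l a x b : splitat k l = Some (a, x, b) -> l = a ++ x :: b.
Proof.
  revert l a; induction k; intros [|y l] a; simpl; intros E; try discriminate.
  - now injection E as <- <- <-.
  - destruct (splitat k l) as [[[a' y'] b']|] eqn:E'; [|discriminate].
    injection E as <- <- <-. simpl. f_equal. auto.
Qed.

(** Names are interpreted by closed terms [I k] whose types are the interpretations of
    the declared ones. *)
Section Soundness.
Variable G : nat -> option (tm * tm).
Variable M : positive -> option tm.
Variable I : nat -> term.
Hypothesis M_none : forall k, M k = None.
Hypothesis I_closed : forall k, closedn 0 (I k).
Hypothesis G_sound : forall k b T, G k = Some (b, T) ->
  I k = erase I b /\ typ [] (I k) (erase I T) /\ exists i, typ [] (erase I T) (Sort i).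

Notation erase := (erase I).
Notation apps t l := (fold_left App l t).

Lemma erase_mkapps h l : erase (mkapps h l) = apps (erase h) (map erase l).
Proof. revert h; induction l; intros h; [reflexivity|apply IHl]. Qed.

Lemma mkapps_app h l l' : mkapps h (l ++ l') = mkapps (mkapps h l) l'.
Proof. apply fold_left_app. Qed.

Lemma conv_apps t t' l : conv t t' -> conv (apps t l) (apps t' l).
Proof.
  revert t t'; induction l; simpl; auto.
  intros. apply IHl. apply conv_App; auto. apply conv_refl.
Qed.

Lemma istep_sound c pre c' l g l' :
  istep c pre c' l = Some (g, l') ->
  iota (erase (mkapps (tCst c) (pre ++ [mkapps (tCst c') l]))) (erase (mkapps g l')).
Proof.
  unfold istep. intros E.
  destruct c; try discriminate E;
    repeat (match type of E with context [match ?x with _ => _ end] => destruct x end;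
            try discriminate E);
    injection E as <- <-; cbn; constructor.
Qed.

Lemma betas_sound l f args h r : betas l f args = (h, r) ->
  conv (apps (subst (subst_list (map erase l)) (erase f)) (map erase args)) (erase (mkapps h r)).
Proof.
  revert l f h r; induction args as [|a args IH]; intros l f h r E.
  - assert (E' : (instl l 0 f, []) = (h, r)) by (destruct f; exact E).
    injection E' as <- <-. simpl. rewrite erase_instl by assumption. apply conv_refl.
  - assert (N : (instl l 0 f, a :: args) = (h, r) ->
       conv (apps (subst (subst_list (map erase l)) (erase f)) (map erase (a :: args))) (erase (mkapps h r))).
    { intros E'. injection E' as <- <-. rewrite erase_mkapps, erase_instl by assumption. apply conv_refl. }
    destruct f; try (apply N; exact E). simpl in E. apply IH in E.
    eapply conv_trans; [|apply E]. simpl. apply conv_apps.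
    eapply conv_trans; [apply conv_beta|].
    rewrite erase_instl_cons by assumption. rewrite erase_instl by assumption. apply conv_refl.
Qed.

Lemma whnf_sound δ n : forall h l h' l',
  whnf G M δ n h l = (h', l') -> conv (erase (mkapps h l)) (erase (mkapps h' l')).
Proof.
  revert δ; induction n; intros δ h l h' l' E; simpl in E.
  { injection E as <- <-. apply conv_refl. }
  destruct h; try (injection E as <- <-; apply conv_refl).
  - destruct l as [|a l]; [injection E as <- <-; apply conv_refl|].
    destruct (betas [a] h2 l) as [f r] eqn:Eb. apply betas_sound in Eb.
    apply IHn in E. eapply conv_trans; [|apply E]. eapply conv_trans; [|apply Eb].
    rewrite erase_mkapps. simpl. apply conv_apps. eapply conv_trans; [apply conv_beta|].
    match goal with |- conv ?x ?y => replace y with x; [apply conv_refl|] end.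
    apply subst_ext. intros [|n']; simpl; [reflexivity|]. unfold subst_list. simpl.
    destruct n'; reflexivity.
  - now apply IHn in E.
  - destruct (elim_pos c) as [k|]; [|injection E as <- <-; apply conv_refl].
    destruct (splitat k l) as [[[pre s] post]|] eqn:Es; [|injection E as <- <-; apply conv_refl].
    destruct (whnf G M true n s []) as [g r] eqn:Ew.
    destruct g; try (injection E as <- <-; apply conv_refl).
    destruct (istep c pre c0 r) as [[g l1]|] eqn:Ei; [|injection E as <- <-; apply conv_refl].
    apply IHn in E. apply IHn in Ew. apply splitat_eq in Es as ->.
    eapply conv_trans; [|apply E]. apply istep_sound in Ei.
    change (pre ++ s :: post) with (pre ++ [s] ++ post).
    rewrite app_assoc, !mkapps_app, 2!(erase_mkapps _ post). apply conv_apps.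
    eapply conv_trans; [|apply conv_iota, Ei].
    rewrite mkapps_app. simpl. apply conv_App; [apply conv_refl|apply Ew].
  - destruct δ; [|injection E as <- <-; apply conv_refl].
    destruct (G k) as [[b T]|] eqn:Eg; [|injection E as <- <-; apply conv_refl].
    apply IHn in E. eapply conv_trans; [|apply E].
    rewrite !erase_mkapps. simpl. apply G_sound in Eg as [-> _]. apply conv_refl.
  - rewrite M_none in E. injection E as <- <-. apply conv_refl.
Qed.

Lemma whd_full_sound t h l : whd_full G M t = (h, l) -> conv (erase t) (erase (mkapps h l)).
Proof. intros E. apply whnf_sound in E. exact E. Qed.

Lemma all2_conv p l l' t t' :
  (forall x y, p x y = true -> conv (erase x) (erase y)) ->
  all2 p l l' = true -> conv t t' -> conv (apps t (map erase l)) (apps t' (map erase l')).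
Proof.
  intros Hp. revert l' t t'; induction l; intros [|y l'] t t'; simpl; try easy.
  intros [E1 E2]%andb_true_iff C. apply IHl; auto. apply conv_App; auto.
Qed.

Lemma head_eq_true h h' : head_eq h h' = true -> h = h'.
Proof.
  destruct h, h'; simpl; try discriminate; intros E;
    try (apply Nat.eqb_eq in E; congruence).
  apply cst_beq_true in E. congruence.
Qed.

Lemma unfold2_conv h h' g g' : unfold2 G h h' = Some (g, g') ->
  erase h = erase g /\ erase h' = erase g'.
Proof.
  assert (B : forall k b, body G k = Some b -> I k = erase b).
  { unfold body. intros k b. destruct (G k) as [[b' T]|] eqn:E; [|discriminate].
    intros [= <-]. eapply G_sound; eauto. }
  unfold unfold2. intros E.
  repeat match type of E with
         | context [match body ?g ?x with _ => _ end] => destruct (body g x) eqn:?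
         | context [match ?x with _ => _ end] => destruct x
         end; try discriminate; injection E as <- <-; simpl; auto.
Qed.

Lemma convb_sound n t u : convb G M n t u = true -> conv (erase t) (erase u).
Proof.
  revert t u; induction n; intros t u E; [discriminate|]. cbn [convb] in E.
  destruct (tm_eqb t u) eqn:Et. { apply tm_eqb_true in Et as ->. apply conv_refl. }
  destruct (whnf G M false fuel t []) as [h l] eqn:E1.
  destruct (whnf G M false fuel u []) as [h' l'] eqn:E2.
  apply whnf_sound in E1, E2. simpl in E1, E2.
  eapply conv_trans; [apply E1|]. eapply conv_trans; [|apply conv_sym, E2].
  clear Et E1 E2 t u.
  (* [fb] is the branch shared by all the pairs of heads without a rule of their own. *)
  set (fb := if head_eq h h' &&& all2 (convb G M n) l l' then true
             else match unfold2 G h h' with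
                  | Some (g, g') => convb G M n (mkapps g l) (mkapps g' l')
                  | None => false end) in E.
  assert (F : fb = true -> conv (erase (mkapps h l)) (erase (mkapps h' l'))).
  { subst fb. clear E. destruct (head_eq h h' &&& all2 (convb G M n) l l') eqn:E.
    - intros _. apply andb_true_iff in E as [E1 E2]. apply head_eq_true in E1 as ->.
      rewrite !erase_mkapps. eapply all2_conv; eauto. apply conv_refl.
    - clear E. destruct (unfold2 G h h') as [[g g']|] eqn:E; [|discriminate].
      apply unfold2_conv in E as [E1 E2]. intros E. apply IHn in E.
      rewrite !erase_mkapps in *. rewrite E1, E2. exact E. }
  clearbody fb.
  assert (EL : forall A b, convb G M n b (tApp (lift 0 1 (mkapps h' l')) (tVar 0)) = true ->
            conv (erase (tLam A b)) (erase (mkapps h' l'))).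
  { intros A b E'. apply IHn in E'. simpl in *. rewrite erase_lift0 in E' by assumption.
    eapply conv_trans; [|apply conv_eta with (A := erase A)]. apply conv_Lam_any. exact E'. }
  assert (ER : forall A b, convb G M n (tApp (lift 0 1 (mkapps h l)) (tVar 0)) b = true ->
            conv (erase (mkapps h l)) (erase (tLam A b))).
  { intros A b E'. apply IHn in E'. simpl in *. rewrite erase_lift0 in E' by assumption.
    apply conv_sym. eapply conv_trans; [|apply conv_eta with (A := erase A)].
    apply conv_Lam_any. apply conv_sym, E'. }
  assert (EE : forall A b A' b', convb G M n b b' = true ->
            conv (erase (tLam A b)) (erase (tLam A' b'))).
  { intros. apply conv_Lam_any, IHn. assumption. }
  assert (EP : forall A b A' b', convb G M n A A' &&& convb G M n b b' = true ->
            conv (erase (tPi A b)) (erase (tPi A' b'))).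
  { intros A b A' b' E'. apply andb_true_iff in E' as []. apply conv_Pi; auto. }
  assert (ES : forall i j, (i =? j) = true -> conv (erase (tSort i)) (erase (tSort j))).
  { intros i j E'. apply Nat.eqb_eq in E' as ->. apply conv_refl. }
  destruct h, l, h', l'; auto; first [exact (ER _ _ E) | exact (EL _ _ E) | exact (ES _ _ E)
    | exact (EP _ _ _ _ E) | exact (EE _ _ _ _ E)].
Qed.

Section InferSound.
Variable v : bool.

Definition sorted (Γ : list tm) (T : term) : Prop := exists i, typ (map erase Γ) T (Sort i).

(** The invariant on inferred types in the two modes of the type checker. *)
Definition valid (Γ : list tm) (T : term) : Prop := if v then True else sorted Γ T.
Definition ctx_ok (Γ : list tm) : Prop := forall n A, nth_error (map erase Γ) n = Some A ->
  sorted Γ (rename (fun m => S n + m) A).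

Lemma ctx_cons Γ A i : ctx_ok Γ -> typ (map erase Γ) (erase A) (Sort i) -> ctx_ok (A :: Γ).
Proof.
  intros H HA [|n] B E; simpl in E.
  - injection E as <-. exists i. apply (typ_shift _ (erase A)) in HA. exact HA.
  - apply H in E as [j E]. exists j. apply (typ_shift _ (erase A)) in E.
    rewrite rename_rename in E. exact E.
Qed.

Lemma valid_of Γ T : sorted Γ T -> valid Γ T.
Proof. unfold valid. destruct v; auto. Qed.

Variable rec : list tm -> tm -> option tm.
Hypothesis IH : forall Γ t T, ctx_ok Γ -> rec Γ t = Some T ->
  typ (map erase Γ) (erase t) (erase T) /\ valid Γ (erase T).

Lemma sortof_sound Γ A i : ctx_ok Γ ->
  sortof G M rec Γ A = Some i -> typ (map erase Γ) (erase A) (Sort i).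
Proof.
  unfold sortof. intros O. destruct (rec Γ A) as [T|] eqn:E; [|discriminate].
  destruct (whd_full G M T) as [h l] eqn:Ew.
  destruct h, l; try discriminate. intros [= ->].
  eapply typ_conv; [exact (proj1 (IH _ _ _ O E))| |apply typ_Sort].
  now apply whd_full_sound in Ew.
Qed.

Lemma raise_leaf Γ a i : ctx_ok Γ ->
  match sortof G M rec Γ a with
  | Some k => if k <=? i then Some (tSort i) else None | None => None end = Some (tSort i) ->
  typ (map erase Γ) (erase a) (Sort i).
Proof.
  intros O. destruct (sortof _ _ _ _ _) as [k|] eqn:E; [|discriminate].
  destruct (k <=? i) eqn:L; [|discriminate]. intros _.
  eapply typ_cumul; [exact (sortof_sound _ _ _ O E)|]. now apply Nat.leb_le.
Qed.

Lemma raise_sound a Γ i T : ctx_ok Γ ->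
  raise G M rec Γ a i = Some T -> typ (map erase Γ) (erase a) (erase T).
Proof.
  assert (L : forall t Γ T, ctx_ok Γ -> match sortof G M rec Γ t with
     | Some k => if k <=? i then Some (tSort i) else None | None => None end = Some T ->
     typ (map erase Γ) (erase t) (erase T)).
  { intros t Δ T' O E. assert (T' = tSort i) as ->.
    { destruct (sortof _ _ _ _ _); [|discriminate]. destruct (_ <=? _); congruence. }
    now apply raise_leaf. }
  revert Γ T; induction a; intros Γ T O E; try (apply L; assumption).
  cbn [raise] in E.
  destruct (sortof G M rec Γ a1) eqn:E1; [|discriminate].
  destruct (raise G M rec (a1 :: Γ) a2 i) eqn:E2; [|discriminate].
  injection E as <-. apply sortof_sound in E1; [|exact O]. simpl.
  eapply typ_Lam; [eassumption|]. apply (IHa2 (a1 :: Γ)); [|exact E2].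
  eapply ctx_cons; eassumption.
Qed.

Lemma checkb_sound Γ a ta A : ctx_ok Γ -> valid Γ (erase A) ->
  typ (map erase Γ) (erase a) (erase ta) -> checkb G M v rec Γ a ta A = true -> typ (map erase Γ) (erase a) (erase A).
Proof.
  intros O VA Ha. unfold checkb.
  destruct (tm_eqb ta A) eqn:Et. { apply tm_eqb_true in Et as ->. auto. }
  assert (N : (if (if v then match sortof G M rec Γ A with Some _ => true | None => false end
                   else true) then
             if convb G M fuel ta A then true else
             match raise G M rec Γ a (cod_sort G M 10 A) with
             | Some T => convb G M fuel T A | None => false end
         else false) = true -> typ (map erase Γ) (erase a) (erase A)).
  { intros E.
    assert (SA : sorted Γ (erase A)).
    { unfold valid in VA. destruct v; [|exact VA].
      destruct (sortof G M rec Γ A) as [i|] eqn:E1; [|discriminate].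
      exists i. eapply sortof_sound; eauto. }
    destruct SA as [i SA].
    destruct (if v then _ else _); [|discriminate].
    destruct (convb G M fuel ta A) eqn:Ec.
    - apply convb_sound in Ec. eapply typ_conv; eauto.
    - destruct (raise _ _ _ _ _ _) as [T|] eqn:Er; [|discriminate].
      apply convb_sound in E. apply raise_sound in Er; [|exact O]. eapply typ_conv; eauto. }
  destruct A; try exact N.
  destruct (whd_full G M ta) as [h l] eqn:Ew. destruct h, l; try discriminate.
  intros L. apply Nat.leb_le in L. apply whd_full_sound in Ew.
  eapply typ_cumul; [|exact L]. eapply typ_conv; [exact Ha|exact Ew|apply typ_Sort].
Qed.

Lemma as_pi_sound Γ t T A B : ctx_ok Γ -> valid Γ (erase T) ->
  typ (map erase Γ) t (erase T) -> as_pi G M rec Γ T = Some (A, B) ->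
  typ (map erase Γ) t (Pi (erase A) (erase B)) /\ valid Γ (Pi (erase A) (erase B)).
Proof.
  intros O VT Ht. unfold as_pi.
  assert (N : match whd_full G M T with
         | (tPi A B, []) => match sortof G M rec Γ (tPi A B) with
                            | Some _ => Some (A, B) | None => None end
         | _ => None end = Some (A, B) ->
         typ (map erase Γ) t (Pi (erase A) (erase B)) /\ valid Γ (Pi (erase A) (erase B))).
  { destruct (whd_full G M T) as [h l] eqn:Ew. destruct h, l; try discriminate.
    destruct (sortof G M rec Γ (tPi h1 h2)) as [i|] eqn:E; [|discriminate].
    intros [= -> ->]. apply sortof_sound in E; [|exact O]. apply whd_full_sound in Ew.
    split; [eapply typ_conv; eauto|]. apply valid_of. exists i. exact E. }
  destruct T; try exact N. intros [= -> ->]. split; [exact Ht|exact VT].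
Qed.

Lemma infer_list_sound Γ l tys : ctx_ok Γ -> infer_list rec Γ l = Some tys ->
  Forall2 (fun a T => typ (map erase Γ) (erase a) (erase T)) l tys.
Proof.
  intros O. revert tys; induction l; simpl; intros tys E.
  - injection E as <-. constructor.
  - destruct (rec Γ a) eqn:E1; [|discriminate]. destruct (infer_list rec Γ l); [|discriminate].
    injection E as <-. constructor; auto. now apply IH.
Qed.

Lemma valid_app Γ A B u : valid Γ (Pi A B) -> typ (map erase Γ) u A -> valid Γ (subst1 u B).
Proof.
  unfold valid. destruct v; auto. intros [i H] Hu.
  apply Pi_inv in H as (j & _ & HB). exists j. eapply typ_subst1; eauto.
Qed.

Lemma valid_dom Γ A B : valid Γ (Pi A B) -> valid Γ A.
Proof.
  unfold valid. destruct v; auto. intros [i H]. apply Pi_inv in H as (j & HA & _). now exists j.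
Qed.

Lemma spine_sound Γ T e l tys R t : ctx_ok Γ ->
  Forall2 (fun a T => typ (map erase Γ) (erase a) (erase T)) l tys ->
  typ (map erase Γ) t (erase (instl e 0 T)) -> valid Γ (erase (instl e 0 T)) ->
  spine G M v rec Γ T e l tys = Some R ->
  typ (map erase Γ) (apps t (map erase l)) (erase R) /\ valid Γ (erase R).
Proof.
  intros O F. revert T e t; induction F as [|x y l tys Hx F IHF]; intros T e t Ht VT E.
  - simpl in E. injection E as <-. split; assumption.
  - assert (N : match as_pi G M rec Γ (instl e 0 T) with
      | Some (A, B) => if checkb G M v rec Γ x y A then spine G M v rec Γ B [x] l tys else None
      | None => None end = Some R ->
      typ (map erase Γ) (apps t (map erase (x :: l))) (erase R) /\ valid Γ (erase R)).
    { destruct (as_pi _ _ _ _ _) as [[A B]|] eqn:Ea; [|discriminate].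
      destruct (checkb _ _ _ _ _ _ _ _) eqn:Ec; [|discriminate].
      eapply as_pi_sound in Ea as [Hf Vf]; eauto.
      eapply checkb_sound in Ec; eauto using valid_dom.
      assert (Q : erase (instl [x] 0 B) = subst1 (erase x) (erase B)).
      { rewrite erase_instl by assumption. apply subst_ext. intros [|[|n]]; reflexivity. }
      apply IHF; rewrite Q.
      - eapply typ_App; eauto.
      - eapply valid_app; eauto. }
    destruct T; try (apply N; exact E). clear N. simpl in E.
    destruct (checkb _ _ _ _ _ _ _ _) eqn:Ec; [|discriminate].
    simpl in Ht, VT. rewrite (erase_instl _ I_closed e 1) in Ht, VT.
    eapply checkb_sound in Ec; eauto using valid_dom.
    revert E. apply IHF; rewrite <- erase_instl_cons by assumption.
    + eapply typ_App; eauto.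
    + eapply valid_app; eauto.
Qed.
End InferSound.

Lemma unapp_eq t l h l' : unapp t l = (h, l') -> mkapps t l = mkapps h l'.
Proof.
  revert l; induction t; intros l E; simpl in E; try (injection E as <- <-; reflexivity).
  apply IHt1 in E. exact E.
Qed.

Lemma infer_sound v n :
  (v = false -> forall c i j, i <= 1 -> j <= 2 -> exists k, typ [] (close (ctype c i j)) (Sort k)) ->
  forall Γ t T, ctx_ok Γ -> infer G M v n Γ t = Some T ->
  typ (map erase Γ) (erase t) (erase T) /\ valid v Γ (erase T).
Proof.
  intros HC. induction n; intros Γ t T O E; [discriminate|]. cbn [infer] in E.
  assert (VC : forall c i j, levels_ok v i j = true -> valid v Γ (close (ctype c i j))).
  { unfold valid, levels_ok. destruct v; auto. intros c i j L.
    apply andb_true_iff in L as [L1%Nat.leb_le L2%Nat.leb_le].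
    destruct (HC eq_refl c i j L1 L2) as [k Hk]. exists k. apply (typ_weaken [] (map erase Γ) _ _ Hk). }
  destruct t.
  - destruct (nth_error Γ n0) eqn:En; [|discriminate]. injection E as <-.
    rewrite erase_lift0 by assumption. apply (map_nth_error erase) in En.
    split; [now apply typ_Var|]. apply valid_of. now apply O.
  - injection E as <-. split; [apply typ_Sort|]. apply valid_of. eexists. apply typ_Sort.
  - destruct (sortof _ _ _ Γ t1) eqn:E1; [|discriminate].
    destruct (sortof _ _ _ (t1 :: Γ) t2) eqn:E2; [|discriminate]. injection E as <-.
    eapply sortof_sound in E1; eauto.
    eapply sortof_sound in E2; eauto; [|eapply ctx_cons; eauto]. simpl in *.
    split; [apply typ_Pi; eapply typ_cumul; eauto; lia|].
    apply valid_of. eexists. apply typ_Sort.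
  - destruct (sortof _ _ _ Γ t1) eqn:E1; [|discriminate].
    destruct (infer _ _ _ n (t1 :: Γ) t2) eqn:E2; [|discriminate]. injection E as <-.
    eapply sortof_sound in E1; eauto. apply IHn in E2 as [E2 V2]; [|eapply ctx_cons; eauto].
    simpl in *. split; [eapply typ_Lam; eauto|].
    unfold valid in *. destruct v; [exact Logic.I|]. destruct V2 as [j V2].
    exists (Nat.max n0 j). apply typ_Pi; eapply typ_cumul; eauto; lia.
  - destruct (unapp (tApp t1 t2) []) as [h l] eqn:Eu. apply unapp_eq in Eu.
    change (tApp t1 t2) with (mkapps (tApp t1 t2) []). rewrite Eu, erase_mkapps.
    destruct (infer_list _ Γ l) as [tys|] eqn:Ei; [|discriminate].
    eapply infer_list_sound in Ei; [|exact IHn|exact O].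
    assert (N : match infer G M v n Γ h with
                | Some T => spine G M v (infer G M v n) Γ T [] l tys | None => None end = Some T ->
                typ (map erase Γ) (apps (erase h) (map erase l)) (erase T) /\ valid v Γ (erase T)).
    { destruct (infer G M v n Γ h) eqn:Eh; [|discriminate]. apply IHn in Eh as [Eh Vh]; [|exact O].
      intros Es. eapply spine_sound in Es; eauto; now rewrite erase_instl_nil. }
    destruct h; try (apply N; exact E).
    destruct (level_args c) as [ps qs]. cbn zeta in E.
    destruct (levels_ok v _ _) eqn:L; [|discriminate].
    eapply spine_sound in E; eauto; rewrite erase_instl_nil, erase_emb by assumption;
      [apply typ_Cst|apply VC, L].
  - injection E as <-. rewrite erase_emb. split; [apply typ_Cst|apply VC]. destruct v; reflexivity.
  - destruct (G k) as [[b T']|] eqn:Eg; [|discriminate]. injection E as <-.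
    apply G_sound in Eg as (_ & Hk & [i Hs]). split; [apply (typ_weaken [] (map erase Γ)); exact Hk|].
    apply valid_of. exists i. apply (typ_weaken [] (map erase Γ)). exact Hs.
  - discriminate.
Qed.
End Soundness.

(** * Elaboration of implicit arguments *)

Record entry : Type := Entry { e_imp : nat; e_type : tm; e_body : tm }.

(** A metavariable is a function of all the variables in scope where it was created,
    whose number is its arity.  Equations that cannot be solved yet are kept in [post]. *)
Record state : Type := St {
  next : positive;
  sols : PositiveMap.t tm;
  arity : PositiveMap.t nat;
  post : list (list tm * tm * tm)
}.

Definition elabM (A : Type) : Type := state -> option (A * state).
Definition ret {A} (a : A) : elabM A := fun s => Some (a, s).
Definition bind {A B} (m : elabM A) (f : A -> elabM B) : elabM B := fun s =>
  match m s with Some (a, s') => f a s' | None => None end.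
Notation "x <- m ;; k" := (bind m (fun x => k))
  (at level 100, m at next level, right associativity).
Notation "' p <- m ;; k" := (bind m (fun p => k))
  (at level 100, p pattern, m at next level, right associativity).

Section Elab.
Variable G : nat -> option (tm * tm).
Variable implicits : nat -> nat.

Definition look (s : state) (k : positive) : option tm := PositiveMap.find k (sols s).

Fixpoint betas' (f : tm) (l : list tm) : tm :=
  match f, l with tLam _ b, a :: r => betas' (instl [a] 0 b) r | _, _ => mkapps f l end.

Fixpoint zonk (n : nat) (s : state) (t : tm) (l : list tm) : tm :=
  match n with
  | 0 => mkapps t l
  | S n =>
      match t with
      | tApp f a => zonk n s f (a :: l)
      | tMeta k => match look s k with
                   | Some b => zonk n s (betas' b l) []
                   | None => mkapps t (map (fun a => zonk n s a []) l) end
      | tPi A B => mkapps (tPi (zonk n s A []) (zonk n s B [])) (map (fun a => zonk n s a []) l)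
      | tLam A B => mkapps (tLam (zonk n s A []) (zonk n s B [])) (map (fun a => zonk n s a []) l)
      | _ => mkapps t (map (fun a => zonk n s a []) l)
      end
  end.
Definition zonkM (t : tm) : elabM tm := fun s => Some (zonk fuel s t [], s).

Definition fail {A} : elabM A := fun _ => None.
Definition orelse {A} (x y : elabM A) : elabM A := fun s =>
  match x s with Some r => Some r | None => y s end.

Definition whnfM (δ : bool) (t : tm) : elabM (tm * list tm) := fun s =>
  Some (whnf G (look s) δ fuel t [], s).

Definition newmeta (n : nat) : elabM positive := fun s =>
  Some (next s, St (Pos.succ (next s)) (sols s) (PositiveMap.add (next s) n (arity s)) (post s)).
Fixpoint locals (n : nat) : list tm :=
  match n with 0 => [] | S n => tVar n :: locals n end.
Definition fresh (Γ : list tm) : elabM tm :=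
  k <- newmeta (List.length Γ) ;; ret (mkapps (tMeta k) (locals (List.length Γ))).
Definition setmeta (k : positive) (t : tm) : elabM unit := fun s =>
  Some (tt, St (next s) (PositiveMap.add k t (sols s)) (arity s) (post s)).
Definition postpone (Γ : list tm) (t u : tm) : elabM unit := fun s =>
  Some (tt, St (next s) (sols s) (arity s) ((Γ, t, u) :: post s)).

Fixpoint mapM {A B} (f : A -> elabM B) (l : list A) : elabM (list B) :=
  match l with
  | [] => ret []
  | x :: l => y <- f x ;; r <- mapM f l ;; ret (y :: r)
  end.

Fixpoint index (n : nat) (l : list nat) (i : nat) : option nat :=
  match l with [] => None | m :: l => if m =? n then Some i else index n l (S i) end.

(** The higher-order pattern rule: an equation between a metavariable applied to distinct
    variables [vs] and [t] has the solution obtained by abstracting [t] over [vs], provided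
    that its other variables are bound inside it (below [c] binders).  An argument of another
    metavariable that violates this is discarded by restricting that metavariable. *)
Fixpoint invert (n : nat) (c : nat) (m : positive) (vs : list nat) (t : tm) : elabM tm :=
  match n with
  | 0 => fail
  | S n =>
      let '(h, l) := unapp t [] in
      match h with
      | tMeta k =>
          if Pos.eqb k m then fail else
          rl <- mapM (fun a => orelse (r <- invert n c m vs a ;; ret (Some r)) (ret None)) l ;;
          if forallb (fun o => match o with Some _ => true | None => false end) rl
          then ret (mkapps h (flat_map (fun o => match o with Some x => [x] | None => [] end) rl))
          else
            k' <- newmeta (List.length l) ;;
            let N := List.length l in
            let keep := flat_map (fun '(o, v) => match o with Some _ => [v] | None => [] end)
                          (combine rl (locals N)) in
            let sol := fold_right (fun _ b => tLam (tSort 0) b) (mkapps (tMeta k') keep) l in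
            _ <- setmeta k sol ;;
            ret (mkapps (tMeta k') (flat_map (fun o => match o with Some x => [x] | None => [] end) rl))
      | _ =>
          l' <- mapM (invert n c m vs) l ;;
          h' <- match h with
                | tVar v => if v <? c then ret h else
                    match index (v - c) vs 0 with
                    | Some i => ret (tVar (c + i)) | None => fail end
                | tPi A B => A' <- invert n c m vs A ;; B' <- invert n (S c) m vs B ;; ret (tPi A' B')
                | tLam A B => A' <- invert n c m vs A ;; B' <- invert n (S c) m vs B ;; ret (tLam A' B')
                | _ => ret h
                end ;;
          ret (mkapps h' l')
      end
  end.

Fixpoint distinct (l : list nat) : bool :=
  match l with [] => true | x :: l => negb (existsb (Nat.eqb x) l) &&& distinct l end.

(** [Sort 0] is a dummy annotation; it disappears when the solution is applied to
    the variables in scope. *)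
Fixpoint close_lams (Γ : list tm) (m : positive) (d : nat) (vs : list nat) (b : tm) : elabM tm :=
  match vs with
  | [] => ret b
  | v :: r =>
      T <- (if List.length r <? d then ret (tSort 0) else
           match nth_error Γ v with
           | Some T => orelse (T' <- zonkM (lift 0 (S v) T) ;; invert fuel 0 m r T') (ret (tSort 0))
           | None => ret (tSort 0) end) ;;
      close_lams Γ m d r (tLam T b)
  end.

Fixpoint occurs (m : positive) (t : tm) : bool :=
  match t with
  | tMeta k => Pos.eqb k m
  | tPi A B | tLam A B | tApp A B => if occurs m A then true else occurs m B
  | _ => false
  end.

Fixpoint is_locals (n : nat) (l : list tm) : bool :=
  match n, l with
  | 0, [] => true
  | S n, tVar v :: l => (v =? n) &&& is_locals n l
  | _, _ => false
  end.

Fixpoint lams (n : nat) (b : tm) : tm :=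
  match n with 0 => b | S n => tLam (tSort 0) (lams n b) end.

Definition arity_of (m : positive) : elabM nat := fun s =>
  Some (match PositiveMap.find m (arity s) with Some n => n | None => 0 end, s).

Fixpoint normal (n : nat) (s : state) (t : tm) : tm :=
  match n with
  | 0 => t
  | S n => let '(h, l) := whnf G (look s) false fuel t [] in
           let h' := match h with
                     | tPi A B => tPi (normal n s A) (normal n s B)
                     | tLam A B => tLam (normal n s A) (normal n s B)
                     | _ => h end in
           mkapps h' (map (normal n s) l)
  end.

Definition solve (Γ : list tm) (m : positive) (sp : list tm) (t : tm) : elabM unit :=
  d <- arity_of m ;;
  if (d =? List.length Γ) &&& is_locals d sp then
    t' <- zonkM t ;;
    if occurs m t' then fail else setmeta m (lams d t')
  else
  sp' <- mapM (fun a => whnfM false a) sp ;;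
  let vs := rev (flat_map (fun x => match x with (tVar v, []) => [v] | _ => [] end) sp') in
  if (List.length vs =? List.length sp) && distinct vs then
    t' <- zonkM t ;;
    b <- orelse (invert fuel 0 m vs t')
           (fun s => invert fuel 0 m vs (normal 200 s t') s) ;;
    b' <- close_lams Γ m d vs b ;;
    setmeta m b'
  else fail.

(** An eliminator blocked by a metavariable may still compute after it is solved, so that
    a mismatch at such a term is not final. *)
Definition stuck (h : tm) (l : list tm) : elabM bool :=
  match h with
  | tCst c => match elim_pos c with
              | Some k => match nth_error l k with
                          | Some a => '(h', _) <- whnfM true a ;;
                              match h' with tMeta _ => ret true
                              | tCst c' => match elim_pos c' with Some _ => ret true | None => ret false end
                              | _ => ret false end
                          | None => ret false end
              | None => ret false end
  | _ => ret false
  end.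

Fixpoint unify_tm (n : nat) (Γ : list tm) (t u : tm) : elabM unit :=
  match n with
  | 0 => fail
  | S n =>
    if tm_eqb t u then ret tt else
    '(h, l) <- whnfM false t ;;
    '(h', l') <- whnfM false u ;;
    let t := mkapps h l in let u := mkapps h' l' in
    if tm_eqb t u then ret tt else
    let uniargs := fix go l l' := match l, l' with
      | [], [] => ret tt
      | x :: l, y :: l' => _ <- unify_tm n Γ x y ;; go l l'
      | _, _ => fail end in
    let delta :=
      match unfold2 G h h' with
      | Some (g, g') => unify_tm n Γ (mkapps g l) (mkapps g' l')
      | None => b <- stuck h l ;; b' <- stuck h' l' ;;
                if b || b' then postpone Γ t u else fail
      end in
    match h, l, h', l' with
    | tMeta m, _, tMeta m', _ =>
        if Pos.eqb m m' then uniargs l l' else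
        orelse (solve Γ m l u) (orelse (solve Γ m' l' t) (postpone Γ t u))
    | tMeta m, _, _, _ => orelse (solve Γ m l u) (postpone Γ t u)
    | _, _, tMeta m, _ => orelse (solve Γ m l' t) (postpone Γ t u)
    | tLam A b, [], tLam _ b', [] => unify_tm n (A :: Γ) b b'
    | tLam A b, [], _, _ => unify_tm n (A :: Γ) b (tApp (lift 0 1 u) (tVar 0))
    | _, _, tLam A b', [] => unify_tm n (A :: Γ) (tApp (lift 0 1 t) (tVar 0)) b'
    | tPi A B, [], tPi A' B', [] => _ <- unify_tm n Γ A A' ;; unify_tm n (A :: Γ) B B'
    | tSort i, [], tSort j, [] => ret tt
    | _, _, _, _ =>
        if head_eq h h' && (List.length l =? List.length l')
        then orelse (uniargs l l')
               match unfold2 G h h' with Some _ => delta | None =>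
                 b <- stuck h l ;; b' <- stuck h' l' ;;
                 if b || b' then postpone Γ t u else uniargs l l' end
        else delta
    end
  end.

Definition retry : elabM unit := fun s =>
  (fix go l := match l with
               | [] => ret tt
               | (Γ, t, u) :: l => _ <- go l ;; (unify_tm fuel Γ t u) end) (post s)
    (St (next s) (sols s) (arity s) []).

(** Elaboration starts from raw terms in which applications of a sort, which are never
    well typed, serve as codes: [App (Sort 0) (Sort k)] is the name [k] with its implicit
    arguments to be inserted, [App (Sort 2) (Sort k)] the same name with all arguments
    given, and [App (Sort 1) _] an argument to be found. *)
Definition isHole (t : term) : bool :=
  match t with App (Sort 1) _ => true | _ => false end.
Definition isLam (t : term) : bool := match t with Lam _ _ => true | _ => false end.

Fixpoint unappS (t : term) (l : list term) : term * list term :=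
  match t with App f a => unappS f (a :: l) | _ => (t, l) end.

Definition addimp (Γ : list tm) (k : nat) : elabM (tm * tm) :=
  match G k with
  | None => fail
  | Some (_, T) =>
      (fix go i f T := match i with
         | 0 => ret (f, T)
         | S i => '(h, _) <- whnfM true T ;;
                  match h with
                  | tPi A B => m <- fresh Γ ;; go i (tApp f m) (instl [m] 0 B)
                  | _ => fail end
         end) (implicits k) (tGlob k) T
  end.

(** All arguments of an application are first replaced by metavariables.  The expected
    result type and those arguments that are not λ-abstractions are then used before the
    λ-abstractions, whose domains they determine. *)
Fixpoint place (Γ : list tm) (f T : tm) (l : list term) (acc : list (term * tm * tm))
  : elabM (tm * tm * list term * list (term * tm * tm)) :=
  match l with
  | [] => ret (f, T, l, rev acc)
  | a :: r =>
      '(h, l') <- whnfM true T ;;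
      match h with
      | tPi A B => m <- fresh Γ ;; place Γ (tApp f m) (instl [m] 0 B) r ((a, m, A) :: acc)
      | _ => ret (f, T, l, rev acc)
      end
  end.

Fixpoint elab (n : nat) (Γ : list tm) (t : term) (exp : option tm) : elabM (tm * tm) :=
  match n with
  | 0 => fail
  | S n =>
    let check Γ t E :=
      '(t', T) <- elab n Γ t (Some E) ;;
      _ <- (unify_tm fuel Γ T E) ;; ret t' in
    let type Γ t := check Γ t (tSort 0) in
    let fix run k Γ (l : list (term * tm * tm)) (lams : bool) : elabM unit :=
      match l with
      | [] => ret tt
      | (a, m, A) :: l =>
          _ <- (if isHole a then ret tt
                else if Bool.eqb (isLam a) lams then
                  a' <- check Γ a A ;;
                  match unapp m [] with
                  | (tMeta k, sp) =>
                      o <- (fun s => Some (look s k, s)) ;;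
                      _ <- match o with
                           | Some _ => (unify_tm fuel Γ m a') | None => ret tt end ;;
                      orelse (solve Γ k sp a') (ret tt)
                  | _ => ret tt end
                else ret tt) ;;
          run k Γ l lams
      end in
    let fix direct Γ f T l : elabM (tm * tm) :=
      match l with
      | [] => ret (f, T)
      | a :: l =>
          '(h, _) <- whnfM true T ;;
          match h with
          | tPi A B => a' <- check Γ a A ;; direct Γ (tApp f a') (instl [a'] 0 B) l
          | _ => fail
          end
      end in
    let fix appl k Γ f T l : elabM (tm * tm) :=
      match l, k with
      | [], _ => ret (f, T)
      | _, 0 => fail
      | _, S k =>
          '(f', T', rest, pend) <- place Γ f T l [] ;;
          match pend with
          | [] => fail
          | _ =>
              _ <- match rest, exp with
                   | [], Some E => orelse (unify_tm fuel Γ T' E) (ret tt)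
                   | _, _ => ret tt end ;;
              _ <- run k Γ pend false ;;
              _ <- run k Γ pend true ;;
              _ <- retry ;;
              appl k Γ f' T' rest
          end
      end in
    let '(h, l) := unappS t [] in
    match h, l with
    | Sort 0, Sort k :: l => '(f, T) <- addimp Γ k ;; appl n Γ f T l
    | Sort 1, _ :: _ =>
        m <- fresh Γ ;; T <- match exp with Some E => ret E | None => fresh Γ end ;; ret (m, T)
    | Sort 2, Sort k :: l =>
        match G k with
        | Some (_, T) => appl n Γ (tGlob k) T l | None => fail end
    | Sort i, _ => ret (tSort i, tSort (S i))
    | Var k, _ =>
        match nth_error Γ k with
        | Some T => let T := lift 0 (S k) T in
            if existsb isHole l then appl n Γ (tVar k) T l else direct Γ (tVar k) T l | None => fail end
    | Cst c, _ =>
        let T := emb (close (ctype c 0 0)) in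
        if existsb isHole l then appl n Γ (tCst c) T l else direct Γ (tCst c) T l
    | Pi A B, _ => A' <- type Γ A ;; B' <- type (A' :: Γ) B ;; ret (tPi A' B', tSort 0)
    | Lam A b, [] =>
        pi <- match exp with
              | Some E => '(h, _) <- whnfM true E ;;
                          match h with tPi A B => ret (Some (A, B)) | _ => ret None end
              | None => ret None end ;;
        match pi with
        | Some (A', B') =>
            A1 <- (if isHole A then ret A' else
                   A1 <- type Γ A ;;
                   _ <- (unify_tm fuel Γ A1 A') ;;
                   ret A1) ;;
            b' <- check (A1 :: Γ) b B' ;; ret (tLam A1 b', tPi A1 B')
        | None =>
            A1 <- type Γ A ;;
            '(b', B) <- elab n (A1 :: Γ) b None ;; ret (tLam A1 b', tPi A1 B)
        end
    | Lam A b, _ =>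
        '(f, T) <- elab n Γ h None ;;
        if existsb isHole l then appl n Γ f T l else direct Γ f T l
    | _, _ => fail
    end
  end.

Fixpoint retry_all (n : nat) : elabM unit := fun s =>
  match n, post s with
  | 0, _ | _, [] => Some (tt, s)
  | S n, _ => bind retry (fun _ => retry_all n) s
  end.

Fixpoint has_meta (t : tm) : bool :=
  match t with
  | tMeta _ => true
  | tPi A B | tLam A B | tApp A B => has_meta A || has_meta B
  | _ => false
  end.

Definition run_elab (type body : term) : option (tm * tm) :=
  match
    ('(T, _) <- elab 1000 [] type None ;;
     '(b, T') <- elab 1000 [] body (Some T) ;;
     _ <- (unify_tm fuel [] T' T) ;;
     _ <- retry_all 5 ;;
     p <- (fun s => Some (post s, s)) ;;
     T1 <- zonkM T ;; b1 <- zonkM b ;;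
     match p with
     | (Γ, t, u) :: _ => fail
     | [] => if has_meta T1 || has_meta b1 then fail
             else ret (T1, b1)
     end) (St 1%positive (PositiveMap.empty tm) (PositiveMap.empty nat) [])
  with Some (r, _) => Some r | None => None end.
End Elab.

(** * Lists of definitions *)

(** The latest definition comes first, so that the number of a definition, which is the
    number of its predecessors, is not affected by further definitions. *)
Definition lookup (l : list entry) (k : nat) : option entry :=
  nth_error l (List.length l - S k).
Definition globs (l : list entry) (k : nat) : option (tm * tm) :=
  if k <? List.length l then
  match lookup l k with Some e => Some (e_body e, e_type e) | None => None end else None.
Definition imps (l : list entry) (k : nat) : nat :=
  match lookup l k with Some e => e_imp e | None => 0 end.

Definition entry_ok (G : nat -> option (tm * tm)) (T b : tm) : bool :=
  let rec := infer G (fun _ => None) false fuel in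
  match sortof G (fun _ => None) rec [] T, rec [] b with
  | Some _, Some T' => checkb G (fun _ => None) false rec [] b T' T
  | _, _ => false
  end.

Definition add_entry (l : list entry) (i : nat) (type body : hterm) : option entry :=
  match run_elab (globs l) (imps l) (close type) (close body) with
  | Some (T, b) => Some (Entry i T b) | None => None
  end.

(** A list of definitions stands for its first entry.  Resolution of the class finds the
    list that was declared last, which the next declaration extends. *)
Class Lib : Type := lib : list entry.
Definition glob (l : Lib) : hterm := fun _ => App (Sort 0) (Sort (List.length l - 1)).
Definition expl (l : Lib) : hterm := fun _ => App (Sort 2) (Sort (List.length l - 1)).
Coercion glob : Lib >-> hterm.
Definition hole : hterm := fun _ => App (Sort 1) (Sort 0).

(** This uses the mode of the type checker in which the validity of types is not assumed. *)
Lemma ctype_sort_check : forall i j, i <= 1 -> j <= 2 -> forall c,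
  match sortof (fun _ => None) (fun _ => None) (infer (fun _ => None) (fun _ => None) true fuel) []
     (emb (close (ctype c i j))) with Some _ => true | None => false end = true.
Proof.
  intros i j Hi Hj.
  destruct i as [|[|i]]; [| |lia]; (destruct j as [|[|[|j]]]; [| | |lia]);
  intros []; vm_compute; reflexivity.
Qed.

(* This keeps tactics from expanding the numeral. *)
Local Opaque fuel.
Lemma ctype_sort c i j : i <= 1 -> j <= 2 -> exists k, typ [] (close (ctype c i j)) (Sort k).
Proof.
  intros Hi Hj. pose proof (ctype_sort_check i j Hi Hj c) as E.
  destruct (sortof _ _ _ _ _) as [k|] eqn:Es; [clear E|discriminate]. exists k.
  apply (sortof_sound (fun _ => None) _ (fun _ => Sort 0)) with (v := true) in Es.
  - rewrite erase_emb in Es. exact Es.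
  - reflexivity.
  - easy.
  - discriminate.
  - intros Γ t T. apply infer_sound; easy.
  - intros [|] ? ?; discriminate.
Qed.

Fixpoint scoped (k : nat) (t : tm) : bool :=
  match t with
  | tPi A B | tLam A B | tApp A B => scoped k A && scoped k B
  | tGlob n => n <? k
  | _ => true
  end.

Lemma erase_scoped I I' k t : (forall n, n < k -> I n = I' n) -> scoped k t = true -> erase I t = erase I' t.
Proof.
  intros E. induction t; simpl; auto; intros S;
    try (apply andb_true_iff in S as [S1 S2]; f_equal; auto).
  apply E. now apply Nat.ltb_lt.
Qed.

Fixpoint library_ok (l : list entry) : bool :=
  match l with
  | [] => true
  | e :: r => scoped (List.length r) (e_type e) && scoped (List.length r) (e_body e)
              && entry_ok (globs r) (e_type e) (e_body e) && library_ok r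
  end.

Lemma globs_cons e l k : globs (e :: l) k =
  if k =? List.length l then Some (e_body e, e_type e) else globs l k.
Proof.
  unfold globs, lookup. cbn [List.length].
  destruct (Nat.eqb_spec k (List.length l)) as [->|N].
  - rewrite (proj2 (Nat.ltb_lt _ _)) by lia. rewrite Nat.sub_diag. reflexivity.
  - destruct (Nat.ltb_spec k (List.length l)).
    + rewrite (proj2 (Nat.ltb_lt _ _)) by lia.
      replace (S (List.length l) - S k) with (S (List.length l - S k)) by lia. reflexivity.
    + rewrite (proj2 (Nat.ltb_ge _ _)) by lia. reflexivity.
Qed.
Lemma globs_lt l k e : globs l k = Some e -> k < List.length l.
Proof. unfold globs. destruct (Nat.ltb_spec k (List.length l)); easy. Qed.

(** Names are interpreted one after the other; a definition refers only to earlier ones,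
    so that its interpretation does not change later. *)
Lemma library_sound l : library_ok l = true -> exists I,
  (forall k, closedn 0 (I k)) /\
  (forall k b T, globs l k = Some (b, T) ->
    scoped (List.length l) b = true /\ scoped (List.length l) T = true /\
    I k = erase I b /\ typ [] (I k) (erase I T) /\ exists i, typ [] (erase I T) (Sort i)).
Proof.
  induction l as [|e r IH]; simpl; intros E.
  { exists (fun _ => Sort 0). split; [easy|]. intros k b T E'. now apply globs_lt in E'. }
  apply andb_true_iff in E as [[[S1 S2]%andb_true_iff C]%andb_true_iff E].
  destruct (IH E) as (I & I_closed & HI). clear IH E.
  assert (typ [] (erase I (e_body e)) (erase I (e_type e)) /\ exists i, typ [] (erase I (e_type e)) (Sort i))
    as [Tb [i Ti]].
  { assert (G_sound : forall k b T, globs r k = Some (b, T) ->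
      I k = erase I b /\ typ [] (I k) (erase I T) /\ exists i, typ [] (erase I T) (Sort i)).
    { intros k b T H. apply HI in H. tauto. }
    unfold entry_ok in C. set (rec := infer _ _ _ _) in C.
    assert (Hrec : forall Γ t T, ctx_ok I Γ -> rec Γ t = Some T ->
              typ (map (erase I) Γ) (erase I t) (erase I T) /\ valid I false Γ (erase I T)).
    { apply infer_sound; auto. intros _. exact ctype_sort. }
    assert (O : ctx_ok I []) by (intros [|] ? ?; discriminate).
    destruct (sortof _ _ _ _ _) as [i|] eqn:Es; [|discriminate].
    destruct (rec [] (e_body e)) as [T|] eqn:Eb; [|discriminate].
    eapply sortof_sound in Es; eauto.
    split; [|exists i; exact Es].
    eapply checkb_sound in C; eauto. exists i. exact Es. apply (Hrec [] _ _ O Eb). }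
  (* The new definition is interpreted by its body. *)
  set (I' := fun k => if k =? List.length r then erase I (e_body e) else I k).
  assert (EI : forall n, n < List.length r -> I n = I' n).
  { intros n L. unfold I'. destruct (Nat.eqb_spec n (List.length r)); [lia|reflexivity]. }
  assert (Mono : forall t, scoped (List.length r) t = true -> scoped (S (List.length r)) t = true).
  { induction t; simpl; auto; try (rewrite !andb_true_iff; intros []; auto; fail).
    rewrite !Nat.ltb_lt. lia. }
  exists I'. split.
  { intros k. unfold I'. destruct (_ =? _); auto. apply (typ_closed [] _ _ Tb). }
  intros k b T. rewrite globs_cons. intros H.
  destruct (Nat.eqb_spec k (List.length r)) as [->|N].
  - injection H as <- <-.
    rewrite <- !(erase_scoped I I' (List.length r)) by assumption.
    unfold I'. rewrite Nat.eqb_refl. eauto 10.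
  - pose proof (globs_lt _ _ _ H) as L. apply HI in H as (B1 & B2 & B3 & B4 & B5).
    rewrite <- !(erase_scoped I I' (List.length r)) by assumption.
    unfold I'. rewrite (proj2 (Nat.eqb_neq _ _)) by assumption. auto 10.
Qed.

Theorem library_theorem e l A : library_ok (e :: l) = true -> e_type e = emb (close A) -> hott_theorem A.
Proof.
  intros H E. destruct (library_sound _ H) as (I & _ & HI).
  destruct (HI (List.length l) (e_body e) (e_type e)) as (_ & _ & _ & T & _).
  { now rewrite globs_cons, Nat.eqb_refl. }
  exists (I (List.length l)). rewrite E, erase_emb in T. exact T.
Qed.

(** * Paths and equivalences in the object language *)

(** [lemma i T b] adds a definition with type [T] and body [b] whose first [i] arguments
    are implicit. *)
Ltac lemma_ i T b :=
  let prev := constr:(_ : Lib) in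
  let t := constr:(add_entry prev i T b) in
  let r := eval vm_compute in t in
  lazymatch r with
  | Some ?e => exact (e :: prev : list entry)
  | None => fail "the elaboration of this entry failed"
  end.
Tactic Notation "lemma" constr(i) uconstr(T) uconstr(b) := lemma_ i T b.

Open Scope hott_scope.
Notation "'fn' x .. y , t" := (hlam hole (fun x => .. (hlam hole (fun y => t)) ..))
  (at level 200, x binder, y binder, t at level 200) : hott_scope.
Notation "x == y" := (Id hole x y) (at level 70) : hott_scope.
Notation rfl := (cRefl @ hole @ hole).
Notation Jp P d p := (cJ @ hole @ hole @ P @ d @ hole @ p).
Notation "⟨ a , b ⟩" := (cPair @ hole @ hole @ a @ b) : hott_scope.

Instance nolib : Lib := [].

(** The basic operations on paths are stated in [U 1].  By cumulativity they also apply
    in [U 0]. *)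
Instance inv : Lib := ltac:(lemma 3
  (Π A : U 1, Π x : A, Π y : A, x == y ⇒ y == x)
  (fn A x y p, Jp (fn y _, y == x) rfl p)).
Instance cat : Lib := ltac:(lemma 4
  (Π A : U 1, Π x : A, Π y : A, Π z : A, x == y ⇒ y == z ⇒ x == z)
  (fn A x y z p q, concat A x y z p q)).
Notation "p • q" := (cat @ p @ q) (at level 50, left associativity) : hott_scope.
Instance catV : Lib := ltac:(lemma 3
  (Π A : U 1, Π x : A, Π y : A, Π p : x == y, p • (inv @ p) == rfl)
  (fn A x y p, Jp (fn y p, p • (inv @ p) == rfl) rfl p)).
Instance invV : Lib := ltac:(lemma 3
  (Π A : U 1, Π x : A, Π y : A, Π p : x == y, inv @ p • p == rfl)
  (fn A x y p, Jp (fn y p, inv @ p • p == rfl) rfl p)).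
Instance catL : Lib := ltac:(lemma 3
  (Π A : U 1, Π x : A, Π y : A, Π p : x == y, rfl • p == p)
  (fn A x y p, Jp (fn y p, rfl • p == p) rfl p)).
Instance catA : Lib := ltac:(lemma 5
  (Π A : U 1, Π x : A, Π y : A, Π z : A, Π w : A, Π p : x == y, Π q : y == z, Π r : z == w,
     p • (q • r) == p • q • r)
  (fn A x y z w p q r, Jp (fn w r, p • (q • r) == p • q • r) rfl r)).
Instance cong : Lib := ltac:(lemma 4
  (Π A : U 1, Π B : U 1, Π x : A, Π y : A, Π f : A ⇒ B, x == y ⇒ f @ x == f @ y)
  (fn A B x y f p, ap A B f x y p)).
Instance transp : Lib := ltac:(lemma 3
  (Π A : U 1, Π x : A, Π y : A, Π P : A ⇒ U 0, x == y ⇒ P @ x ⇒ P @ y)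
  (fn A x y P p u, transport A P x y p u)).
Instance cancelL : Lib := ltac:(lemma 4
  (Π A : U 1, Π x : A, Π y : A, Π z : A, Π p : x == y, Π q : y == z, Π r : y == z,
     p • q == p • r ⇒ q == r)
  (fn A x y z p, Jp (fn y p, Π q : y == z, Π r : y == z, p • q == p • r ⇒ q == r)
     (fn q r h, inv @ (catL @ q) • h • catL @ r) p)).

Instance pr1 : Lib := ltac:(lemma 2
  (Π A : U 1, Π B : A ⇒ U 1, Sig A B ⇒ A)
  (fn A B p, fst A B p)).
Instance pr2 : Lib := ltac:(lemma 2
  (Π A : U 1, Π B : A ⇒ U 1, Π p : Sig A B, B @ (pr1 @ p))
  (fn A B p, snd A B p)).
Instance einv : Lib := ltac:(lemma 3
  (Π A : U 1, Π B : U 1, Π f : A ⇒ B, isEquiv A B f ⇒ B ⇒ A)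
  (fn A B f e y, pr1 @ (pr1 @ (e @ y)))).
Instance einvS : Lib := ltac:(lemma 3
  (Π A : U 1, Π B : U 1, Π f : A ⇒ B, Π e : isEquiv A B f, Π y : B, f @ (einv @ e @ y) == y)
  (fn A B f e y, pr2 @ (pr1 @ (e @ y)))).
Instance einvK : Lib := ltac:(lemma 3
  (Π A : U 1, Π B : U 1, Π f : A ⇒ B, Π e : isEquiv A B f, Π x : A, einv @ e @ (f @ x) == x)
  (fn A B f e x, cong @ (fn c, pr1 @ c) @ (pr2 @ (e @ (f @ x)) @ ⟨x, rfl⟩))).
Instance funext : Lib := ltac:(lemma 4
  (Π A : U 0, Π B : A ⇒ U 0, Π f : (Π x : A, B @ x), Π g : (Π x : A, B @ x),
    (Π x : A, f @ x == g @ x) ⇒ f == g)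
  (fn A B f g h, einv @ (cFunext @ A @ B @ f @ g) @ h)).

(** * Propositions, sets and truncations *)

Instance contrProp : Lib := ltac:(lemma 1
  (Π A : U 1, isContr A ⇒ isProp A)
  (fn A c x y, inv @ (pr2 @ c @ x) • pr2 @ c @ y)).
Instance propContr : Lib := ltac:(lemma 1
  (Π A : U 1, isProp A ⇒ Π x : A, Π y : A, isContr (x == y))
  (fn A h x y, ⟨inv @ (h @ x @ x) • h @ x @ y,
     fn p, Jp (fn y p, inv @ (h @ x @ x) • h @ x @ y == p) (invV @ (h @ x @ x)) p⟩)).
Instance propSet : Lib := ltac:(lemma 1
  (Π A : U 1, isProp A ⇒ isSet A)
  (fn A h x y, contrProp @ (propContr @ h @ x @ y))).
Instance hlevelS : Lib := ltac:(lemma 0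
  (Π n : cNat, Π A : U 1, hlevel 1 n A ⇒ hlevel 1 (cS @ n) A)
  (cNatInd @ (fn n, Π A : U 1, hlevel 1 n A ⇒ hlevel 1 (cS @ n) A)
     @ (fn A c x y, propContr @ (contrProp @ c) @ x @ y)
     @ (fn n r A h x y, r @ (x == y) @ (h @ x @ y)))).
Instance setHlevel : Lib := ltac:(lemma 1
  (Π A : U 1, isSet A ⇒ Π n : cNat, hlevel 1 (cS @ (cS @ n)) A)
  (fn A h, cNatInd @ (fn n, hlevel 1 (cS @ (cS @ n)) A)
     @ (fn x y p q, propContr @ (h @ x @ y) @ p @ q)
     @ (fn n r, hlevelS @ (cS @ (cS @ n)) @ A @ r))).
Instance propPi : Lib := ltac:(lemma 2
  (Π A : U 0, Π B : A ⇒ U 0, (Π x : A, isProp (B @ x)) ⇒ isProp (Π x : A, B @ x))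
  (fn A B h f g, funext @ (fn x, h @ x @ (f @ x) @ (g @ x)))).
Instance setPi : Lib := ltac:(lemma 2
  (Π A : U 0, Π B : A ⇒ U 0, (Π x : A, isSet (B @ x)) ⇒ isSet (Π x : A, B @ x))
  (fn A B h f g p q,
    inv @ (einvK @ (cFunext @ A @ B @ f @ g) @ p)
    • cong @ (fn r, einv @ (cFunext @ A @ B @ f @ g) @ r) @
        (propPi @ (fn x, h @ x @ (f @ x) @ (g @ x)) @ (happly A B f g @ p) @ (happly A B f g @ q))
    • einvK @ (cFunext @ A @ B @ f @ g) @ q)).
Instance propIsProp : Lib := ltac:(lemma 1
  (Π A : U 0, isProp (isProp A))
  (fn A h k, funext @ (fn x, funext @ (fn y, propSet @ h @ x @ y @ (h @ x @ y) @ (k @ x @ y))))).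
Instance sigEq : Lib := ltac:(lemma 2
  (Π A : U 1, Π B : A ⇒ U 1, (Π x : A, isProp (B @ x)) ⇒
    Π x : A, Π y : A, Π b : B @ x, Π c : B @ y, x == y ⇒ Id (Sig A B) ⟨x, b⟩ ⟨y, c⟩)
  (fn A B h x y b c p,
    Jp (fn y _, Π c : B @ y, Id (Sig A B) ⟨x, b⟩ ⟨y, c⟩)
       (fn c, cong @ (λ b : B @ x, cPair @ A @ B @ x @ b) @ (h @ x @ b @ c)) p @ c)).

(** For a set B the second components in the fibres of f are unique, so that a two-sided
    inverse is enough. *)
Instance qinv : Lib := ltac:(lemma 3
  (Π A : U 1, Π B : U 1, Π f : A ⇒ B, isSet B ⇒ Π g : B ⇒ A,
    (Π y : B, f @ (g @ y) == y) ⇒ (Π x : A, g @ (f @ x) == x) ⇒ isEquiv A B f)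
  (fn A B f hB g fg gf y,
    ⟨⟨g @ y, fg @ y⟩,
     cSigInd @ A @ (fn x, f @ x == y) @ (fn c, Id (fib A B f y) ⟨g @ y, fg @ y⟩ c)
       @ (fn x p, sigEq @ (fn x, hB @ (f @ x) @ y) @ (g @ y) @ x @ (fg @ y) @ p
            @ (cong @ g @ (inv @ p) • gf @ x))⟩)).

(** Univalence for propositions. *)
Instance propExt : Lib := ltac:(lemma 2
  (Π A : U 0, Π B : U 0, isProp A ⇒ isProp B ⇒ (A ⇒ B) ⇒ (B ⇒ A) ⇒ Id (U 0) A B)
  (fn A B hA hB f g,
    einv @ (cUA @ A @ B)
      @ ⟨f, qinv @ (propSet @ hB) @ g @ (fn y, hB @ (f @ (g @ y)) @ y) @ (fn x, hA @ (g @ (f @ x)) @ x)⟩)).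

(** The map from x = y to R x y, which transports reflexivity, has a left inverse: the
    implication, corrected by a fixed loop.  Hence x = y is a proposition. *)
Instance relSet : Lib := ltac:(lemma 1
  (Π X : U 1, Π R : X ⇒ X ⇒ U 0, (Π x : X, Π y : X, isProp (R @ x @ y)) ⇒
    (Π x : X, R @ x @ x) ⇒ (Π x : X, Π y : X, R @ x @ y ⇒ x == y) ⇒ isSet X)
  (fn X R hR ρ φ x y p q,
    (* s exhibits p as the image of a proof of R x y. *)
    (λ s : (Π p : x == y, inv @ (φ @ x @ x @ (ρ @ x)) •
              φ @ x @ y @ (Jp (fn y _, R @ x @ y) (ρ @ x) p) == p),
      inv @ (s @ p)
      • cong @ (fn r, inv @ (φ @ x @ x @ (ρ @ x)) • φ @ x @ y @ r)
          @ (hR @ x @ y @ (Jp (fn y _, R @ x @ y) (ρ @ x) p) @ (Jp (fn y _, R @ x @ y) (ρ @ x) q))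
      • s @ q)
    @ (fn p, Jp (fn y p, inv @ (φ @ x @ x @ (ρ @ x)) •
              φ @ x @ y @ (Jp (fn y _, R @ x @ y) (ρ @ x) p) == p)
        (invV @ (φ @ x @ x @ (ρ @ x))) p))).
Instance prodProp : Lib := ltac:(lemma 2
  (Π A : U 0, Π B : U 0, isProp A ⇒ isProp B ⇒ isProp (A × B))
  (fn A B hA hB, cSigInd @ A @ (fn _, B) @ (fn p, Π q : A × B, p == q)
    @ (fn a b, cSigInd @ A @ (fn _, B) @ (fn q, ⟨a, b⟩ == q)
      @ (fn c d, sigEq @ (fn _, hB) @ a @ c @ b @ d @ (hA @ a @ c))))).

Definition hProp : hterm := Σ X : U 0, isProp X.

(** Logical equivalence is a mere relation that implies identity, by univalence. *)
Instance hPropSet : Lib := ltac:(lemma 0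
  (isSet hProp)
  (relSet @ (λ P : hProp, λ Q : hProp, (pr1 @ P ⇒ pr1 @ Q) × (pr1 @ Q ⇒ pr1 @ P))
    @ (fn P Q, prodProp @ (propPi @ (fn _, pr2 @ Q)) @ (propPi @ (fn _, pr2 @ P)))
    @ (fn P, ⟨fn x, x, fn x, x⟩)
    @ (cSigInd @ (U 0) @ (fn X, isProp X)
        @ (fn P, Π Q : hProp, (pr1 @ P ⇒ pr1 @ Q) × (pr1 @ Q ⇒ pr1 @ P) ⇒ P == Q)
        @ (fn X hX, cSigInd @ (U 0) @ (fn X, isProp X)
           @ (fn Q, (X ⇒ pr1 @ Q) × (pr1 @ Q ⇒ X) ⇒ Id hProp ⟨X, hX⟩ Q)
           @ (fn Y hY r, sigEq @ (fn X, propIsProp) @ X @ Y @ hX @ hY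
                @ (propExt @ hX @ hY @ (pr1 @ r) @ (pr2 @ r))))))).

Instance truncProp : Lib := ltac:(lemma 1
  (Π A : U 0, isProp (cTr @ cO @ A))
  (fn A x y, pr1 @ (cTrLevel @ cO @ A @ x @ y))).
Instance truncRec : Lib := ltac:(lemma 2
  (Π A : U 0, Π P : U 0, isProp P ⇒ (A ⇒ P) ⇒ cTr @ cO @ A ⇒ P)
  (fn A P h f, cTrInd @ cO @ A @ (fn _, P) @ (fn _, propContr @ h) @ f)).
Instance setTrSet : Lib := ltac:(lemma 1
  (Π A : U 0, isSet (setTr A))
  (fn A x y p q, pr1 @ (cTrLevel @ (cS @ cO) @ A @ x @ y @ p @ q))).
Instance setTrInd : Lib := ltac:(lemma 2
  (Π A : U 0, Π P : setTr A ⇒ U 0, (Π x : setTr A, isProp (P @ x)) ⇒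
    (Π a : A, P @ setIn A a) ⇒ Π x : setTr A, P @ x)
  (fn A P h f, cTrInd @ (cS @ cO) @ A @ P
    @ (fn x a b p q, propContr @ (propSet @ (h @ x) @ a @ b) @ p @ q) @ f)).

(** To prove a proposition on a connected type it suffices to look at one point: the
    family factors through the contractible truncation, since the type of propositions
    is a set. *)
Instance connInd : Lib := ltac:(lemma 2
  (Π A : U 0, Π m : cNat, isContr (cTr @ (cS @ m) @ A) ⇒
    Π P : A ⇒ U 0, (Π x : A, isProp (P @ x)) ⇒ Π a : A, P @ a ⇒ Π x : A, P @ x)
  (fn A m c P h a u x,
    let F := cTrInd @ (cS @ m) @ A @ (fn _, hProp) @ (fn _, setHlevel @ hPropSet @ m)
         @ (fn x, ⟨P @ x, h @ x⟩) in
    transp @ (fn X, X)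
      @ (cong @ (fn t, pr1 @ (F @ t))
           @ (contrProp @ c @ (cTrIn @ (cS @ m) @ A @ a) @ (cTrIn @ (cS @ m) @ A @ x))) @ u)).

(** Encode-decode: the family ‖a = x‖ extends to the set truncation because the
    type of propositions is a set. *)
Instance setTrEq : Lib := ltac:(lemma 3
  (Π A : U 0, Π a : A, Π b : A, setIn A a == setIn A b ⇒ cTr @ cO @ (a == b))
  (fn A a b p,
    let F := cTrInd @ (cS @ cO) @ A @ (fn _, hProp) @ (fn _, setHlevel @ hPropSet @ cO)
         @ (λ x : A, ⟨cTr @ cO @ (a == x), truncProp⟩) in
    transp @ (fn X, X) @ (cong @ (fn t, pr1 @ (F @ t)) @ p) @ (cTrIn @ cO @ (a == a) @ rfl))).

(** * The ring of integers *)

(** The operations receive names, so that they are not unfolded without need. *)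
Instance zsucc : Lib := ltac:(lemma 0 (Zcar ⇒ Zcar) Zsucc).
Instance zpred : Lib := ltac:(lemma 0 (Zcar ⇒ Zcar) Zpred).
Instance zopp : Lib := ltac:(lemma 0 (Zcar ⇒ Zcar) Zopp).
Instance zadd : Lib := ltac:(lemma 0 (Zcar ⇒ Zcar ⇒ Zcar) Zadd).
Instance zmul : Lib := ltac:(lemma 0 (Zcar ⇒ Zcar ⇒ Zcar) Zmul).
Definition z0 : hterm := pos cO.
Definition z1 : hterm := pos (cS @ cO).
Notation "x ⊕ y" := (zadd @ x @ y) (at level 45, left associativity) : hott_scope.
Notation "x ⊗ y" := (zmul @ x @ y) (at level 40, left associativity) : hott_scope.

Definition natCases (P z : hterm) (s : hterm -> hterm) : hterm := cNatInd @ P @ z @ (fn n _, s n).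
Definition zCases (P f g : hterm) : hterm := cSumInd @ cNat @ cNat @ P @ f @ g.

Instance zsuccPred : Lib := ltac:(lemma 0
  (Π x : Zcar, zsucc @ (zpred @ x) == x)
  (zCases (fn x, zsucc @ (zpred @ x) == x)
     (natCases (fn n, zsucc @ (zpred @ pos n) == pos n) rfl (fun n => rfl))
     (fn n, rfl))).
Instance zpredSucc : Lib := ltac:(lemma 0
  (Π x : Zcar, zpred @ (zsucc @ x) == x)
  (zCases (fn x, zpred @ (zsucc @ x) == x) (fn n, rfl)
     (natCases (fn n, zpred @ (zsucc @ neg n) == neg n) rfl (fun n => rfl)))).

(** Every integer is reached from 0 by successors and predecessors.  This spares the
    case distinctions on signs in the proofs of the ring laws. *)
Instance zInd : Lib := ltac:(lemma 0
  (Π P : Zcar ⇒ U 0, P @ z0 ⇒ (Π x : Zcar, P @ x ⇒ P @ (zsucc @ x)) ⇒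
     (Π x : Zcar, P @ x ⇒ P @ (zpred @ x)) ⇒ Π x : Zcar, P @ x)
  (fn P a s p, zCases P
     (cNatInd @ (fn n, P @ pos n) @ a @ (fn n r, s @ pos n @ r))
     (cNatInd @ (fn n, P @ neg n) @ (p @ z0 @ a) @ (fn n r, p @ neg n @ r)))).

Instance addS : Lib := ltac:(lemma 0
  (Π x : Zcar, Π y : Zcar, x ⊕ (zsucc @ y) == zsucc @ (x ⊕ y))
  (fn x, zCases (fn y, x ⊕ (zsucc @ y) == zsucc @ (x ⊕ y)) (fn n, rfl)
     (natCases (fn n, x ⊕ (zsucc @ neg n) == zsucc @ (x ⊕ neg n)) (inv @ (zsuccPred @ x))
        (fun n => inv @ (zsuccPred @ (x ⊕ neg n)))))).
Instance addP : Lib := ltac:(lemma 0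
  (Π x : Zcar, Π y : Zcar, x ⊕ (zpred @ y) == zpred @ (x ⊕ y))
  (fn x, zCases (fn y, x ⊕ (zpred @ y) == zpred @ (x ⊕ y))
     (natCases (fn n, x ⊕ (zpred @ pos n) == zpred @ (x ⊕ pos n)) rfl (fun n => inv @ (zpredSucc @ (x ⊕ pos n))))
     (fn n, rfl))).
Instance commSP : Lib := ltac:(lemma 0
  (Π x : Zcar, zsucc @ (zpred @ x) == zpred @ (zsucc @ x))
  (fn x, zsuccPred @ x • inv @ (zpredSucc @ x))).
Instance addSl : Lib := ltac:(lemma 0
  (Π x : Zcar, Π y : Zcar, (zsucc @ x) ⊕ y == zsucc @ (x ⊕ y))
  (fn x, zInd @ (fn y, (zsucc @ x) ⊕ y == zsucc @ (x ⊕ y)) @ rfl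
     @ (fn y r, addS @ (zsucc @ x) @ y • cong @ zsucc @ r • cong @ zsucc @ (inv @ (addS @ x @ y)))
     @ (fn y r, addP @ (zsucc @ x) @ y • cong @ zpred @ r • inv @ (commSP @ (x ⊕ y))
          • cong @ zsucc @ (inv @ (addP @ x @ y))))).
Instance addPl : Lib := ltac:(lemma 0
  (Π x : Zcar, Π y : Zcar, (zpred @ x) ⊕ y == zpred @ (x ⊕ y))
  (fn x, zInd @ (fn y, (zpred @ x) ⊕ y == zpred @ (x ⊕ y)) @ rfl
     @ (fn y r, addS @ (zpred @ x) @ y • cong @ zsucc @ r • commSP @ (x ⊕ y)
          • cong @ zpred @ (inv @ (addS @ x @ y)))
     @ (fn y r, addP @ (zpred @ x) @ y • cong @ zpred @ r • cong @ zpred @ (inv @ (addP @ x @ y))))).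
Instance add0l : Lib := ltac:(lemma 0
  (Π x : Zcar, z0 ⊕ x == x)
  (zInd @ (fn x, z0 ⊕ x == x) @ rfl
     @ (fn x r, addS @ z0 @ x • cong @ zsucc @ r) @ (fn x r, addP @ z0 @ x • cong @ zpred @ r))).
Instance addC : Lib := ltac:(lemma 0
  (Π x : Zcar, Π y : Zcar, x ⊕ y == y ⊕ x)
  (fn x, zInd @ (fn y, x ⊕ y == y ⊕ x) @ (inv @ (add0l @ x))
     @ (fn y r, addS @ x @ y • cong @ zsucc @ r • inv @ (addSl @ y @ x))
     @ (fn y r, addP @ x @ y • cong @ zpred @ r • inv @ (addPl @ y @ x)))).
Instance addA : Lib := ltac:(lemma 0
  (Π x : Zcar, Π y : Zcar, Π z : Zcar, x ⊕ (y ⊕ z) == x ⊕ y ⊕ z)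
  (fn x y, zInd @ (fn z, x ⊕ (y ⊕ z) == x ⊕ y ⊕ z) @ rfl
     @ (fn z r, cong @ (zadd @ x) @ (addS @ y @ z) • addS @ x @ (y ⊕ z) • cong @ zsucc @ r
          • inv @ (addS @ (x ⊕ y) @ z))
     @ (fn z r, cong @ (zadd @ x) @ (addP @ y @ z) • addP @ x @ (y ⊕ z) • cong @ zpred @ r
          • inv @ (addP @ (x ⊕ y) @ z)))).

Instance oppS : Lib := ltac:(lemma 0
  (Π x : Zcar, zopp @ (zsucc @ x) == zpred @ (zopp @ x))
  (zCases (fn x, zopp @ (zsucc @ x) == zpred @ (zopp @ x))
     (natCases (fn n, zopp @ (zsucc @ pos n) == zpred @ (zopp @ pos n)) rfl (fun n => rfl))
     (natCases (fn n, zopp @ (zsucc @ neg n) == zpred @ (zopp @ neg n)) rfl (fun n => rfl)))).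
Instance oppP : Lib := ltac:(lemma 0
  (Π x : Zcar, zopp @ (zpred @ x) == zsucc @ (zopp @ x))
  (zCases (fn x, zopp @ (zpred @ x) == zsucc @ (zopp @ x))
     (natCases (fn n, zopp @ (zpred @ pos n) == zsucc @ (zopp @ pos n)) rfl
        (fun n => (natCases (fn n, zopp @ (zpred @ pos (cS @ n)) == zsucc @ (zopp @ pos (cS @ n))) rfl (fun n => rfl)) @ n))
     (fn n, rfl))).
Instance addN : Lib := ltac:(lemma 0
  (Π x : Zcar, x ⊕ (zopp @ x) == z0)
  (zInd @ (fn x, x ⊕ (zopp @ x) == z0) @ rfl
     @ (fn x r, cong @ (zadd @ (zsucc @ x)) @ (oppS @ x) • addP @ (zsucc @ x) @ (zopp @ x)
          • cong @ zpred @ (addSl @ x @ (zopp @ x)) • zpredSucc @ (x ⊕ (zopp @ x)) • r)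
     @ (fn x r, cong @ (zadd @ (zpred @ x)) @ (oppP @ x) • addS @ (zpred @ x) @ (zopp @ x)
          • cong @ zsucc @ (addPl @ x @ (zopp @ x)) • zsuccPred @ (x ⊕ (zopp @ x)) • r))).
Instance oppAdd : Lib := ltac:(lemma 0
  (Π x : Zcar, Π y : Zcar, zopp @ (x ⊕ y) == (zopp @ x) ⊕ (zopp @ y))
  (fn x, zInd @ (fn y, zopp @ (x ⊕ y) == (zopp @ x) ⊕ (zopp @ y)) @ rfl
     @ (fn y r, cong @ zopp @ (addS @ x @ y) • oppS @ (x ⊕ y) • cong @ zpred @ r
          • inv @ (addP @ (zopp @ x) @ (zopp @ y)) • cong @ (zadd @ (zopp @ x)) @ (inv @ (oppS @ y)))
     @ (fn y r, cong @ zopp @ (addP @ x @ y) • oppP @ (x ⊕ y) • cong @ zsucc @ r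
          • inv @ (addS @ (zopp @ x) @ (zopp @ y)) • cong @ (zadd @ (zopp @ x)) @ (inv @ (oppP @ y))))).
Instance addNK : Lib := ltac:(lemma 0
  (Π x : Zcar, Π y : Zcar, x ⊕ ((zopp @ x) ⊕ y) == y)
  (fn x y, addA @ x @ (zopp @ x) @ y • cong @ (fn t, t ⊕ y) @ (addN @ x) • add0l @ y)).
Instance NaddK : Lib := ltac:(lemma 0
  (Π x : Zcar, Π y : Zcar, (zopp @ x) ⊕ (x ⊕ y) == y)
  (fn x y, addA @ (zopp @ x) @ x @ y • cong @ (fn t, t ⊕ y) @ (addC @ (zopp @ x) @ x • addN @ x) • add0l @ y)).

(** This shows that multiplication commutes with opposites. *)
Instance oppUnique : Lib := ltac:(lemma 0
  (Π x : Zcar, Π y : Zcar, x ⊕ y == z0 ⇒ y == zopp @ x)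
  (fn x y h, inv @ (NaddK @ x @ y) • cong @ (zadd @ (zopp @ x)) @ h)).

Instance cong2 : Lib := ltac:(lemma 7
  (Π A : U 1, Π B : U 1, Π C : U 1, Π a : A, Π a' : A, Π b : B, Π b' : B,
    Π f : A ⇒ B ⇒ C, a == a' ⇒ b == b' ⇒ f @ a @ b == f @ a' @ b')
  (fn A B C a a' b b' f p q, cong @ (fn t, f @ t @ b) @ p • cong @ (f @ a') @ q)).
Instance medial : Lib := ltac:(lemma 1
  (Π A : U 0, Π f : A ⇒ A ⇒ A, (Π x : A, Π y : A, Π z : A, f @ x @ (f @ y @ z) == f @ (f @ x @ y) @ z) ⇒
    (Π x : A, Π y : A, f @ x @ y == f @ y @ x) ⇒ Π a : A, Π b : A, Π c : A, Π d : A,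
    f @ (f @ a @ b) @ (f @ c @ d) == f @ (f @ a @ c) @ (f @ b @ d))
  (fn A f fA fC a b c d,
    inv @ (fA @ a @ b @ (f @ c @ d))
    • cong @ (f @ a) @ (fA @ b @ c @ d • cong @ (fn t, f @ t @ d) @ (fC @ b @ c) • inv @ (fA @ c @ b @ d))
    • fA @ a @ c @ (f @ b @ d))).

Instance mulSl : Lib := ltac:(lemma 0
  (Π x : Zcar, Π y : Zcar, (zsucc @ x) ⊗ y == y ⊕ x ⊗ y)
  (fn x y, zCases (fn x, (zsucc @ x) ⊗ y == y ⊕ x ⊗ y) (fn n, rfl)
     (natCases (fn n, (zsucc @ neg n) ⊗ y == y ⊕ neg n ⊗ y) (inv @ (addN @ y))
        (fun n => inv @ (cong @ (zadd @ y) @ (oppAdd @ y @ (pos (cS @ n) ⊗ y)) • addNK @ y @ (neg n ⊗ y)))) @ x)).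
Instance mulPl : Lib := ltac:(lemma 0
  (Π x : Zcar, Π y : Zcar, (zpred @ x) ⊗ y == (zopp @ y) ⊕ x ⊗ y)
  (fn x y, zCases (fn x, (zpred @ x) ⊗ y == (zopp @ y) ⊕ x ⊗ y)
     (natCases (fn n, (zpred @ pos n) ⊗ y == (zopp @ y) ⊕ pos n ⊗ y) rfl
        (fun n => inv @ (NaddK @ y @ (pos n ⊗ y))))
     (fn n, oppAdd @ y @ (pos (cS @ n) ⊗ y)) @ x)).
Instance mulDr : Lib := ltac:(lemma 0
  (Π x : Zcar, Π y : Zcar, Π z : Zcar, x ⊗ (y ⊕ z) == x ⊗ y ⊕ x ⊗ z)
  (fn x y z, zInd @ (fn x, x ⊗ (y ⊕ z) == x ⊗ y ⊕ x ⊗ z) @ rfl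
     @ (fn x r, mulSl @ x @ (y ⊕ z) • cong @ (zadd @ (y ⊕ z)) @ r
          • medial @ zadd @ addA @ addC @ y @ z @ (x ⊗ y) @ (x ⊗ z)
          • cong2 @ zadd @ (inv @ (mulSl @ x @ y)) @ (inv @ (mulSl @ x @ z)))
     @ (fn x r, mulPl @ x @ (y ⊕ z) • cong2 @ zadd @ (oppAdd @ y @ z) @ r
          • medial @ zadd @ addA @ addC @ (zopp @ y) @ (zopp @ z) @ (x ⊗ y) @ (x ⊗ z)
          • cong2 @ zadd @ (inv @ (mulPl @ x @ y)) @ (inv @ (mulPl @ x @ z))) @ x)).
Instance mulDl : Lib := ltac:(lemma 0
  (Π x : Zcar, Π y : Zcar, Π z : Zcar, (x ⊕ y) ⊗ z == x ⊗ z ⊕ y ⊗ z)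
  (fn x y z, zInd @ (fn x, (x ⊕ y) ⊗ z == x ⊗ z ⊕ y ⊗ z)
     @ (cong @ (fn t, t ⊗ z) @ (add0l @ y) • inv @ (add0l @ (y ⊗ z)))
     @ (fn x r, cong @ (fn t, t ⊗ z) @ (addSl @ x @ y) • mulSl @ (x ⊕ y) @ z • cong @ (zadd @ z) @ r
          • addA @ z @ (x ⊗ z) @ (y ⊗ z) • cong @ (fn t, t ⊕ y ⊗ z) @ (inv @ (mulSl @ x @ z)))
     @ (fn x r, cong @ (fn t, t ⊗ z) @ (addPl @ x @ y) • mulPl @ (x ⊕ y) @ z • cong @ (zadd @ (zopp @ z)) @ r
          • addA @ (zopp @ z) @ (x ⊗ z) @ (y ⊗ z) • cong @ (fn t, t ⊕ y ⊗ z) @ (inv @ (mulPl @ x @ z))) @ x)).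
Instance mulNl : Lib := ltac:(lemma 0
  (Π x : Zcar, Π y : Zcar, (zopp @ x) ⊗ y == zopp @ (x ⊗ y))
  (fn x y, oppUnique @ (x ⊗ y) @ ((zopp @ x) ⊗ y)
     @ (inv @ (mulDl @ x @ (zopp @ x) @ y) • cong @ (fn t, t ⊗ y) @ (addN @ x)))).
Instance mulA : Lib := ltac:(lemma 0
  (Π x : Zcar, Π y : Zcar, Π z : Zcar, x ⊗ (y ⊗ z) == x ⊗ y ⊗ z)
  (fn x y z, zInd @ (fn x, x ⊗ (y ⊗ z) == x ⊗ y ⊗ z) @ rfl
     @ (fn x r, mulSl @ x @ (y ⊗ z) • cong @ (zadd @ (y ⊗ z)) @ r • inv @ (mulDl @ y @ (x ⊗ y) @ z)
          • cong @ (fn t, t ⊗ z) @ (inv @ (mulSl @ x @ y)))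
     @ (fn x r, mulPl @ x @ (y ⊗ z) • cong2 @ zadd @ (inv @ (mulNl @ y @ z)) @ r
          • inv @ (mulDl @ (zopp @ y) @ (x ⊗ y) @ z)
          • cong @ (fn t, t ⊗ z) @ (inv @ (mulPl @ x @ y))) @ x)).
Instance mul1r : Lib := ltac:(lemma 0
  (Π x : Zcar, x ⊗ z1 == x)
  (zInd @ (fn x, x ⊗ z1 == x) @ rfl
     @ (fn x r, mulSl @ x @ z1 • cong @ (zadd @ z1) @ r • addC @ z1 @ x)
     @ (fn x r, mulPl @ x @ z1 • cong @ (zadd @ neg cO) @ r • addC @ neg cO @ x))).
Instance mul0r : Lib := ltac:(lemma 0
  (Π x : Zcar, x ⊗ z0 == z0)
  (zInd @ (fn x, x ⊗ z0 == z0) @ rfl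
     @ (fn x r, mulSl @ x @ z0 • cong @ (zadd @ z0) @ r)
     @ (fn x r, mulPl @ x @ z0 • cong @ (zadd @ z0) @ r))).

(** * Rings *)

Instance IsRing : Lib := ltac:(lemma 0
  (Π C : U 0, C ⇒ C ⇒ (C ⇒ C ⇒ C) ⇒ (C ⇒ C ⇒ C) ⇒ U 0)
  (λ C : U 0, fn z u a m, isRing (RawRing C z u a m))).

(** The operations of a ring are bound one by one to keep the type of each law small. *)
Definition forRing (P : hterm -> hterm -> hterm -> hterm -> hterm -> hterm -> hterm) : hterm :=
  Π C : U 0, Π z : C, Π u : C, Π a : C ⇒ C ⇒ C, Π m : C ⇒ C ⇒ C,
  Π h : IsRing @ C @ z @ u @ a @ m, P C z u a m h.
Instance rAddA : Lib := ltac:(lemma 5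
  (forRing (fun C z u a m h => Π x : C, Π y : C, Π w : C, a @ x @ (a @ y @ w) == a @ (a @ x @ y) @ w))
  (fn C z u a m h, pr1 @ (pr2 @ h))).
Instance rAdd0 : Lib := ltac:(lemma 5
  (forRing (fun C z u a m h => Π x : C, a @ x @ z == x))
  (fn C z u a m h, pr1 @ (pr2 @ (pr2 @ (pr2 @ h))))).
Instance rOpp : Lib := ltac:(lemma 5
  (forRing (fun C z u a m h => Π x : C, Σ y : C, a @ x @ y == z))
  (fn C z u a m h, pr1 @ (pr2 @ (pr2 @ (pr2 @ (pr2 @ h)))))).
Instance rMulA : Lib := ltac:(lemma 5
  (forRing (fun C z u a m h => Π x : C, Π y : C, Π w : C, m @ x @ (m @ y @ w) == m @ (m @ x @ y) @ w))
  (fn C z u a m h, pr1 @ (pr2 @ (pr2 @ (pr2 @ (pr2 @ (pr2 @ h))))))).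
Instance rMul1l : Lib := ltac:(lemma 5
  (forRing (fun C z u a m h => Π x : C, m @ u @ x == x))
  (fn C z u a m h, pr1 @ (pr2 @ (pr2 @ (pr2 @ (pr2 @ (pr2 @ (pr2 @ h)))))))).
Instance rMul1r : Lib := ltac:(lemma 5
  (forRing (fun C z u a m h => Π x : C, m @ x @ u == x))
  (fn C z u a m h, pr1 @ (pr2 @ (pr2 @ (pr2 @ (pr2 @ (pr2 @ (pr2 @ (pr2 @ h))))))))).
Instance rMulDr : Lib := ltac:(lemma 5
  (forRing (fun C z u a m h => Π x : C, Π y : C, Π w : C, m @ x @ (a @ y @ w) == a @ (m @ x @ y) @ (m @ x @ w)))
  (fn C z u a m h, pr1 @ (pr2 @ (pr2 @ (pr2 @ (pr2 @ (pr2 @ (pr2 @ (pr2 @ (pr2 @ h)))))))))).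
Instance rMulDl : Lib := ltac:(lemma 5
  (forRing (fun C z u a m h => Π x : C, Π y : C, Π w : C, m @ (a @ x @ y) @ w == a @ (m @ x @ w) @ (m @ y @ w)))
  (fn C z u a m h, pr2 @ (pr2 @ (pr2 @ (pr2 @ (pr2 @ (pr2 @ (pr2 @ (pr2 @ (pr2 @ h)))))))))).

(** Serves to show x · 0 = 0 and 0 · x = 0, since by distributivity these products are
    additively idempotent. *)
Instance rIdem0 : Lib := ltac:(lemma 5
  (forRing (fun C z u a m h => Π x : C, a @ x @ x == x ⇒ x == z))
  (fn C z u a m h x p,
    inv @ (rAdd0 @ h @ x) • cong @ (a @ x) @ (inv @ (pr2 @ (rOpp @ h @ x)))
    • rAddA @ h @ x @ x @ (pr1 @ (rOpp @ h @ x))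
    • cong @ (fn t, a @ t @ (pr1 @ (rOpp @ h @ x))) @ p • pr2 @ (rOpp @ h @ x))).
Instance rMul0r : Lib := ltac:(lemma 5
  (forRing (fun C z u a m h => Π x : C, m @ x @ z == z))
  (fn C z u a m h x, rIdem0 @ h @ (m @ x @ z)
    @ (inv @ (rMulDr @ h @ x @ z @ z) • cong @ (m @ x) @ (rAdd0 @ h @ z)))).
Instance rMul0l : Lib := ltac:(lemma 5
  (forRing (fun C z u a m h => Π x : C, m @ z @ x == z))
  (fn C z u a m h x, rIdem0 @ h @ (m @ z @ x)
    @ (inv @ (rMulDl @ h @ z @ z @ x) • cong @ (fn t, m @ t @ x) @ (rAdd0 @ h @ z)))).
Instance zRing : Lib := ltac:(lemma 0
  (isSet Zcar ⇒ IsRing @ Zcar @ z0 @ z1 @ zadd @ zmul)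
  (fn h, ⟨h, ⟨addA, ⟨addC, ⟨fn x, rfl, ⟨fn x, ⟨zopp @ x, addN @ x⟩,
    ⟨mulA, ⟨fn x, rfl, ⟨mul1r, ⟨mulDr, mulDl⟩⟩⟩⟩⟩⟩⟩⟩⟩)).

(** * Direct sums *)

Instance plusA : Lib := ltac:(lemma 0
  (Π n : cNat, Π k : cNat, Π l : cNat, plus n (plus k l) == plus (plus n k) l)
  (fn n k l, cNatInd @ (fn n, plus n (plus k l) == plus (plus n k) l) @ rfl
    @ (fn n r, cong @ cS @ r) @ n)).
Instance plus0 : Lib := ltac:(lemma 0
  (Π n : cNat, plus n cO == n)
  (cNatInd @ (fn n, plus n cO == n) @ rfl @ (fn n r, cong @ cS @ r))).

Definition forDS (P : hterm -> hterm -> hterm -> hterm -> hterm -> (hterm -> hterm -> hterm) ->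
    (hterm -> hterm -> hterm) -> hterm) : hterm :=
  Π G : cNat ⇒ U 0, Π z : (Π n : cNat, G @ n), Π a : (Π n : cNat, G @ n ⇒ G @ n ⇒ G @ n),
  P G z a (cDS @ G @ z @ a) (cDSZero @ G @ z @ a) (fun n x => cDSBase @ G @ z @ a @ n @ x)
    (fun x y => cDSAdd @ G @ z @ a @ x @ y).

(** Into a family of propositions only the values on generators matter. *)
Instance dsIndProp : Lib := ltac:(lemma 3
  (forDS (fun G z a D zero base plus =>
    Π P : D ⇒ U 0, (Π x : D, isProp (P @ x)) ⇒ P @ zero ⇒
    (Π n : cNat, Π x : G @ n, P @ base n x) ⇒
    (Π x : D, Π y : D, P @ x ⇒ P @ y ⇒ P @ plus x y) ⇒ Π x : D, P @ x))
  (fn G z a P h constEl pb pa, cDSInd @ G @ z @ a @ P @ (fn x, propSet @ (h @ x)) @ constEl @ pb @ pa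
     @ (fn x y w u v t, h @ hole @ hole @ hole) @ (fn x y u v, h @ hole @ hole @ hole)
     @ (fn x u, h @ hole @ hole @ hole) @ (fn n, h @ hole @ hole @ hole)
     @ (fn n x y, h @ hole @ hole @ hole))).

(** The path conditions of a recursor are transports in a constant family. *)
Instance transportConst : Lib := ltac:(lemma 4
  (Π A : U 0, Π M : U 0, Π x : A, Π y : A, Π p : x == y, Π u : M,
    transport A (fn _, M) x y p u == u)
  (fn A M x y p u, Jp (fn y p, transport A (fn _, M) x y p u == u) rfl p)).
Instance dsRec : Lib := ltac:(lemma 4
  (forDS (fun G z a D zero base plus =>
    Π M : U 0, isSet M ⇒ Π m0 : M, Π b : (Π n : cNat, G @ n ⇒ M), Π p : M ⇒ M ⇒ M,
    (Π x : M, Π y : M, Π w : M, p @ x @ (p @ y @ w) == p @ (p @ x @ y) @ w) ⇒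
    (Π x : M, Π y : M, p @ x @ y == p @ y @ x) ⇒
    (Π x : M, p @ x @ m0 == x) ⇒
    (Π n : cNat, b @ n @ (z @ n) == m0) ⇒
    (Π n : cNat, Π x : G @ n, Π y : G @ n, p @ (b @ n @ x) @ (b @ n @ y) == b @ n @ (a @ n @ x @ y)) ⇒
    D ⇒ M))
  (fn G z a M h m0 b p polyAddA polyAddC polyAdd0 bz ba,
     cDSInd @ G @ z @ a @ (fn _, M) @ (fn _, h) @ m0 @ b @ (fn _ _ u v, p @ u @ v)
     @ (fn x y w u v t, transportConst @ hole @ hole • polyAddA @ u @ v @ t)
     @ (fn x y u v, transportConst @ hole @ hole • polyAddC @ u @ v)
     @ (fn x u, transportConst @ hole @ hole • polyAdd0 @ u)
     @ (fn n, transportConst @ hole @ hole • bz @ n)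
     @ (fn n x y, transportConst @ hole @ hole • ba @ n @ x @ y))).

(** * Polynomial rings *)

Definition constFam (C : hterm) : hterm := λ _ : cNat, C.
Definition constEl (z : hterm) : hterm := λ _ : cNat, z.
Definition polyCar (C z a : hterm) : hterm := cDS @ constFam C @ constEl z @ constEl a.
Definition polyZero (C z a : hterm) : hterm := cDSZero @ constFam C @ constEl z @ constEl a.
Definition polyBase (C z a n x : hterm) : hterm := cDSBase @ constFam C @ constEl z @ constEl a @ n @ x.
Definition polyAdd (C z a : hterm) : hterm := cDSAdd @ constFam C @ constEl z @ constEl a.
Definition polySet (C z a : hterm) : hterm := cDSSet @ constFam C @ constEl z @ constEl a.
Definition polyAddA (C z a : hterm) : hterm := cDSAssoc @ constFam C @ constEl z @ constEl a.
Definition polyAddC (C z a : hterm) : hterm := cDSComm @ constFam C @ constEl z @ constEl a.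
Definition polyAdd0 (C z a : hterm) : hterm := cDSUnit @ constFam C @ constEl z @ constEl a.
Definition polyBaseZero (C z a : hterm) : hterm := cDSBaseZero @ constFam C @ constEl z @ constEl a.
Definition polyBaseAdd (C z a : hterm) : hterm := cDSBaseAdd @ constFam C @ constEl z @ constEl a.

Instance pointwiseA : Lib := ltac:(lemma 2
  (Π D : U 0, Π M : U 0, Π f : M ⇒ M ⇒ M, (Π x : M, Π y : M, Π w : M, f @ x @ (f @ y @ w) == f @ (f @ x @ y) @ w) ⇒
    Π p : D ⇒ M, Π q : D ⇒ M, Π r : D ⇒ M,
    (λ t : D, f @ (p @ t) @ (f @ (q @ t) @ (r @ t))) == (λ t : D, f @ (f @ (p @ t) @ (q @ t)) @ (r @ t)))
  (fn D M f h p q r, funext @ (fn t, h @ (p @ t) @ (q @ t) @ (r @ t)))).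
Instance pointwiseC : Lib := ltac:(lemma 2
  (Π D : U 0, Π M : U 0, Π f : M ⇒ M ⇒ M, (Π x : M, Π y : M, f @ x @ y == f @ y @ x) ⇒
    Π p : D ⇒ M, Π q : D ⇒ M, (λ t : D, f @ (p @ t) @ (q @ t)) == (λ t : D, f @ (q @ t) @ (p @ t)))
  (fn D M f h p q, funext @ (fn t, h @ (p @ t) @ (q @ t)))).
Instance pointwise0 : Lib := ltac:(lemma 2
  (Π D : U 0, Π M : U 0, Π f : M ⇒ M ⇒ M, Π e : M, (Π x : M, f @ x @ e == x) ⇒
    Π p : D ⇒ M, Id (D ⇒ M) (λ t : D, f @ (p @ t) @ e) p)
  (fn D M f e h p, funext @ (fn t, h @ (p @ t)))).
Instance baseM0 : Lib := ltac:(lemma 5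
  (forRing (fun C z u a m h => Π n : cNat, Π x : C, polyBase C z a n (m @ x @ z) == polyZero C z a))
  (fn C z u a m h n x, cong @ (fn t, polyBase C z a n t) @ (rMul0r @ h @ x) • polyBaseZero C z a @ n)).
Instance base0M : Lib := ltac:(lemma 5
  (forRing (fun C z u a m h => Π n : cNat, Π x : C, polyBase C z a n (m @ z @ x) == polyZero C z a))
  (fn C z u a m h n x, cong @ (fn t, polyBase C z a n t) @ (rMul0l @ h @ x) • polyBaseZero C z a @ n)).
Instance baseMDr : Lib := ltac:(lemma 5
  (forRing (fun C z u a m h => Π n : cNat, Π x : C, Π y : C, Π w : C,
     polyAdd C z a @ polyBase C z a n (m @ x @ y) @ polyBase C z a n (m @ x @ w) == polyBase C z a n (m @ x @ (a @ y @ w))))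
  (fn C z u a m h n x y w, polyBaseAdd C z a @ n @ (m @ x @ y) @ (m @ x @ w)
     • cong @ (fn t, polyBase C z a n t) @ (inv @ (rMulDr @ h @ x @ y @ w)))).
Instance baseMDl : Lib := ltac:(lemma 5
  (forRing (fun C z u a m h => Π n : cNat, Π x : C, Π y : C, Π w : C,
     polyAdd C z a @ polyBase C z a n (m @ x @ w) @ polyBase C z a n (m @ y @ w) == polyBase C z a n (m @ (a @ x @ y) @ w)))
  (fn C z u a m h n x y w, polyBaseAdd C z a @ n @ (m @ x @ w) @ (m @ y @ w)
     • cong @ (fn t, polyBase C z a n t) @ (inv @ (rMulDl @ h @ x @ y @ w)))).

(** Multiplication by the monomial x Xⁿ, additive by construction. *)
Instance monomialMul : Lib := ltac:(lemma 5
  (forRing (fun C z u a m h => cNat ⇒ C ⇒ polyCar C z a ⇒ polyCar C z a))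
  (fn C z u a m h n x, dsRec @ (polySet C z a) @ (polyZero C z a)
     @ (fn k y, polyBase C z a (plus n k) (m @ x @ y)) @ (polyAdd C z a)
     @ (polyAddA C z a) @ (polyAddC C z a) @ (polyAdd0 C z a)
     @ (fn k, baseM0 @ h @ plus n k @ x) @ (fn k, baseMDr @ h @ plus n k @ x))).
Instance monomialMul0 : Lib := ltac:(lemma 5
  (forRing (fun C z u a m h => Π n : cNat, monomialMul @ h @ n @ z == (λ y : polyCar C z a, polyZero C z a)))
  (fn C z u a m h n, funext @ (dsIndProp @ (λ y : polyCar C z a, Id (polyCar C z a) (monomialMul @ h @ n @ z @ y) (polyZero C z a))
          @ (fn y, polySet C z a @ hole @ hole) @ rfl
          @ (fn k, base0M @ h @ plus n k)
          @ (fn y w r s, cong2 @ polyAdd C z a @ r @ s • polyAdd0 C z a @ polyZero C z a)))).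
Instance monomialMulD : Lib := ltac:(lemma 5
  (forRing (fun C z u a m h => Π n : cNat, Π x : C, Π x' : C,
     (λ y : polyCar C z a, polyAdd C z a @ (monomialMul @ h @ n @ x @ y) @ (monomialMul @ h @ n @ x' @ y)) ==
     monomialMul @ h @ n @ (a @ x @ x')))
  (fn C z u a m h n x x', funext @ (dsIndProp
          @ (λ y : polyCar C z a, Id (polyCar C z a) (polyAdd C z a @ (monomialMul @ h @ n @ x @ y) @ (monomialMul @ h @ n @ x' @ y))
               (monomialMul @ h @ n @ (a @ x @ x') @ y))
          @ (fn y, polySet C z a @ hole @ hole) @ (polyAdd0 C z a @ polyZero C z a)
          @ (fn k, baseMDl @ h @ plus n k @ x @ x')
          @ (fn y w r s, medial @ polyAdd C z a @ polyAddA C z a @ polyAddC C z a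
               @ (monomialMul @ h @ n @ x @ y) @ (monomialMul @ h @ n @ x @ w)
               @ (monomialMul @ h @ n @ x' @ y) @ (monomialMul @ h @ n @ x' @ w)
               • cong2 @ polyAdd C z a @ r @ s)))).

(** Additive in the first factor, with values in the set of functions of the second factor.
    Hence the product has the expected value on monomials and distributes over
    sums on the left by computation. *)
Instance polyMul : Lib := ltac:(lemma 5
  (forRing (fun C z u a m h => polyCar C z a ⇒ polyCar C z a ⇒ polyCar C z a))
  (fn C z u a m h, 
     let D := polyCar C z a in
     dsRec @ (setPi @ (λ _ : D, polySet C z a)) @ (λ _ : D, polyZero C z a)
     @ (monomialMul @ h) @ (λ f : D ⇒ D, λ g : D ⇒ D, λ y : D, polyAdd C z a @ (f @ y) @ (g @ y))
     @ (pointwiseA @ polyAdd C z a @ polyAddA C z a) @ (pointwiseC @ polyAdd C z a @ polyAddC C z a) @ (pointwise0 @ polyAdd C z a @ polyZero C z a @ polyAdd0 C z a)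
     @ (monomialMul0 @ h) @ (monomialMulD @ h))).
Definition polyLaw (P : (hterm -> hterm -> hterm) -> (hterm -> hterm -> hterm) -> hterm -> hterm) : hterm :=
  forRing (fun C z u a m h =>
    P (fun x y => polyAdd C z a @ x @ y) (fun x y => polyMul @ h @ x @ y) (polyCar C z a)).
Instance polyMulDr : Lib := ltac:(lemma 5
  (polyLaw (fun add mul D => Π x : D, Π y : D, Π w : D,
     Id D (mul x (add y w)) (add (mul x y) (mul x w))))
  (fn C z u a m h, fn x y w,
     let D := polyCar C z a in
     let mul x y := polyMul @ h @ x @ y in
     let add x y := polyAdd C z a @ x @ y in
     dsIndProp @ (λ x : D, Id D (mul x (add y w)) (add (mul x y) (mul x w)))
      @ (fn x, polySet C z a @ hole @ hole) @ (inv @ (polyAdd0 C z a @ polyZero C z a)) @ (fn n c, rfl)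
      @ (fn x x' r s, cong2 @ polyAdd C z a @ r @ s
           • medial @ polyAdd C z a @ polyAddA C z a @ polyAddC C z a @ mul x y @ mul x w @ mul x' y @ mul x' w) @ x)).

(** Both sides are additive in each variable, so that three monomials remain. *)
Instance polyMulA : Lib := ltac:(lemma 5
  (polyLaw (fun add mul D => Π x : D, Π y : D, Π w : D,
     Id D (mul x (mul y w)) (mul (mul x y) w)))
  (fn C z u a m h, fn x y w,
     let D := polyCar C z a in
     let mul x y := polyMul @ h @ x @ y in
     let base n c := polyBase C z a n c in
     dsIndProp @ (λ x : D, Id D (mul x (mul y w)) (mul (mul x y) w))
      @ (fn x, polySet C z a @ hole @ hole) @ rfl
      @ (fn n c, dsIndProp @ (λ y : D, Id D (mul (base n c) (mul y w)) (mul (mul (base n c) y) w))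
         @ (fn x, polySet C z a @ hole @ hole) @ rfl
         @ (fn k d, dsIndProp @ (λ w : D, Id D (mul (base n c) (mul (base k d) w))
                                         (mul (mul (base n c) (base k d)) w))
             @ (fn x, polySet C z a @ hole @ hole) @ rfl
             @ (fn l e, cong2 @ (λ n : cNat, λ x : C, base n x) @ (plusA @ n @ k @ l) @ (rMulA @ h @ c @ d @ e))
             @ (fn w w' r s, cong2 @ polyAdd C z a @ r @ s) @ w)
         @ (fn y y' r s, cong2 @ polyAdd C z a @ r @ s) @ y)
      @ (fn x x' r s, cong2 @ polyAdd C z a @ r @ s) @ x)).
Instance polyMul1l : Lib := ltac:(lemma 5
  (forRing (fun C z u a m h => Π x : polyCar C z a, polyMul @ h @ polyBase C z a cO u @ x == x))
  (fn C z u a m h,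
     let D := polyCar C z a in
     dsIndProp @ (λ x : D, Id D (polyMul @ h @ polyBase C z a cO u @ x) x)
      @ (fn x, polySet C z a @ hole @ hole) @ rfl
      @ (fn n c, cong @ (fn t, polyBase C z a n t) @ (rMul1l @ h @ c))
      @ (fn x x' r s, cong2 @ polyAdd C z a @ r @ s))).
Instance polyMul1r : Lib := ltac:(lemma 5
  (forRing (fun C z u a m h => Π x : polyCar C z a, polyMul @ h @ x @ polyBase C z a cO u == x))
  (fn C z u a m h,
     let D := polyCar C z a in
     dsIndProp @ (λ x : D, Id D (polyMul @ h @ x @ polyBase C z a cO u) x)
      @ (fn x, polySet C z a @ hole @ hole) @ rfl
      @ (fn n c, cong2 @ (λ n : cNat, λ x : C, polyBase C z a n x) @ (plus0 @ n) @ (rMul1r @ h @ c))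
      @ (fn x x' r s, cong2 @ polyAdd C z a @ r @ s))).

(** Makes the type of opposites of x a proposition, so that opposites of polynomials can
    be found by induction on generators. *)
Instance oppProp : Lib := ltac:(lemma 1
  (Π A : U 0, Π z : A, Π f : A ⇒ A ⇒ A, isSet A ⇒
    (Π x : A, Π y : A, Π w : A, f @ x @ (f @ y @ w) == f @ (f @ x @ y) @ w) ⇒
    (Π x : A, Π y : A, f @ x @ y == f @ y @ x) ⇒ (Π x : A, f @ x @ z == x) ⇒
    Π x : A, isProp (Σ y : A, f @ x @ y == z))
  (fn A z f h fA fC f0 x,
    cSigInd @ A @ (fn y, f @ x @ y == z)
      @ (fn p, Π q : (Σ y : A, f @ x @ y == z), p == q)
      @ (fn y p, cSigInd @ A @ (fn y, f @ x @ y == z)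
           @ (fn q, Id (Σ y : A, f @ x @ y == z) ⟨y, p⟩ q)
           @ (fn w q, sigEq @ (fn y, h @ (f @ x @ y) @ z) @ y @ w @ p @ q
               @ (inv @ (f0 @ y) • cong @ (f @ y) @ (inv @ q) • fA @ y @ x @ w
                  • cong @ (fn t, f @ t @ w) @ (fC @ y @ x • p) • fC @ z @ w • f0 @ w))))).
Instance polyOpp : Lib := ltac:(lemma 5
  (forRing (fun C z u a m h => Π x : polyCar C z a,
     Σ y : polyCar C z a, polyAdd C z a @ x @ y == polyZero C z a))
  (fn C z u a m h,
     let D := polyCar C z a in
     let P := λ x : D, Σ y : D, Id D (polyAdd C z a @ x @ y) (polyZero C z a) in
     dsIndProp @ P
      @ (oppProp @ polyZero C z a @ polyAdd C z a @ polySet C z a @ polyAddA C z a @ polyAddC C z a @ polyAdd0 C z a)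
      @ ⟨polyZero C z a, polyAdd0 C z a @ polyZero C z a⟩
      @ (fn n c, ⟨polyBase C z a n (pr1 @ (rOpp @ h @ c)),
           polyBaseAdd C z a @ n @ c @ (pr1 @ (rOpp @ h @ c))
           • cong @ (fn t, polyBase C z a n t) @ (pr2 @ (rOpp @ h @ c)) • polyBaseZero C z a @ n⟩)
      @ (λ x : D, λ y : D, λ r : P @ x, λ s : P @ y, ⟨polyAdd C z a @ (pr1 @ r) @ (pr1 @ s),
           medial @ polyAdd C z a @ polyAddA C z a @ polyAddC C z a @ x @ y @ (pr1 @ r) @ (pr1 @ s)
           • cong2 @ polyAdd C z a @ (pr2 @ r) @ (pr2 @ s) • polyAdd0 C z a @ polyZero C z a⟩))).
Instance polyRing : Lib := ltac:(lemma 5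
  (forRing (fun C z u a m h => 
     IsRing @ polyCar C z a @ polyZero C z a @ polyBase C z a cO u @ polyAdd C z a @ (polyMul @ h)))
  (fn C z u a m h,
    ⟨polySet C z a, ⟨polyAddA C z a, ⟨polyAddC C z a, ⟨polyAdd0 C z a, ⟨polyOpp @ h,
    ⟨polyMulA @ h, ⟨polyMul1l @ h, ⟨polyMul1r @ h, ⟨polyMulDr @ h, fn x y w, rfl⟩⟩⟩⟩⟩⟩⟩⟩⟩)).

(** * Dual numbers *)

(** The maps f0, f1 and g identify A with ℤ × ℤ in such a way that the operations of A
    become those of x₀ + x₁ ε with ε² = 0. *)
Instance IsDual : Lib := ltac:(lemma 0
  (Π A : U 0, A ⇒ A ⇒ (A ⇒ A ⇒ A) ⇒ (A ⇒ A ⇒ A) ⇒ (A ⇒ Zcar) ⇒ (A ⇒ Zcar) ⇒ (Zcar ⇒ Zcar ⇒ A) ⇒ U 0)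
  (λ A : U 0, fn z u a m f0 f1 g,
    (Π x : A, g @ (f0 @ x) @ (f1 @ x) == x)
    × (Π x : Zcar, Π y : Zcar, f0 @ (g @ x @ y) == x)
    × (Π x : Zcar, Π y : Zcar, f1 @ (g @ x @ y) == y)
    × (f0 @ z == z0) × (f1 @ z == z0) × (f0 @ u == z1) × (f1 @ u == z0)
    × (Π x : A, Π y : A, f0 @ (a @ x @ y) == f0 @ x ⊕ f0 @ y)
    × (Π x : A, Π y : A, f1 @ (a @ x @ y) == f1 @ x ⊕ f1 @ y)
    × (Π x : A, Π y : A, f0 @ (m @ x @ y) == (f0 @ x) ⊗ (f0 @ y))
    × (Π x : A, Π y : A, f1 @ (m @ x @ y) == (f0 @ x) ⊗ (f1 @ y) ⊕ (f1 @ x) ⊗ (f0 @ y)))).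
Definition forDual (P : hterm -> hterm -> hterm -> hterm -> hterm -> hterm -> hterm -> hterm -> hterm -> hterm) : hterm :=
  Π A : U 0, Π z : A, Π u : A, Π a : A ⇒ A ⇒ A, Π m : A ⇒ A ⇒ A,
  Π f0 : A ⇒ Zcar, Π f1 : A ⇒ Zcar, Π g : Zcar ⇒ Zcar ⇒ A,
  Π d : IsDual @ A @ z @ u @ a @ m @ f0 @ f1 @ g, P A z u a m f0 f1 g d.
Instance dGF : Lib := ltac:(lemma 8
  (forDual (fun A z u a m f0 f1 g d => Π x : A, g @ (f0 @ x) @ (f1 @ x) == x))
  (fn A z u a m f0 f1 g d, pr1 @ d)).
Instance dFG0 : Lib := ltac:(lemma 8
  (forDual (fun A z u a m f0 f1 g d => Π x : Zcar, Π y : Zcar, f0 @ (g @ x @ y) == x))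
  (fn A z u a m f0 f1 g d, pr1 @ (pr2 @ d))).
Instance dFG1 : Lib := ltac:(lemma 8
  (forDual (fun A z u a m f0 f1 g d => Π x : Zcar, Π y : Zcar, f1 @ (g @ x @ y) == y))
  (fn A z u a m f0 f1 g d, pr1 @ (pr2 @ (pr2 @ d)))).
Instance dZ0 : Lib := ltac:(lemma 8
  (forDual (fun A z u a m f0 f1 g d => f0 @ z == z0))
  (fn A z u a m f0 f1 g d, pr1 @ (pr2 @ (pr2 @ (pr2 @ d))))).
Instance dZ1 : Lib := ltac:(lemma 8
  (forDual (fun A z u a m f0 f1 g d => f1 @ z == z0))
  (fn A z u a m f0 f1 g d, pr1 @ (pr2 @ (pr2 @ (pr2 @ (pr2 @ d)))))).
Instance dU0 : Lib := ltac:(lemma 8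
  (forDual (fun A z u a m f0 f1 g d => f0 @ u == z1))
  (fn A z u a m f0 f1 g d, pr1 @ (pr2 @ (pr2 @ (pr2 @ (pr2 @ (pr2 @ d))))))).
Instance dU1 : Lib := ltac:(lemma 8
  (forDual (fun A z u a m f0 f1 g d => f1 @ u == z0))
  (fn A z u a m f0 f1 g d, pr1 @ (pr2 @ (pr2 @ (pr2 @ (pr2 @ (pr2 @ (pr2 @ d)))))))).
Instance dA0 : Lib := ltac:(lemma 8
  (forDual (fun A z u a m f0 f1 g d => Π x : A, Π y : A, f0 @ (a @ x @ y) == f0 @ x ⊕ f0 @ y))
  (fn A z u a m f0 f1 g d, pr1 @ (pr2 @ (pr2 @ (pr2 @ (pr2 @ (pr2 @ (pr2 @ (pr2 @ d))))))))).
Instance dA1 : Lib := ltac:(lemma 8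
  (forDual (fun A z u a m f0 f1 g d => Π x : A, Π y : A, f1 @ (a @ x @ y) == f1 @ x ⊕ f1 @ y))
  (fn A z u a m f0 f1 g d, pr1 @ (pr2 @ (pr2 @ (pr2 @ (pr2 @ (pr2 @ (pr2 @ (pr2 @ (pr2 @ d)))))))))).
Instance dM0 : Lib := ltac:(lemma 8
  (forDual (fun A z u a m f0 f1 g d => Π x : A, Π y : A, f0 @ (m @ x @ y) == (f0 @ x) ⊗ (f0 @ y)))
  (fn A z u a m f0 f1 g d, pr1 @ (pr2 @ (pr2 @ (pr2 @ (pr2 @ (pr2 @ (pr2 @ (pr2 @ (pr2 @ (pr2 @ d))))))))))).
Instance dM1 : Lib := ltac:(lemma 8
  (forDual (fun A z u a m f0 f1 g d => Π x : A, Π y : A,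
     f1 @ (m @ x @ y) == (f0 @ x) ⊗ (f1 @ y) ⊕ (f1 @ x) ⊗ (f0 @ y)))
  (fn A z u a m f0 f1 g d, pr2 @ (pr2 @ (pr2 @ (pr2 @ (pr2 @ (pr2 @ (pr2 @ (pr2 @ (pr2 @ (pr2 @ d))))))))))).

(** Reduces equations in A to equations between integers. *)
Instance dEq : Lib := ltac:(lemma 8
  (forDual (fun A z u a m f0 f1 g d => Π x : A, Π y : A, f0 @ x == f0 @ y ⇒ f1 @ x == f1 @ y ⇒ x == y))
  (fn A z u a m f0 f1 g d x y p q, inv @ (dGF @ d @ x) • cong2 @ g @ p @ q • dGF @ d @ y)).

(** Laws of the integers are transferred along each additive component. *)
Definition forHom (P : hterm -> hterm -> hterm -> hterm) : hterm :=
  Π A : U 0, Π a : A ⇒ A ⇒ A, Π f : A ⇒ Zcar,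
  (Π x : A, Π y : A, f @ (a @ x @ y) == f @ x ⊕ f @ y) ⇒ P A a f.
Instance homA : Lib := ltac:(lemma 3
  (forHom (fun A a f => Π x : A, Π y : A, Π w : A, f @ (a @ x @ (a @ y @ w)) == f @ (a @ (a @ x @ y) @ w)))
  (fn A a f h x y w, h @ x @ (a @ y @ w) • cong @ (zadd @ (f @ x)) @ (h @ y @ w)
     • addA @ (f @ x) @ (f @ y) @ (f @ w) • cong @ (fn t, t ⊕ f @ w) @ (inv @ (h @ x @ y))
     • inv @ (h @ (a @ x @ y) @ w))).
Instance homC : Lib := ltac:(lemma 3
  (forHom (fun A a f => Π x : A, Π y : A, f @ (a @ x @ y) == f @ (a @ y @ x)))
  (fn A a f h x y, h @ x @ y • addC @ (f @ x) @ (f @ y) • inv @ (h @ y @ x))).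
Instance hom0 : Lib := ltac:(lemma 3
  (forHom (fun A a f => Π z : A, f @ z == z0 ⇒ Π x : A, f @ (a @ x @ z) == f @ x))
  (fn A a f h z hz x, h @ x @ z • cong @ (zadd @ (f @ x)) @ hz)).

(** The component of degree 1 of a triple product of dual numbers. *)
Instance dualMulA : Lib := ltac:(lemma 0
  (Π x : Zcar, Π x' : Zcar, Π y : Zcar, Π y' : Zcar, Π w : Zcar, Π w' : Zcar,
    x ⊗ (y ⊗ w' ⊕ y' ⊗ w) ⊕ x' ⊗ (y ⊗ w) == x ⊗ y ⊗ w' ⊕ (x ⊗ y' ⊕ x' ⊗ y) ⊗ w)
  (fn x x' y y' w w',
    cong @ (fn t, t ⊕ x' ⊗ (y ⊗ w)) @ (mulDr @ x @ (y ⊗ w') @ (y' ⊗ w))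
    • inv @ (addA @ (x ⊗ (y ⊗ w')) @ (x ⊗ (y' ⊗ w)) @ (x' ⊗ (y ⊗ w)))
    • cong2 @ zadd @ (mulA @ x @ y @ w')
        @ (cong2 @ zadd @ (mulA @ x @ y' @ w) @ (mulA @ x' @ y @ w)
           • inv @ (mulDl @ (x ⊗ y') @ (x' ⊗ y) @ w)))).

Instance dualMulA1 : Lib := ltac:(lemma 8
  (forDual (fun A z u a m f0 f1 g d => Π x : A, Π y : A, Π w : A, m @ x @ (m @ y @ w) == m @ (m @ x @ y) @ w))
  (fn A z u a m f0 f1 g d x y w,
    dEq @ d @ (m @ x @ (m @ y @ w)) @ (m @ (m @ x @ y) @ w)
      @ (dM0 @ d @ x @ (m @ y @ w) • cong @ (zmul @ (f0 @ x)) @ (dM0 @ d @ y @ w)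
         • mulA @ (f0 @ x) @ (f0 @ y) @ (f0 @ w)
         • cong @ (fn t, t ⊗ (f0 @ w)) @ (inv @ (dM0 @ d @ x @ y)) • inv @ (dM0 @ d @ (m @ x @ y) @ w))
      @ (dM1 @ d @ x @ (m @ y @ w)
         • cong2 @ (fn s t, (f0 @ x) ⊗ s ⊕ (f1 @ x) ⊗ t) @ (dM1 @ d @ y @ w) @ (dM0 @ d @ y @ w)
         • dualMulA @ (f0 @ x) @ (f1 @ x) @ (f0 @ y) @ (f1 @ y) @ (f0 @ w) @ (f1 @ w)
         • cong2 @ (fn s t, s ⊗ (f1 @ w) ⊕ t ⊗ (f0 @ w)) @ (inv @ (dM0 @ d @ x @ y)) @ (inv @ (dM1 @ d @ x @ y))
         • inv @ (dM1 @ d @ (m @ x @ y) @ w)))).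
Instance dualMul1l : Lib := ltac:(lemma 8
  (forDual (fun A z u a m f0 f1 g d => Π x : A, m @ u @ x == x))
  (fn A z u a m f0 f1 g d x,
    dEq @ d @ (m @ u @ x) @ x
      @ (dM0 @ d @ u @ x • cong @ (fn t, t ⊗ (f0 @ x)) @ (dU0 @ d))
      @ (dM1 @ d @ u @ x • cong2 @ (fn s t, s ⊗ (f1 @ x) ⊕ t ⊗ (f0 @ x)) @ (dU0 @ d) @ (dU1 @ d)))).
Instance dualMul1r : Lib := ltac:(lemma 8
  (forDual (fun A z u a m f0 f1 g d => Π x : A, m @ x @ u == x))
  (fn A z u a m f0 f1 g d x,
    dEq @ d @ (m @ x @ u) @ x
      @ (dM0 @ d @ x @ u • cong @ (zmul @ (f0 @ x)) @ (dU0 @ d) • mul1r @ (f0 @ x))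
      @ (dM1 @ d @ x @ u • cong2 @ (fn s t, (f0 @ x) ⊗ t ⊕ (f1 @ x) ⊗ s) @ (dU0 @ d) @ (dU1 @ d)
         • cong2 @ zadd @ (mul0r @ (f0 @ x)) @ (mul1r @ (f1 @ x)) • add0l @ (f1 @ x)))).
Instance dualMulDr : Lib := ltac:(lemma 8
  (forDual (fun A z u a m f0 f1 g d => Π x : A, Π y : A, Π w : A,
     m @ x @ (a @ y @ w) == a @ (m @ x @ y) @ (m @ x @ w)))
  (fn A z u a m f0 f1 g d x y w,
    dEq @ d @ (m @ x @ (a @ y @ w)) @ (a @ (m @ x @ y) @ (m @ x @ w))
      @ (dM0 @ d @ x @ (a @ y @ w) • cong @ (zmul @ (f0 @ x)) @ (dA0 @ d @ y @ w)
         • mulDr @ (f0 @ x) @ (f0 @ y) @ (f0 @ w)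
         • cong2 @ zadd @ (inv @ (dM0 @ d @ x @ y)) @ (inv @ (dM0 @ d @ x @ w))
         • inv @ (dA0 @ d @ (m @ x @ y) @ (m @ x @ w)))
      @ (dM1 @ d @ x @ (a @ y @ w)
         • cong2 @ (fn s t, (f0 @ x) ⊗ s ⊕ (f1 @ x) ⊗ t) @ (dA1 @ d @ y @ w) @ (dA0 @ d @ y @ w)
         • cong2 @ zadd @ (mulDr @ (f0 @ x) @ (f1 @ y) @ (f1 @ w)) @ (mulDr @ (f1 @ x) @ (f0 @ y) @ (f0 @ w))
         • medial @ zadd @ addA @ addC @ ((f0 @ x) ⊗ (f1 @ y)) @ ((f0 @ x) ⊗ (f1 @ w))
             @ ((f1 @ x) ⊗ (f0 @ y)) @ ((f1 @ x) ⊗ (f0 @ w))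
         • cong2 @ zadd @ (inv @ (dM1 @ d @ x @ y)) @ (inv @ (dM1 @ d @ x @ w))
         • inv @ (dA1 @ d @ (m @ x @ y) @ (m @ x @ w))))).
Instance dualMulDl : Lib := ltac:(lemma 8
  (forDual (fun A z u a m f0 f1 g d => Π x : A, Π y : A, Π w : A,
     m @ (a @ x @ y) @ w == a @ (m @ x @ w) @ (m @ y @ w)))
  (fn A z u a m f0 f1 g d x y w,
    dEq @ d @ (m @ (a @ x @ y) @ w) @ (a @ (m @ x @ w) @ (m @ y @ w))
      @ (dM0 @ d @ (a @ x @ y) @ w • cong @ (fn t, t ⊗ (f0 @ w)) @ (dA0 @ d @ x @ y)
         • mulDl @ (f0 @ x) @ (f0 @ y) @ (f0 @ w)
         • cong2 @ zadd @ (inv @ (dM0 @ d @ x @ w)) @ (inv @ (dM0 @ d @ y @ w))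
         • inv @ (dA0 @ d @ (m @ x @ w) @ (m @ y @ w)))
      @ (dM1 @ d @ (a @ x @ y) @ w
         • cong2 @ (fn s t, s ⊗ (f1 @ w) ⊕ t ⊗ (f0 @ w)) @ (dA0 @ d @ x @ y) @ (dA1 @ d @ x @ y)
         • cong2 @ zadd @ (mulDl @ (f0 @ x) @ (f0 @ y) @ (f1 @ w)) @ (mulDl @ (f1 @ x) @ (f1 @ y) @ (f0 @ w))
         • medial @ zadd @ addA @ addC @ ((f0 @ x) ⊗ (f1 @ w)) @ ((f0 @ y) ⊗ (f1 @ w))
             @ ((f1 @ x) ⊗ (f0 @ w)) @ ((f1 @ y) ⊗ (f0 @ w))
         • cong2 @ zadd @ (inv @ (dM1 @ d @ x @ w)) @ (inv @ (dM1 @ d @ y @ w))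
         • inv @ (dA1 @ d @ (m @ x @ w) @ (m @ y @ w))))).
Instance dualRing : Lib := ltac:(lemma 8
  (forDual (fun A z u a m f0 f1 g d => isSet A ⇒ IsRing @ A @ z @ u @ a @ m))
  (fn A z u a m f0 f1 g d h,
    ⟨h,
    ⟨fn x y w, dEq @ d @ (a @ x @ (a @ y @ w)) @ (a @ (a @ x @ y) @ w)
                @ (homA @ (dA0 @ d) @ x @ y @ w) @ (homA @ (dA1 @ d) @ x @ y @ w),
    ⟨fn x y, dEq @ d @ (a @ x @ y) @ (a @ y @ x) @ (homC @ (dA0 @ d) @ x @ y) @ (homC @ (dA1 @ d) @ x @ y),
    ⟨fn x, dEq @ d @ (a @ x @ z) @ x @ (hom0 @ (dA0 @ d) @ z @ (dZ0 @ d) @ x) @ (hom0 @ (dA1 @ d) @ z @ (dZ1 @ d) @ x),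
    ⟨fn x, ⟨g @ (zopp @ (f0 @ x)) @ (zopp @ (f1 @ x)),
       dEq @ d @ (a @ x @ (g @ (zopp @ (f0 @ x)) @ (zopp @ (f1 @ x)))) @ z
        @ (dA0 @ d @ x @ (g @ (zopp @ (f0 @ x)) @ (zopp @ (f1 @ x)))
           • cong @ (zadd @ (f0 @ x)) @ (dFG0 @ d @ (zopp @ (f0 @ x)) @ (zopp @ (f1 @ x)))
           • addN @ (f0 @ x) • inv @ (dZ0 @ d))
        @ (dA1 @ d @ x @ (g @ (zopp @ (f0 @ x)) @ (zopp @ (f1 @ x)))
           • cong @ (zadd @ (f1 @ x)) @ (dFG1 @ d @ (zopp @ (f0 @ x)) @ (zopp @ (f1 @ x)))
           • addN @ (f1 @ x) • inv @ (dZ1 @ d))⟩,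
    ⟨dualMulA1 @ d, ⟨dualMul1l @ d, ⟨dualMul1r @ d, ⟨dualMulDr @ d, dualMulDl @ d⟩⟩⟩⟩⟩⟩⟩⟩⟩)).

(** The isomorphism preserves both components. *)
Instance dualIso : Lib := ltac:(lemma 8
  (forDual (fun A z u a m f0 f1 g d => forDual (fun B z' u' a' m' k0 k1 k d' =>
    isSet B ⇒ ringIso (RawRing A z u a m) (RawRing B z' u' a' m'))))
  (fn A z u a m f0 f1 g d B z' u' a' m' k0 k1 k d' h,
    let f x := k @ (f0 @ x) @ (f1 @ x) in
    let e0 x := dFG0 @ d' @ (f0 @ x) @ (f1 @ x) in
    let e1 x := dFG1 @ d' @ (f0 @ x) @ (f1 @ x) in
    ⟨λ x : A, f x,
    ⟨qinv @ h @ (λ y : B, g @ (k0 @ y) @ (k1 @ y))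
       @ (fn y, cong2 @ k @ (dFG0 @ d @ (k0 @ y) @ (k1 @ y)) @ (dFG1 @ d @ (k0 @ y) @ (k1 @ y)) • dGF @ d' @ y)
       @ (fn x, cong2 @ g @ e0 x @ e1 x • dGF @ d @ x),
    ⟨dEq @ d' @ f u @ u' @ (e0 u • dU0 @ d • inv @ (dU0 @ d')) @ (e1 u • dU1 @ d • inv @ (dU1 @ d')),
    ⟨fn x y, dEq @ d' @ f (a @ x @ y) @ (a' @ f x @ f y)
        @ (e0 (a @ x @ y) • dA0 @ d @ x @ y
           • cong2 @ zadd @ (inv @ e0 x) @ (inv @ e0 y) • inv @ (dA0 @ d' @ f x @ f y))
        @ (e1 (a @ x @ y) • dA1 @ d @ x @ y
           • cong2 @ zadd @ (inv @ e1 x) @ (inv @ e1 y) • inv @ (dA1 @ d' @ f x @ f y)),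
     fn x y, dEq @ d' @ f (m @ x @ y) @ (m' @ f x @ f y)
        @ (e0 (m @ x @ y) • dM0 @ d @ x @ y
           • cong2 @ zmul @ (inv @ e0 x) @ (inv @ e0 y) • inv @ (dM0 @ d' @ f x @ f y))
        @ (e1 (m @ x @ y) • dM1 @ d @ x @ y
           • cong2 @ zadd @ (cong2 @ zmul @ (inv @ e0 x) @ (inv @ e1 y)) @ (cong2 @ zmul @ (inv @ e1 x) @ (inv @ e0 y))
           • inv @ (dM1 @ d' @ f x @ f y))⟩⟩⟩⟩)).

(** * Homogeneous components of degree 0 and 1 *)

(** The component of degree 0 of a homogeneous element, read as an integer through e. *)
Instance comp0 : Lib := ltac:(lemma 0
  (Π G : cNat ⇒ U 0, (G @ cO ⇒ Zcar) ⇒ Π n : cNat, G @ n ⇒ Zcar)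
  (fn G e, cNatInd @ (λ n : cNat, G @ n ⇒ Zcar) @ e @ (fn _ _ _, z0))).

(** The degree is shifted down by one, so that [comp1] in degree n + 1 is [comp0] in degree n
    by computation. *)
Instance comp1 : Lib := ltac:(lemma 0
  (Π G : cNat ⇒ U 0, (G @ (cS @ cO) ⇒ Zcar) ⇒ Π n : cNat, G @ n ⇒ Zcar)
  (fn G e, cNatInd @ (λ n : cNat, G @ n ⇒ Zcar) @ (fn _, z0)
     @ (fn n _, comp0 @ (λ n : cNat, G @ (cS @ n)) @ e @ n))).
Instance comp0Zero : Lib := ltac:(lemma 0
  (Π G : cNat ⇒ U 0, Π z : (Π n : cNat, G @ n), Π e : G @ cO ⇒ Zcar, e @ (z @ cO) == z0 ⇒
    Π n : cNat, comp0 @ G @ e @ n @ (z @ n) == z0)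
  (fn G z e h, cNatInd @ (λ n : cNat, comp0 @ G @ e @ n @ (z @ n) == z0) @ h @ (fn n _, rfl))).
Instance comp0Add : Lib := ltac:(lemma 0
  (Π G : cNat ⇒ U 0, Π a : (Π n : cNat, G @ n ⇒ G @ n ⇒ G @ n), Π e : G @ cO ⇒ Zcar,
    (Π x : G @ cO, Π y : G @ cO, e @ (a @ cO @ x @ y) == e @ x ⊕ e @ y) ⇒
    Π n : cNat, Π x : G @ n, Π y : G @ n,
      (comp0 @ G @ e @ n @ x) ⊕ (comp0 @ G @ e @ n @ y) == comp0 @ G @ e @ n @ (a @ n @ x @ y))
  (fn G a e h, cNatInd @ (λ n : cNat, Π x : G @ n, Π y : G @ n,
      (comp0 @ G @ e @ n @ x) ⊕ (comp0 @ G @ e @ n @ y) == comp0 @ G @ e @ n @ (a @ n @ x @ y))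
     @ (fn x y, inv @ (h @ x @ y)) @ (fn n _ x y, rfl))).
Instance comp1Zero : Lib := ltac:(lemma 0
  (Π G : cNat ⇒ U 0, Π z : (Π n : cNat, G @ n), Π e : G @ (cS @ cO) ⇒ Zcar, e @ (z @ (cS @ cO)) == z0 ⇒
    Π n : cNat, comp1 @ G @ e @ n @ (z @ n) == z0)
  (fn G z e h, cNatInd @ (λ n : cNat, comp1 @ G @ e @ n @ (z @ n) == z0) @ rfl
     @ (fn n _, comp0Zero @ (λ n : cNat, G @ (cS @ n)) @ (fn n, z @ (cS @ n)) @ e @ h @ n))).
Instance comp1Add : Lib := ltac:(lemma 0
  (Π G : cNat ⇒ U 0, Π a : (Π n : cNat, G @ n ⇒ G @ n ⇒ G @ n), Π e : G @ (cS @ cO) ⇒ Zcar,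
    (Π x : G @ (cS @ cO), Π y : G @ (cS @ cO), e @ (a @ (cS @ cO) @ x @ y) == e @ x ⊕ e @ y) ⇒
    Π n : cNat, Π x : G @ n, Π y : G @ n,
      (comp1 @ G @ e @ n @ x) ⊕ (comp1 @ G @ e @ n @ y) == comp1 @ G @ e @ n @ (a @ n @ x @ y))
  (fn G a e h, cNatInd @ (λ n : cNat, Π x : G @ n, Π y : G @ n,
      (comp1 @ G @ e @ n @ x) ⊕ (comp1 @ G @ e @ n @ y) == comp1 @ G @ e @ n @ (a @ n @ x @ y))
     @ (fn x y, rfl)
     @ (fn n _, comp0Add @ (λ n : cNat, G @ (cS @ n)) @ (fn n, a @ (cS @ n)) @ e @ h @ n))).
Instance coef0 : Lib := ltac:(lemma 3
  (forDS (fun G z a D zero base plus => isSet Zcar ⇒ Π e : G @ cO ⇒ Zcar, e @ (z @ cO) == z0 ⇒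
    (Π x : G @ cO, Π y : G @ cO, e @ (a @ cO @ x @ y) == e @ x ⊕ e @ y) ⇒ D ⇒ Zcar))
  (fn G z a hZ e ez ea, dsRec @ hZ @ z0 @ (comp0 @ G @ e) @ zadd @ addA @ addC @ (fn x, rfl)
     @ (comp0Zero @ G @ z @ e @ ez) @ (comp0Add @ G @ a @ e @ ea))).
Instance coef1 : Lib := ltac:(lemma 3
  (forDS (fun G z a D zero base plus => isSet Zcar ⇒ Π e : G @ (cS @ cO) ⇒ Zcar, e @ (z @ (cS @ cO)) == z0 ⇒
    (Π x : G @ (cS @ cO), Π y : G @ (cS @ cO), e @ (a @ (cS @ cO) @ x @ y) == e @ x ⊕ e @ y) ⇒ D ⇒ Zcar))
  (fn G z a hZ e ez ea, dsRec @ hZ @ z0 @ (comp1 @ G @ e) @ zadd @ addA @ addC @ (fn x, rfl)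
     @ (comp1Zero @ G @ z @ e @ ez) @ (comp1Add @ G @ a @ e @ ea))).

(** The map from the product of G₀ and G₁ to the direct sum. *)
Instance lowSum : Lib := ltac:(lemma 3
  (forDS (fun G z a D zero base plus => G @ cO ⇒ G @ (cS @ cO) ⇒ D))
  (fn G z a x y, cDSAdd @ G @ z @ a @ (cDSBase @ G @ z @ a @ cO @ x) @ (cDSBase @ G @ z @ a @ (cS @ cO) @ y))).
Instance lowSumAdd : Lib := ltac:(lemma 0
  (forDS (fun G z a D zero base plus => Π x : G @ cO, Π x' : G @ cO, Π y : G @ (cS @ cO), Π y' : G @ (cS @ cO),
    plus (expl lowSum @ G @ z @ a @ x @ y) (expl lowSum @ G @ z @ a @ x' @ y') ==
    expl lowSum @ G @ z @ a @ (a @ cO @ x @ x') @ (a @ (cS @ cO) @ y @ y')))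
  (fn G z a x x' y y',
     medial @ (cDSAdd @ G @ z @ a) @ (cDSAssoc @ G @ z @ a) @ (cDSComm @ G @ z @ a)
       @ (cDSBase @ G @ z @ a @ cO @ x) @ (cDSBase @ G @ z @ a @ (cS @ cO) @ y)
       @ (cDSBase @ G @ z @ a @ cO @ x') @ (cDSBase @ G @ z @ a @ (cS @ cO) @ y')
     • cong2 @ (cDSAdd @ G @ z @ a) @ (cDSBaseAdd @ G @ z @ a @ cO @ x @ x')
         @ (cDSBaseAdd @ G @ z @ a @ (cS @ cO) @ y @ y'))).
Instance lowSumL : Lib := ltac:(lemma 0
  (forDS (fun G z a D zero base plus => Π x : G @ cO,
    expl lowSum @ G @ z @ a @ x @ (z @ (cS @ cO)) == base cO x))
  (fn G z a x, cong @ (cDSAdd @ G @ z @ a @ (cDSBase @ G @ z @ a @ cO @ x)) @ (cDSBaseZero @ G @ z @ a @ (cS @ cO))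
     • cDSUnit @ G @ z @ a @ (cDSBase @ G @ z @ a @ cO @ x))).
Instance lowSumR : Lib := ltac:(lemma 0
  (forDS (fun G z a D zero base plus => Π y : G @ (cS @ cO),
    expl lowSum @ G @ z @ a @ (z @ cO) @ y == base (cS @ cO) y))
  (fn G z a y, cong @ (fn t, cDSAdd @ G @ z @ a @ t @ (cDSBase @ G @ z @ a @ (cS @ cO) @ y)) @ (cDSBaseZero @ G @ z @ a @ cO)
     • cDSComm @ G @ z @ a @ (cDSZero @ G @ z @ a) @ (cDSBase @ G @ z @ a @ (cS @ cO) @ y)
     • cDSUnit @ G @ z @ a @ (cDSBase @ G @ z @ a @ (cS @ cO) @ y))).
Instance lowSum00 : Lib := ltac:(lemma 0
  (forDS (fun G z a D zero base plus => expl lowSum @ G @ z @ a @ (z @ cO) @ (z @ (cS @ cO)) == zero))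
  (fn G z a, lowSumL @ G @ z @ a @ (z @ cO) • cDSBaseZero @ G @ z @ a @ cO)).

(** * Integral polynomials modulo the square of the variable *)

Definition zpCar : hterm := polyCar Zcar z0 zadd.
Definition zpZero : hterm := polyZero Zcar z0 zadd.
Definition zpBase (n x : hterm) : hterm := polyBase Zcar z0 zadd n x.
Definition zpAdd : hterm := polyAdd Zcar z0 zadd.
Definition zpMul (hZ : hterm) : hterm := polyMul @ (zRing @ hZ).
Definition zpLowSum (x y : hterm) : hterm := expl lowSum @ constFam Zcar @ constEl z0 @ constEl zadd @ x @ y.

(** A coefficient in degree 0 or 1 is its own component. *)
Definition idZ : hterm := λ x : Zcar, x.
Definition zComp0 (n x : hterm) : hterm := comp0 @ constFam Zcar @ idZ @ n @ x.
Definition zComp1 (n x : hterm) : hterm := comp1 @ constFam Zcar @ idZ @ n @ x.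
Instance polyCoef0 : Lib := ltac:(lemma 0
  (isSet Zcar ⇒ zpCar ⇒ Zcar)
  (fn hZ, expl coef0 @ constFam Zcar @ constEl z0 @ constEl zadd @ hZ @ idZ @ rfl @ (fn x y, rfl))).
Instance polyCoef1 : Lib := ltac:(lemma 0
  (isSet Zcar ⇒ zpCar ⇒ Zcar)
  (fn hZ, expl coef1 @ constFam Zcar @ constEl z0 @ constEl zadd @ hZ @ idZ @ rfl @ (fn x y, rfl))).

(** A product of monomials has degree 0 exactly when both have degree 0. *)
Instance zComp0Mul : Lib := ltac:(lemma 0
  (Π n : cNat, Π k : cNat, Π x : Zcar, Π y : Zcar, zComp0 (plus n k) (x ⊗ y) == zComp0 n x ⊗ zComp0 k y)
  (fn n k x y, natCases (λ n : cNat, zComp0 (plus n k) (x ⊗ y) == zComp0 n x ⊗ zComp0 k y)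
     (natCases (λ k : cNat, zComp0 k (x ⊗ y) == x ⊗ zComp0 k y) rfl (fun _ => inv @ (mul0r @ x)) @ k)
     (fun _ => rfl) @ n)).

(** A product of monomials has degree 1 exactly when one factor has degree 0 and the
    other has degree 1. *)
Instance zComp1Mul : Lib := ltac:(lemma 0
  (Π n : cNat, Π k : cNat, Π x : Zcar, Π y : Zcar,
    zComp1 (plus n k) (x ⊗ y) == zComp0 n x ⊗ zComp1 k y ⊕ zComp1 n x ⊗ zComp0 k y)
  (fn n k x y, natCases (λ n : cNat, zComp1 (plus n k) (x ⊗ y) == zComp0 n x ⊗ zComp1 k y ⊕ zComp1 n x ⊗ zComp0 k y)
     (natCases (λ k : cNat, zComp1 k (x ⊗ y) == x ⊗ zComp1 k y ⊕ z0 ⊗ zComp0 k y) (inv @ (mul0r @ x))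
        (fun k => natCases (λ k : cNat, zComp0 k (x ⊗ y) == x ⊗ zComp0 k y ⊕ z0) rfl (fun _ => inv @ (mul0r @ x)) @ k) @ k)
     (fun n => natCases (λ n : cNat, zComp1 (cS @ plus n k) (x ⊗ y) == z0 ⊕ zComp0 n x ⊗ zComp0 k y)
        (natCases (λ k : cNat, zComp0 k (x ⊗ y) == z0 ⊕ x ⊗ zComp0 k y) (inv @ (add0l @ (x ⊗ y)))
           (fun _ => inv @ (add0l @ (x ⊗ z0) • mul0r @ x)) @ k)
        (fun _ => rfl) @ n) @ n)).
Instance polyCoef0Mul : Lib := ltac:(lemma 0
  (Π hZ : isSet Zcar, Π x : zpCar, Π y : zpCar, polyCoef0 @ hZ @ (zpMul hZ @ x @ y) == (polyCoef0 @ hZ @ x) ⊗ (polyCoef0 @ hZ @ y))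
  (fn hZ x y, let p x := polyCoef0 @ hZ @ x in
    dsIndProp @ (λ x : zpCar, p (zpMul hZ @ x @ y) == p x ⊗ p y) @ (fn x, hZ @ hole @ hole) @ rfl
     @ (fn n c, dsIndProp @ (λ y : zpCar, p (zpMul hZ @ zpBase n c @ y) == zComp0 n c ⊗ p y) @ (fn x, hZ @ hole @ hole)
          @ (inv @ (mul0r @ zComp0 n c)) @ (fn k d, zComp0Mul @ n @ k @ c @ d)
          @ (fn y y' r s, cong2 @ zadd @ r @ s • inv @ (mulDr @ zComp0 n c @ p y @ p y')) @ y)
     @ (fn x x' r s, cong2 @ zadd @ r @ s • inv @ (mulDl @ p x @ p x' @ p y)) @ x)).
Instance polyCoef1Mul : Lib := ltac:(lemma 0
  (Π hZ : isSet Zcar, Π x : zpCar, Π y : zpCar, polyCoef1 @ hZ @ (zpMul hZ @ x @ y) ==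
     (polyCoef0 @ hZ @ x) ⊗ (polyCoef1 @ hZ @ y) ⊕ (polyCoef1 @ hZ @ x) ⊗ (polyCoef0 @ hZ @ y))
  (fn hZ x y, let p x := polyCoef0 @ hZ @ x in let q x := polyCoef1 @ hZ @ x in
    dsIndProp @ (λ x : zpCar, q (zpMul hZ @ x @ y) == p x ⊗ q y ⊕ q x ⊗ p y) @ (fn x, hZ @ hole @ hole) @ rfl
     @ (fn n c, dsIndProp @ (λ y : zpCar, q (zpMul hZ @ zpBase n c @ y) == zComp0 n c ⊗ q y ⊕ zComp1 n c ⊗ p y)
          @ (fn x, hZ @ hole @ hole)
          @ (inv @ (cong2 @ zadd @ (mul0r @ zComp0 n c) @ (mul0r @ zComp1 n c))) @ (fn k d, zComp1Mul @ n @ k @ c @ d)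
          @ (fn y y' r s, cong2 @ zadd @ r @ s
               • medial @ zadd @ addA @ addC @ (zComp0 n c ⊗ q y) @ (zComp1 n c ⊗ p y) @ (zComp0 n c ⊗ q y') @ (zComp1 n c ⊗ p y')
               • cong2 @ zadd @ (inv @ (mulDr @ zComp0 n c @ q y @ q y')) @ (inv @ (mulDr @ zComp1 n c @ p y @ p y'))) @ y)
     @ (fn x x' r s, cong2 @ zadd @ r @ s
          • medial @ zadd @ addA @ addC @ (p x ⊗ q y) @ (q x ⊗ p y) @ (p x' ⊗ q y) @ (q x' ⊗ p y)
          • cong2 @ zadd @ (inv @ (mulDl @ p x @ p x' @ q y)) @ (inv @ (mulDl @ q x @ q x' @ p y))) @ x)).

Definition zpRing (hZ : hterm) : rawRing := RawRing zpCar zpZero (zpBase cO z1) zpAdd (zpMul hZ).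
Definition XX (hZ : hterm) : hterm := zpMul hZ @ zpBase (cS @ cO) z1 @ zpBase (cS @ cO) z1.
Definition modXX (hZ x y : hterm) : hterm := Σ q : zpCar, x == zpAdd @ y @ (zpMul hZ @ q @ XX hZ).

(** X² has no coefficients in degrees 0 and 1, so that they are well defined modulo X². *)
Instance polyCoef0Ideal : Lib := ltac:(lemma 0
  (Π hZ : isSet Zcar, Π y : zpCar, Π q : zpCar, polyCoef0 @ hZ @ (zpAdd @ y @ (zpMul hZ @ q @ XX hZ)) == polyCoef0 @ hZ @ y)
  (fn hZ y q, cong @ (zadd @ (polyCoef0 @ hZ @ y)) @ (polyCoef0Mul @ hZ @ q @ XX hZ • mul0r @ (polyCoef0 @ hZ @ q)))).
Instance polyCoef1Ideal : Lib := ltac:(lemma 0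
  (Π hZ : isSet Zcar, Π y : zpCar, Π q : zpCar, polyCoef1 @ hZ @ (zpAdd @ y @ (zpMul hZ @ q @ XX hZ)) == polyCoef1 @ hZ @ y)
  (fn hZ y q, cong @ (zadd @ (polyCoef1 @ hZ @ y)) @ (polyCoef1Mul @ hZ @ q @ XX hZ
     • cong2 @ zadd @ (mul0r @ (polyCoef0 @ hZ @ q)) @ (mul0r @ (polyCoef1 @ hZ @ q))))).
Instance plusTwo : Lib := ltac:(lemma 0
  (Π n : cNat, plus n (cS @ (cS @ cO)) == cS @ (cS @ n))
  (cNatInd @ (λ n : cNat, plus n (cS @ (cS @ cO)) == cS @ (cS @ n)) @ rfl @ (fn n r, cong @ cS @ r))).

(** A monomial of degree n + 2 is a multiple of X², so that every polynomial is congruent to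
    its part of degree at most 1.  The congruence is merely known, and the
    proof goes by induction into a proposition. *)
Instance modXXLowSum : Lib := ltac:(lemma 0
  (Π hZ : isSet Zcar, Π x : zpCar, cTr @ cO @ modXX hZ x (zpLowSum (polyCoef0 @ hZ @ x) (polyCoef1 @ hZ @ x)))
  (fn hZ, let p x := polyCoef0 @ hZ @ x in let q x := polyCoef1 @ hZ @ x in
     let M x := modXX hZ x (zpLowSum (p x) (q x)) in
     let triv x := fun e => cTrIn @ cO @ M x @ ⟨zpZero, inv @ (polyAdd0 Zcar z0 zadd @ zpLowSum (p x) (q x) • e)⟩ in
    dsIndProp @ (λ x : zpCar, cTr @ cO @ M x) @ (fn x, truncProp)
     @ triv zpZero (lowSum00 @ constFam Zcar @ constEl z0 @ constEl zadd)
     @ (natCases (λ n : cNat, Π c : Zcar, cTr @ cO @ M (zpBase n c))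
          (fn c, triv (zpBase cO c) (lowSumL @ constFam Zcar @ constEl z0 @ constEl zadd @ c))
          (fun n => natCases (λ n : cNat, Π c : Zcar, cTr @ cO @ M (zpBase (cS @ n) c))
              (fn c, triv (zpBase (cS @ cO) c) (lowSumR @ constFam Zcar @ constEl z0 @ constEl zadd @ c))
              (* c Xⁿ⁺² = (c Xⁿ) X² *)
              (fun n => fn c, cTrIn @ cO @ M (zpBase (cS @ (cS @ n)) c) @ ⟨zpBase n c,
                 inv @ (cong2 @ zpAdd @ (lowSum00 @ constFam Zcar @ constEl z0 @ constEl zadd)
                          @ (cong2 @ (λ n : cNat, λ c : Zcar, zpBase n c) @ (plusTwo @ n) @ (mul1r @ c))
                        • polyAddC Zcar z0 zadd @ zpZero @ zpBase (cS @ (cS @ n)) c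
                        • polyAdd0 Zcar z0 zadd @ zpBase (cS @ (cS @ n)) c)⟩) @ n))
     @ (fn x y, truncRec @ (propPi @ (fn _, truncProp)) @ (λ r : M x, truncRec @ truncProp @ (λ s : M y,
          cTrIn @ cO @ M (zpAdd @ x @ y) @ ⟨zpAdd @ (pr1 @ r) @ (pr1 @ s),
            cong2 @ zpAdd @ (pr2 @ r) @ (pr2 @ s)
            • medial @ zpAdd @ polyAddA Zcar z0 zadd @ polyAddC Zcar z0 zadd @ zpLowSum (p x) (q x) @ (zpMul hZ @ (pr1 @ r) @ XX hZ)
                @ zpLowSum (p y) (q y) @ (zpMul hZ @ (pr1 @ s) @ XX hZ)
            • cong @ (fn t, zpAdd @ t @ (zpMul hZ @ (zpAdd @ (pr1 @ r) @ (pr1 @ s)) @ XX hZ))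
                @ (lowSumAdd @ constFam Zcar @ constEl z0 @ constEl zadd @ p x @ p y @ q x @ q y)⟩))))).

Definition zpQuot (hZ : hterm) : hterm := quotCar (zpRing hZ) (XX hZ).
Definition zpRel (hZ : hterm) : hterm := idealRel (zpRing hZ) (XX hZ).
Definition qin (hZ x : hterm) : hterm := quotIn (zpRing hZ) (XX hZ) x.
Instance quotIndProp : Lib := ltac:(lemma 3
  (Π A : U 0, Π R : A ⇒ A ⇒ U 0, Π P : cQuot @ A @ R ⇒ U 0, (Π q : cQuot @ A @ R, isProp (P @ q)) ⇒
    (Π x : A, P @ (cQuotIn @ A @ R @ x)) ⇒ Π q : cQuot @ A @ R, P @ q)
  (fn A R P h f, cQuotInd @ A @ R @ P @ (fn q, propSet @ (h @ q)) @ f @ (fn x y r, h @ hole @ hole @ hole))).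
Instance quotCoef0 : Lib := ltac:(lemma 0
  (Π hZ : isSet Zcar, zpQuot hZ ⇒ Zcar)
  (fn hZ, cQuotInd @ zpCar @ zpRel hZ @ (λ _ : zpQuot hZ, Zcar) @ (fn _, hZ) @ (polyCoef0 @ hZ)
     @ (fn x y r, transportConst @ hole @ hole •
          truncRec @ (hZ @ (polyCoef0 @ hZ @ x) @ (polyCoef0 @ hZ @ y))
            @ (λ s : modXX hZ x y, cong @ (polyCoef0 @ hZ) @ (pr2 @ s) • polyCoef0Ideal @ hZ @ y @ (pr1 @ s)) @ r))).
Instance quotCoef1 : Lib := ltac:(lemma 0
  (Π hZ : isSet Zcar, zpQuot hZ ⇒ Zcar)
  (fn hZ, cQuotInd @ zpCar @ zpRel hZ @ (λ _ : zpQuot hZ, Zcar) @ (fn _, hZ) @ (polyCoef1 @ hZ)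
     @ (fn x y r, transportConst @ hole @ hole •
          truncRec @ (hZ @ (polyCoef1 @ hZ @ x) @ (polyCoef1 @ hZ @ y))
            @ (λ s : modXX hZ x y, cong @ (polyCoef1 @ hZ) @ (pr2 @ s) • polyCoef1Ideal @ hZ @ y @ (pr1 @ s)) @ r))).
Instance quotLowSum : Lib := ltac:(lemma 0
  (Π hZ : isSet Zcar, Zcar ⇒ Zcar ⇒ zpQuot hZ)
  (fn hZ x y, qin hZ (zpLowSum x y))).
Instance quotRetract : Lib := ltac:(lemma 0
  (Π hZ : isSet Zcar, Π x : zpQuot hZ, quotLowSum @ hZ @ (quotCoef0 @ hZ @ x) @ (quotCoef1 @ hZ @ x) == x)
  (fn hZ, quotIndProp @ (λ x : zpQuot hZ, cQuotSet @ zpCar @ zpRel hZ @ hole @ hole)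
     @ (fn x, inv @ (cQuotEq @ zpCar @ zpRel hZ @ x @ zpLowSum (polyCoef0 @ hZ @ x) (polyCoef1 @ hZ @ x) @ (modXXLowSum @ hZ @ x))))).

(** The operations of the quotient are those of the pairs of coefficients; that they are
    induced by those of polynomials follows afterwards, as both sides have the same coefficients. *)
Instance quotAdd : Lib := ltac:(lemma 0
  (Π hZ : isSet Zcar, zpQuot hZ ⇒ zpQuot hZ ⇒ zpQuot hZ)
  (fn hZ x y, quotLowSum @ hZ @ (quotCoef0 @ hZ @ x ⊕ quotCoef0 @ hZ @ y) @ (quotCoef1 @ hZ @ x ⊕ quotCoef1 @ hZ @ y))).
Instance quotMul : Lib := ltac:(lemma 0
  (Π hZ : isSet Zcar, zpQuot hZ ⇒ zpQuot hZ ⇒ zpQuot hZ)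
  (fn hZ x y, quotLowSum @ hZ @ ((quotCoef0 @ hZ @ x) ⊗ (quotCoef0 @ hZ @ y))
     @ ((quotCoef0 @ hZ @ x) ⊗ (quotCoef1 @ hZ @ y) ⊕ (quotCoef1 @ hZ @ x) ⊗ (quotCoef0 @ hZ @ y)))).
Instance quotIsDual : Lib := ltac:(lemma 0
  (Π hZ : isSet Zcar, IsDual @ zpQuot hZ @ qin hZ zpZero @ qin hZ (zpBase cO z1) @ (quotAdd @ hZ) @ (quotMul @ hZ)
     @ (quotCoef0 @ hZ) @ (quotCoef1 @ hZ) @ (quotLowSum @ hZ))
  (fn hZ, ⟨quotRetract @ hZ, ⟨fn x y, rfl, ⟨fn x y, add0l @ y, ⟨rfl, ⟨rfl, ⟨rfl, ⟨rfl,
     ⟨fn x y, rfl, ⟨fn x y, add0l @ hole, ⟨fn x y, rfl, fn x y, add0l @ hole⟩⟩⟩⟩⟩⟩⟩⟩⟩⟩)).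

Instance quotIso : Lib := ltac:(lemma 8
  (forDual (fun A z u a m f0 f1 g d => Π hZ : isSet Zcar,
       theQuotientRing (zpRing hZ) (XX hZ) (fun Q => ringIso (RawRing A z u a m) Q)))
  (fn A z u a m f0 f1 g d hZ,
    ⟨quotAdd @ hZ, ⟨quotMul @ hZ, ⟨dualRing @ (quotIsDual @ hZ) @ (cQuotSet @ zpCar @ zpRel hZ),
    ⟨fn x y, quotRetract @ hZ @ qin hZ (zpAdd @ x @ y),
    ⟨fn x y, cong2 @ (quotLowSum @ hZ) @ (inv @ (polyCoef0Mul @ hZ @ x @ y)) @ (inv @ (polyCoef1Mul @ hZ @ x @ y))
        • quotRetract @ hZ @ qin hZ (zpMul hZ @ x @ y),
     dualIso @ d @ hole @ hole @ hole @ hole @ hole @ hole @ hole @ hole @ (quotIsDual @ hZ) @ (cQuotSet @ zpCar @ zpRel hZ)⟩⟩⟩⟩⟩)).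
Instance polyQuotIso : Lib := ltac:(lemma 8
  (forDual (fun A z u a m f0 f1 g d => isSet Zcar ⇒
     thePolynomialRing ZRing (fun B =>
       theQuotientRing B (mul B (polyX ZRing) (polyX ZRing)) (fun Q =>
       ringIso (RawRing A z u a m) Q))))
  (fn A z u a m f0 f1 g d hZ,
    ⟨zpMul hZ, ⟨polyRing @ (zRing @ hZ), ⟨fn n k x y, rfl, quotIso @ d @ hZ⟩⟩⟩)).

(** * Graded groups concentrated in degrees 0 and 1 *)

Definition cOne : hterm := cS @ cO.

(** A graded group G with products m, identifications e0, v0 of degree 0 and e1, v1 of
    degree 1 with ℤ that turn the products into those of integers, and nothing in higher
    degrees (hi). *)
Record grData : Type := Gr {
  gG : hterm; gz : hterm; ga : hterm; gm : hterm; ghZ : hterm;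
  ge0 : hterm; ge0z : hterm; ge0a : hterm; gv0 : hterm; gev0 : hterm; gve0 : hterm;
  ge1 : hterm; ge1z : hterm; ge1a : hterm; gv1 : hterm; gev1 : hterm; gve1 : hterm;
  ghi : hterm; gm00 : hterm; gm01 : hterm; gm10 : hterm
}.
Definition forGr (P : grData -> hterm) : hterm :=
  Π G : cNat ⇒ U 0, Π z : (Π n : cNat, G @ n), Π a : (Π n : cNat, G @ n ⇒ G @ n ⇒ G @ n),
  Π m : (Π n : cNat, Π k : cNat, G @ n ⇒ G @ k ⇒ G @ plus n k), Π hZ : isSet Zcar,
  Π e0 : G @ cO ⇒ Zcar, Π e0z : e0 @ (z @ cO) == z0,
  Π e0a : (Π x : G @ cO, Π y : G @ cO, e0 @ (a @ cO @ x @ y) == e0 @ x ⊕ e0 @ y),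
  Π v0 : Zcar ⇒ G @ cO, Π ev0 : (Π x : Zcar, e0 @ (v0 @ x) == x), Π ve0 : (Π x : G @ cO, v0 @ (e0 @ x) == x),
  Π e1 : G @ cOne ⇒ Zcar, Π e1z : e1 @ (z @ cOne) == z0,
  Π e1a : (Π x : G @ cOne, Π y : G @ cOne, e1 @ (a @ cOne @ x @ y) == e1 @ x ⊕ e1 @ y),
  Π v1 : Zcar ⇒ G @ cOne, Π ev1 : (Π x : Zcar, e1 @ (v1 @ x) == x), Π ve1 : (Π x : G @ cOne, v1 @ (e1 @ x) == x),
  Π hi : (Π n : cNat, Π x : G @ (cS @ (cS @ n)), z @ (cS @ (cS @ n)) == x),
  Π m00 : (Π x : G @ cO, Π y : G @ cO, e0 @ (m @ cO @ cO @ x @ y) == (e0 @ x) ⊗ (e0 @ y)),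
  Π m01 : (Π x : G @ cO, Π y : G @ cOne, e1 @ (m @ cO @ cOne @ x @ y) == (e0 @ x) ⊗ (e1 @ y)),
  Π m10 : (Π x : G @ cOne, Π y : G @ cO, e1 @ (m @ cOne @ cO @ x @ y) == (e1 @ x) ⊗ (e0 @ y)),
  P (Gr G z a m hZ e0 e0z e0a v0 ev0 ve0 e1 e1z e1a v1 ev1 ve1 hi m00 m01 m10).
Definition lamGr (P : grData -> hterm) : hterm :=
  fn G z a m hZ e0 e0z e0a v0 ev0 ve0 e1 e1z e1a v1 ev1 ve1 hi m00 m01 m10,
  P (Gr G z a m hZ e0 e0z e0a v0 ev0 ve0 e1 e1z e1a v1 ev1 ve1 hi m00 m01 m10).
Definition inGr (t : hterm) (g : grData) : hterm :=
  t @ gG g @ gz g @ ga g @ gm g @ ghZ g @ ge0 g @ ge0z g @ ge0a g @ gv0 g @ gev0 g @ gve0 g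
    @ ge1 g @ ge1z g @ ge1a g @ gv1 g @ gev1 g @ gve1 g @ ghi g @ gm00 g @ gm01 g @ gm10 g.
Definition grCoef0 (g : grData) (x : hterm) : hterm :=
  expl coef0 @ gG g @ gz g @ ga g @ ghZ g @ ge0 g @ ge0z g @ ge0a g @ x.
Definition grCoef1 (g : grData) (x : hterm) : hterm :=
  expl coef1 @ gG g @ gz g @ ga g @ ghZ g @ ge1 g @ ge1z g @ ge1a g @ x.
Definition grComp0 (g : grData) (n x : hterm) : hterm := comp0 @ gG g @ ge0 g @ n @ x.
Definition grComp1 (g : grData) (n x : hterm) : hterm := comp1 @ gG g @ ge1 g @ n @ x.
Definition grLowSum (g : grData) (x y : hterm) : hterm :=
  expl lowSum @ gG g @ gz g @ ga g @ (gv0 g @ x) @ (gv1 g @ y).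
Definition grCar (g : grData) : hterm := cDS @ gG g @ gz g @ ga g.
Definition grBase (g : grData) (n x : hterm) : hterm := cDSBase @ gG g @ gz g @ ga g @ n @ x.
Definition grAdd (g : grData) : hterm := cDSAdd @ gG g @ gz g @ ga g.

Instance grV0Zero : Lib := ltac:(lemma 0
  (forGr (fun g => gv0 g @ z0 == gz g @ cO))
  (lamGr (fun g => cong @ gv0 g @ (inv @ ge0z g) • gve0 g @ (gz g @ cO)))).
Instance grV1Zero : Lib := ltac:(lemma 0
  (forGr (fun g => gv1 g @ z0 == gz g @ cOne))
  (lamGr (fun g => cong @ gv1 g @ (inv @ ge1z g) • gve1 g @ (gz g @ cOne)))).
Instance grV0Add : Lib := ltac:(lemma 0
  (forGr (fun g => Π x : Zcar, Π y : Zcar, ga g @ cO @ (gv0 g @ x) @ (gv0 g @ y) == gv0 g @ (x ⊕ y)))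
  (lamGr (fun g => fn x y, inv @ (gve0 g @ (ga g @ cO @ (gv0 g @ x) @ (gv0 g @ y)))
     • cong @ gv0 g @ (ge0a g @ (gv0 g @ x) @ (gv0 g @ y) • cong2 @ zadd @ (gev0 g @ x) @ (gev0 g @ y))))).
Instance grV1Add : Lib := ltac:(lemma 0
  (forGr (fun g => Π x : Zcar, Π y : Zcar, ga g @ cOne @ (gv1 g @ x) @ (gv1 g @ y) == gv1 g @ (x ⊕ y)))
  (lamGr (fun g => fn x y, inv @ (gve1 g @ (ga g @ cOne @ (gv1 g @ x) @ (gv1 g @ y)))
     • cong @ gv1 g @ (ge1a g @ (gv1 g @ x) @ (gv1 g @ y) • cong2 @ zadd @ (gev1 g @ x) @ (gev1 g @ y))))).
Instance grLowSum0 : Lib := ltac:(lemma 0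
  (forGr (fun g => grLowSum g z0 z0 == cDSZero @ gG g @ gz g @ ga g))
  (lamGr (fun g => cong2 @ (expl lowSum @ gG g @ gz g @ ga g) @ inGr grV0Zero g @ inGr grV1Zero g
     • lowSum00 @ gG g @ gz g @ ga g))).

(** An element is the sum of its components of degrees 0 and 1, the others being zero. *)
Instance grRetract : Lib := ltac:(lemma 0
  (forGr (fun g => Π x : grCar g, grLowSum g (grCoef0 g x) (grCoef1 g x) == x))
  (lamGr (fun g => 
    dsIndProp @ (λ x : grCar g, grLowSum g (grCoef0 g x) (grCoef1 g x) == x) @ (fn x, cDSSet @ gG g @ gz g @ ga g @ hole @ hole)
     @ inGr grLowSum0 g
     @ (natCases (λ n : cNat, Π c : gG g @ n, grLowSum g (grComp0 g n c) (grComp1 g n c) == grBase g n c)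
          (fn c, cong2 @ (expl lowSum @ gG g @ gz g @ ga g) @ (gve0 g @ c) @ inGr grV1Zero g
             • lowSumL @ gG g @ gz g @ ga g @ c)
          (fun n => natCases (λ n : cNat, Π c : gG g @ (cS @ n),
                grLowSum g (grComp0 g (cS @ n) c) (grComp1 g (cS @ n) c) == grBase g (cS @ n) c)
              (fn c, cong2 @ (expl lowSum @ gG g @ gz g @ ga g) @ inGr grV0Zero g @ (gve1 g @ c)
                 • lowSumR @ gG g @ gz g @ ga g @ c)
              (fun n => fn c, inGr grLowSum0 g • inv @ (cDSBaseZero @ gG g @ gz g @ ga g @ (cS @ (cS @ n)))
                 • cong @ (cDSBase @ gG g @ gz g @ ga g @ (cS @ (cS @ n))) @ (ghi g @ n @ c)) @ n))
     @ (fn x y r s, cong2 @ (expl lowSum @ gG g @ gz g @ ga g)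
            @ (inv @ (inGr grV0Add g @ grCoef0 g x @ grCoef0 g y)) @ (inv @ (inGr grV1Add g @ grCoef1 g x @ grCoef1 g y))
          • inv @ (lowSumAdd @ gG g @ gz g @ ga g @ (gv0 g @ grCoef0 g x) @ (gv0 g @ grCoef0 g y)
               @ (gv1 g @ grCoef1 g x) @ (gv1 g @ grCoef1 g y))
          • cong2 @ grAdd g @ r @ s)))).
Definition grMulFun (g : grData) : hterm :=
  λ x : grCar g, λ y : grCar g, grLowSum g (grCoef0 g x ⊗ grCoef0 g y) (grCoef0 g x ⊗ grCoef1 g y ⊕ grCoef1 g x ⊗ grCoef0 g y).
Instance grMul : Lib := ltac:(lemma 0 (forGr (fun g => grCar g ⇒ grCar g ⇒ grCar g)) (lamGr grMulFun)).
Definition grIsDual (g : grData) (u : hterm) : hterm :=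
  IsDual @ grCar g @ (cDSZero @ gG g @ gz g @ ga g) @ grBase g cO u @ grAdd g @ inGr grMul g
     @ (λ x : grCar g, grCoef0 g x) @ (λ x : grCar g, grCoef1 g x) @ (λ x : Zcar, λ y : Zcar, grLowSum g x y).
Instance grDual : Lib := ltac:(lemma 0
  (forGr (fun g => Π u : gG g @ cO, ge0 g @ u == z1 ⇒ grIsDual g u))
  (lamGr (fun g => fn u hu, 
    ⟨inGr grRetract g,
     ⟨fn x y, gev0 g @ x, ⟨fn x y, add0l @ (ge1 g @ (gv1 g @ y)) • gev1 g @ y,
     ⟨rfl, ⟨rfl, ⟨hu, ⟨rfl, ⟨fn x y, rfl, ⟨fn x y, rfl,
     ⟨fn x y, gev0 g @ (grCoef0 g x ⊗ grCoef0 g y),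
      fn x y, add0l @ (ge1 g @ (gv1 g @ (grCoef0 g x ⊗ grCoef1 g y ⊕ grCoef1 g x ⊗ grCoef0 g y)))
         • gev1 g @ (grCoef0 g x ⊗ grCoef1 g y ⊕ grCoef1 g x ⊗ grCoef0 g y)⟩⟩⟩⟩⟩⟩⟩⟩⟩⟩))).
Instance grMulComp0 : Lib := ltac:(lemma 0
  (forGr (fun g => Π n : cNat, Π k : cNat, Π x : gG g @ n, Π y : gG g @ k,
     grComp0 g (plus n k) (gm g @ n @ k @ x @ y) == grComp0 g n x ⊗ grComp0 g k y))
  (lamGr (fun g => 
    natCases (λ n : cNat, Π k : cNat, Π x : gG g @ n, Π y : gG g @ k,
       grComp0 g (plus n k) (gm g @ n @ k @ x @ y) == grComp0 g n x ⊗ grComp0 g k y)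
     (natCases (λ k : cNat, Π x : gG g @ cO, Π y : gG g @ k,
          grComp0 g k (gm g @ cO @ k @ x @ y) == ge0 g @ x ⊗ grComp0 g k y)
        (gm00 g) (fun _ => fn x y, inv @ (mul0r @ (ge0 g @ x))))
     (fun _ => fn k x y, rfl)))).

(** In total degree 1 one of the factors has degree 0.  In all other cases both sides vanish. *)
Instance grMulComp1 : Lib := ltac:(lemma 0
  (forGr (fun g => Π n : cNat, Π k : cNat, Π x : gG g @ n, Π y : gG g @ k,
     grComp1 g (plus n k) (gm g @ n @ k @ x @ y) == grComp0 g n x ⊗ grComp1 g k y ⊕ grComp1 g n x ⊗ grComp0 g k y))
  (lamGr (fun g => 
    natCases (λ n : cNat, Π k : cNat, Π x : gG g @ n, Π y : gG g @ k,
       grComp1 g (plus n k) (gm g @ n @ k @ x @ y) == grComp0 g n x ⊗ grComp1 g k y ⊕ grComp1 g n x ⊗ grComp0 g k y)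
     (natCases (λ k : cNat, Π x : gG g @ cO, Π y : gG g @ k,
          grComp1 g k (gm g @ cO @ k @ x @ y) == ge0 g @ x ⊗ grComp1 g k y ⊕ z0 ⊗ grComp0 g k y)
        (fn x y, inv @ (mul0r @ (ge0 g @ x)))
        (fun k => natCases (λ k : cNat, Π x : gG g @ cO, Π y : gG g @ (cS @ k),
             grComp1 g (cS @ k) (gm g @ cO @ (cS @ k) @ x @ y) == ge0 g @ x ⊗ grComp1 g (cS @ k) y ⊕ z0)
           (gm01 g) (fun k => fn x y, inv @ (mul0r @ (ge0 g @ x))) @ k))
     (fun n => natCases (λ n : cNat, Π k : cNat, Π x : gG g @ (cS @ n), Π y : gG g @ k,
          grComp1 g (cS @ plus n k) (gm g @ (cS @ n) @ k @ x @ y) ==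
            z0 ⊕ grComp1 g (cS @ n) x ⊗ grComp0 g k y)
        (natCases (λ k : cNat, Π x : gG g @ cOne, Π y : gG g @ k,
             grComp1 g (cS @ k) (gm g @ cOne @ k @ x @ y) == z0 ⊕ ge1 g @ x ⊗ grComp0 g k y)
           (fn x y, gm10 g @ x @ y • inv @ (add0l @ (ge1 g @ x ⊗ ge0 g @ y)))
           (fun k => fn x y, inv @ (add0l @ (ge1 g @ x ⊗ z0) • mul0r @ (ge1 g @ x))))
        (fun n => fn k x y, rfl) @ n)))).
Instance grMulBase : Lib := ltac:(lemma 0
  (forGr (fun g => Π n : cNat, Π k : cNat, Π x : gG g @ n, Π y : gG g @ k,
     inGr grMul g @ grBase g n x @ grBase g k y == grBase g (plus n k) (gm g @ n @ k @ x @ y)))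
  (lamGr (fun g => fn n k x y,
    cong2 @ (λ x : Zcar, λ y : Zcar, grLowSum g x y) @ (inv @ (inGr grMulComp0 g @ n @ k @ x @ y))
      @ (inv @ (inGr grMulComp1 g @ n @ k @ x @ y))
    • inGr grRetract g @ grBase g (plus n k) (gm g @ n @ k @ x @ y)))).

(** The direct sum ring is a ring of dual numbers, and so is ℤ[X]/(X²). *)
Instance grIso : Lib := ltac:(lemma 0
  (forGr (fun g => Π u : gG g @ cO, ge0 g @ u == z1 ⇒
     theDirectSumRing (mkGraded (gG g) (gz g) (ga g) u (fun n k x y => gm g @ n @ k @ x @ y)) (fun A =>
       thePolynomialRing ZRing (fun B =>
       theQuotientRing B (mul B (polyX ZRing) (polyX ZRing)) (fun Q =>
       ringIso A Q)))))
  (lamGr (fun g => fn u hu,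
    ⟨inGr grMul g, ⟨dualRing @ (inGr grDual g @ u @ hu) @ (cDSSet @ gG g @ gz g @ ga g),
    ⟨inGr grMulBase g, polyQuotIso @ (inGr grDual g @ u @ hu) @ ghZ g⟩⟩⟩))).

(** * Maps from the circle *)

Instance congId : Lib := ltac:(lemma 3
  (Π A : U 1, Π x : A, Π y : A, Π p : x == y, cong @ (λ t : A, t) @ p == p)
  (fn A x y p, Jp (fn y p, cong @ (λ t : A, t) @ p == p) rfl p)).
Instance congConst : Lib := ltac:(lemma 4
  (Π A : U 1, Π B : U 1, Π x : A, Π y : A, Π b : B, Π p : x == y, cong @ (λ t : A, b) @ p == rfl)
  (fn A B x y b p, Jp (fn y p, cong @ (λ t : A, b) @ p == rfl) rfl p)).
Instance congComp : Lib := ltac:(lemma 5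
  (Π A : U 1, Π B : U 1, Π C : U 1, Π x : A, Π y : A, Π f : B ⇒ C, Π g : A ⇒ B, Π p : x == y,
    cong @ (λ t : A, f @ (g @ t)) @ p == cong @ f @ (cong @ g @ p))
  (fn A B C x y f g p, Jp (fn y p, cong @ (λ t : A, f @ (g @ t)) @ p == cong @ f @ (cong @ g @ p)) rfl p)).
Instance congNatural : Lib := ltac:(lemma 4
  (Π A : U 1, Π B : U 1, Π x : A, Π y : A, Π f : A ⇒ B, Π g : A ⇒ B, Π h : (Π t : A, f @ t == g @ t),
    Π p : x == y, cong @ f @ p • h @ y == h @ x • cong @ g @ p)
  (fn A B x y f g h p, Jp (fn y p, cong @ f @ p • h @ y == h @ x • cong @ g @ p) (catL @ (h @ x)) p)).

(** Interchange: the action of a binary function on two paths decomposes into its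
    actions on each of them. *)
Instance congBinary : Lib := ltac:(lemma 5
  (Π D : U 1, Π A : U 1, Π B : U 1, Π c : D, Π d : D, Π f : A ⇒ A ⇒ B, Π u : D ⇒ A, Π v : D ⇒ A, Π e : c == d,
    cong @ (λ t : D, f @ (u @ t) @ (v @ t)) @ e ==
    cong @ (λ x : A, f @ x @ (v @ c)) @ (cong @ u @ e) • cong @ (f @ (u @ d)) @ (cong @ v @ e))
  (fn D A B c d f u v e, Jp (fn d e, cong @ (λ t : D, f @ (u @ t) @ (v @ t)) @ e ==
      cong @ (λ x : A, f @ x @ (v @ c)) @ (cong @ u @ e) • cong @ (f @ (u @ d)) @ (cong @ v @ e)) rfl e)).

(** Transport in a family of identity types is a commuting square. *)
Instance transportEq : Lib := ltac:(lemma 4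
  (Π A : U 0, Π B : U 0, Π x : A, Π y : A, Π f : A ⇒ B, Π g : A ⇒ B, Π p : x == y,
    Π u : f @ x == g @ x, Π v : f @ y == g @ y, cong @ f @ p • v == u • cong @ g @ p ⇒
    transport A (λ t : A, f @ t == g @ t) x y p u == v)
  (fn A B x y f g p u, Jp (fn y p, Π v : f @ y == g @ y, cong @ f @ p • v == u • cong @ g @ p ⇒
    transport A (λ t : A, f @ t == g @ t) x y p u == v) (fn v h, inv @ h • catL @ v) p)).

(** Computes the action on [cLoop] of a map defined by the recursor, see [circBeta]. *)
Instance apdConst : Lib := ltac:(lemma 4
  (Π A : U 0, Π M : U 0, Π x : A, Π y : A, Π f : A ⇒ M, Π p : x == y,
    apd A (λ _ : A, M) f x y p == transportConst @ p @ (f @ x) • cong @ f @ p)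
  (fn A M x y f p, Jp (fn y p, apd A (λ _ : A, M) f x y p == transportConst @ p @ (f @ x) • cong @ f @ p) rfl p)).

Instance circRec : Lib := ltac:(lemma 1
  (Π A : U 0, Π a : A, a == a ⇒ cCirc ⇒ A)
  (fn A a l, cCircInd @ (fn _, A) @ a @ (transportConst @ cLoop @ a • l))).
Instance circBeta : Lib := ltac:(lemma 1
  (Π A : U 0, Π a : A, Π l : a == a, cong @ (circRec @ a @ l) @ cLoop == l)
  (fn A a l, cancelL @ (transportConst @ cLoop @ a) @ (cong @ (circRec @ a @ l) @ cLoop) @ l
    @ (inv @ (apdConst @ (circRec @ a @ l) @ cLoop)
       • cCircIndLoop @ (λ _ : cCirc, A) @ a @ (transportConst @ cLoop @ a • l)))).

(** By function extensionality and induction on the circle, whose path condition is the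
    commuting square. *)
Instance circHtpy : Lib := ltac:(lemma 1
  (Π A : U 0, Π f : cCirc ⇒ A, Π g : cCirc ⇒ A, Π h : f @ cBase == g @ cBase,
    cong @ f @ cLoop • h == h • cong @ g @ cLoop ⇒ f == g)
  (fn A f g h e, funext @ (cCircInd @ (fn x, f @ x == g @ x) @ h @ (transportEq @ f @ g @ cLoop @ h @ h @ e)))).
Instance circEta : Lib := ltac:(lemma 1
  (Π A : U 0, Π f : cCirc ⇒ A, circRec @ (f @ cBase) @ (cong @ f @ cLoop) == f)
  (fn A f, circHtpy @ (circRec @ (f @ cBase) @ (cong @ f @ cLoop)) @ f @ rfl
     @ (circBeta @ (f @ cBase) @ (cong @ f @ cLoop) • inv @ (catL @ (cong @ f @ cLoop))))).
Instance circRefl : Lib := ltac:(lemma 1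
  (Π A : U 0, Π a : A, circRec @ a @ rfl == (λ _ : cCirc, a))
  (fn A a, circHtpy @ (circRec @ a @ rfl) @ (λ _ : cCirc, a) @ rfl
     @ (circBeta @ a @ rfl • cong @ (fn t, rfl • t) @ (inv @ (congConst @ a @ cLoop))))).

(** Post-composition with a pointed map acts on loops by its action on loop spaces. *)
Instance circPost : Lib := ltac:(lemma 2
  (Π A : U 0, Π B : U 0, Π f : A ⇒ B, Π a : A, Π b : B, Π q : f @ a == b, Π p : a == a,
    (λ c : cCirc, f @ (circRec @ a @ p @ c)) == circRec @ b @ (conjLoop B (f @ a) b q (cong @ f @ p)))
  (fn A B f a b q p, Jp
     (fn b q, (λ c : cCirc, f @ (circRec @ a @ p @ c)) == circRec @ b @ (conjLoop B (f @ a) b q (cong @ f @ p)))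
     (circHtpy @ (λ c : cCirc, f @ (circRec @ a @ p @ c)) @ (circRec @ (f @ a) @ (cong @ f @ p)) @ rfl
        @ (congComp @ f @ (circRec @ a @ p) @ cLoop • cong @ (fn t, cong @ f @ t) @ (circBeta @ a @ p)
           • inv @ (circBeta @ (f @ a) @ (cong @ f @ p))
           • inv @ (catL @ (cong @ (circRec @ (f @ a) @ (cong @ f @ p)) @ cLoop)))) q)).

(** In a set the loop is trivial. *)
Instance circConst : Lib := ltac:(lemma 1
  (Π A : U 0, isSet A ⇒ Π f : cCirc ⇒ A, (λ _ : cCirc, f @ cBase) == f)
  (fn A h f, funext @ (cCircInd @ (fn x, f @ cBase == f @ x) @ rfl @ (h @ hole @ hole @ hole @ hole)))).

(** A map is a point with a loop, and the mere statement need only be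
    proved when this point is the base point, where it is trivial. *)
Instance circSurj : Lib := ltac:(lemma 1
  (Π A : U 0, Π m : cNat, isContr (cTr @ (cS @ m) @ A) ⇒ Π a : A, Π f : cCirc ⇒ A,
    cTr @ cO @ (Σ p : a == a, circRec @ a @ p == f))
  (fn A m c a f,
     truncRec @ truncProp
       @ (λ s : (Σ p : a == a, circRec @ a @ p == circRec @ (f @ cBase) @ (cong @ f @ cLoop)),
           cTrIn @ cO @ (Σ p : a == a, circRec @ a @ p == f) @ ⟨pr1 @ s, pr2 @ s • circEta @ f⟩)
       @ (connInd @ c
           @ (λ x : A, Π l : x == x, cTr @ cO @ (Σ p : a == a, circRec @ a @ p == circRec @ x @ l))
           @ (fn x, propPi @ (fn l, truncProp)) @ a
           @ (fn l, cTrIn @ cO @ (Σ p : a == a, circRec @ a @ p == circRec @ a @ l) @ ⟨l, rfl⟩)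
           @ (f @ cBase) @ (cong @ f @ cLoop)))).

(** A path of maps from the circle restricts to a path at the base point that conjugates
    one loop into the other. *)
Instance circEqNatural : Lib := ltac:(lemma 3
  (Π A : U 0, Π f : cCirc ⇒ A, Π g : cCirc ⇒ A, Π e : f == g,
    cong @ f @ cLoop • cong @ (λ f : cCirc ⇒ A, f @ cBase) @ e ==
    cong @ (λ f : cCirc ⇒ A, f @ cBase) @ e • cong @ g @ cLoop)
  (fn A f g e, Jp (fn g e, cong @ f @ cLoop • cong @ (λ f : cCirc ⇒ A, f @ cBase) @ e ==
    cong @ (λ f : cCirc ⇒ A, f @ cBase) @ e • cong @ g @ cLoop) (inv @ (catL @ (cong @ f @ cLoop))) e)).

(** Conjugate loops are equal when loops commute. *)
Instance circInj : Lib := ltac:(lemma 2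
  (Π A : U 0, Π a : A, (Π p : a == a, Π q : a == a, p • q == q • p) ⇒
    Π p : a == a, Π q : a == a, circRec @ a @ p == circRec @ a @ q ⇒ p == q)
  (fn A a comm p q e,
    (* d is the restriction of e to the base point, h its naturality. *)
    (λ d : a == a, λ h : cong @ (circRec @ a @ p) @ cLoop • d == d • cong @ (circRec @ a @ q) @ cLoop,
      cancelL @ d @ p @ q
       @ (comm @ d @ p • cong @ (fn t, t • d) @ (inv @ (circBeta @ a @ p)) • h
          • cong @ (fn t, d • t) @ (circBeta @ a @ q)))
    @ (cong @ (λ f : cCirc ⇒ A, f @ cBase) @ e) @ (circEqNatural @ e))).

(** * Maps from the circle to a delooping of the integers *)

(** Connected deloopings A of the group ℤ. *)
Definition forK1 (P : hterm -> hterm -> hterm -> hterm -> hterm -> hterm -> hterm -> hterm) : hterm :=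
  Π A : U 0, Π a : A, Π s : Zcar ⇒ a == a,
  Π sE : isEquiv Zcar (a == a) s, Π hom : (Π x : Zcar, Π y : Zcar, s @ (x ⊕ y) == s @ x • s @ y),
  Π conn : isContr (setTr A), Π hZ : isSet Zcar, P A a s sE hom conn hZ.
Definition circMaps (A : hterm) : hterm := setTr (cCirc ⇒ A).
Definition k1Args (t sE hom conn hZ : hterm) : hterm := t @ sE @ hom @ conn @ hZ.

(** Loops commute since integers do. *)
Instance loopComm : Lib := ltac:(lemma 3
  (forK1 (fun A a s sE hom conn hZ => Π p : a == a, Π q : a == a, p • q == q • p))
  (fn A a s sE hom conn hZ p q,
    inv @ (cong2 @ cat @ (einvS @ sE @ p) @ (einvS @ sE @ q))
    • inv @ (hom @ (einv @ sE @ p) @ (einv @ sE @ q))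
    • cong @ s @ (addC @ (einv @ sE @ p) @ (einv @ sE @ q))
    • hom @ (einv @ sE @ q) @ (einv @ sE @ p)
    • cong2 @ cat @ (einvS @ sE @ q) @ (einvS @ sE @ p))).
Instance homZero : Lib := ltac:(lemma 3
  (forK1 (fun A a s sE hom conn hZ => s @ z0 == rfl))
  (fn A a s sE hom conn hZ,
    cancelL @ (s @ z0) @ (s @ z0) @ rfl @ (inv @ (hom @ z0 @ z0)))).
Instance loopClass : Lib := ltac:(lemma 2
  (Π A : U 0, Π a : A, Π s : Zcar ⇒ a == a, Zcar ⇒ circMaps A)
  (fn A a s k, setIn (cCirc ⇒ A) (circRec @ a @ (s @ k)))).
Instance loopClassInj : Lib := ltac:(lemma 3
  (forK1 (fun A a s sE hom conn hZ => Π k : Zcar, Π l : Zcar, loopClass @ s @ k == loopClass @ s @ l ⇒ k == l))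
  (fn A a s sE hom conn hZ k l e,
    truncRec @ (hZ @ k @ l)
      @ (λ e : circRec @ a @ (s @ k) == circRec @ a @ (s @ l),
          inv @ (einvK @ sE @ k)
          • cong @ (fn p, einv @ sE @ p) @
             (circInj @ (k1Args loopComm sE hom conn hZ) @ (s @ k) @ (s @ l) @ e)
          • einvK @ sE @ l)
      @ (setTrEq @ e))).
Instance loopClassSurj : Lib := ltac:(lemma 3
  (forK1 (fun A a s sE hom conn hZ => Π x : circMaps A, cTr @ cO @ (Σ k : Zcar, loopClass @ s @ k == x)))
  (fn A a s sE hom conn hZ, 
    setTrInd @ (λ x : circMaps A, truncProp) @ (λ f : cCirc ⇒ A,
      truncRec @ truncProp
        @ (λ r : (Σ p : a == a, circRec @ a @ p == f),
            cTrIn @ cO @ (Σ k : Zcar, loopClass @ s @ k == setIn (cCirc ⇒ A) f)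
              @ ⟨einv @ sE @ (pr1 @ r),
                 cong @ (λ p : a == a, setIn (cCirc ⇒ A) (circRec @ a @ p)) @ (einvS @ sE @ (pr1 @ r))
                 • cong @ (λ f : cCirc ⇒ A, setIn (cCirc ⇒ A) f) @ (pr2 @ r)⟩)
        @ (circSurj @ cO @ conn @ a @ f)))).
Instance fibProp : Lib := ltac:(lemma 3
  (Π A : U 0, Π B : U 0, Π f : A ⇒ B, isSet B ⇒ (Π x : A, Π y : A, f @ x == f @ y ⇒ x == y) ⇒
    Π b : B, isProp (Σ x : A, f @ x == b))
  (fn A B f hB inj b,
    cSigInd @ A @ (fn x, f @ x == b) @ (fn c, Π d : (Σ x : A, f @ x == b), c == d)
      @ (fn x p, cSigInd @ A @ (fn x, f @ x == b)
          @ (fn d, Id (Σ x : A, f @ x == b) ⟨x, p⟩ d)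
          @ (fn y q, sigEq @ (fn x, hB @ (f @ x) @ b) @ x @ y @ p @ q @ (inj @ x @ y @ (p • inv @ q)))))).

(** The loop class is injective, hence a preimage is unique and can be extracted from its
    mere existence. *)
Instance windingFib : Lib := ltac:(lemma 3
  (forK1 (fun A a s sE hom conn hZ => Π x : circMaps A, Σ k : Zcar, loopClass @ s @ k == x))
  (fn A a s sE hom conn hZ x,
    truncRec @ (fibProp @ setTrSet @ (k1Args loopClassInj sE hom conn hZ) @ x) @ (λ c : (Σ k : Zcar, loopClass @ s @ k == x), c)
      @ (k1Args loopClassSurj sE hom conn hZ @ x))).
Instance winding : Lib := ltac:(lemma 3
  (forK1 (fun A a s sE hom conn hZ => circMaps A ⇒ Zcar))
  (fn A a s sE hom conn hZ x, pr1 @ (k1Args windingFib sE hom conn hZ @ x))).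
Instance loopClassWinding : Lib := ltac:(lemma 3
  (forK1 (fun A a s sE hom conn hZ => Π x : circMaps A, loopClass @ s @ (k1Args winding sE hom conn hZ @ x) == x))
  (fn A a s sE hom conn hZ x, pr2 @ (k1Args windingFib sE hom conn hZ @ x))).
Instance windingLoopClass : Lib := ltac:(lemma 3
  (forK1 (fun A a s sE hom conn hZ => Π k : Zcar, k1Args winding sE hom conn hZ @ (loopClass @ s @ k) == k))
  (fn A a s sE hom conn hZ k, k1Args loopClassInj sE hom conn hZ @ (k1Args winding sE hom conn hZ @ (loopClass @ s @ k)) @ k
     @ (k1Args loopClassWinding sE hom conn hZ @ (loopClass @ s @ k)))).

Instance catVK : Lib := ltac:(lemma 4
  (Π A : U 1, Π x : A, Π y : A, Π z : A, Π w : x == y, Π u : x == z, w • (inv @ w • u) == u)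
  (fn A x y z w u, catA @ w @ (inv @ w) @ u • cong @ (fn t, t • u) @ (catV @ w) • catL @ u)).

(** If u and w conjugate P to p and Q to q, then u conjugates P • Q to p • q, because
    conjugation by the loop w⁻¹ • u is trivial. *)
Instance conjCat : Lib := ltac:(lemma 3
  (Π A : U 1, Π x : A, Π a : A, (Π p : a == a, Π q : a == a, p • q == q • p) ⇒
    Π P : x == x, Π Q : x == x, Π u : x == a, Π w : x == a, Π p : a == a, Π q : a == a,
    P • u == u • p ⇒ Q • w == w • q ⇒ P • Q • u == u • (p • q))
  (fn A x a comm P Q u w p q hP hQ,
    (* u agrees with w up to the loop w⁻¹ • u, which commutes with q. *)
    (λ hu : Q • u == u • q,
       inv @ (catA @ P @ Q @ u) • cong @ (fn t, P • t) @ hu • catA @ P @ u @ q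
       • cong @ (fn t, t • q) @ hP • inv @ (catA @ u @ p @ q))
    @ (cong @ (fn t, Q • t) @ (inv @ (catVK @ w @ u)) • catA @ Q @ w @ (inv @ w • u)
       • cong @ (fn t, t • (inv @ w • u)) @ hQ • inv @ (catA @ w @ q @ (inv @ w • u))
       • cong @ (fn t, w • t) @ (comm @ q @ (inv @ w • u)) • catA @ w @ (inv @ w • u) @ q
       • cong @ (fn t, t • q) @ (catVK @ w @ u)))).

(** For an operation with unit a, the maps x ↦ f(x, a) and y ↦ f(a, y) are homotopic
    to the identity, so that by interchange f(p, q) is p • q up to conjugation. *)
Instance circOp : Lib := ltac:(lemma 2
  (Π A : U 0, Π a : A, Π f : A ⇒ A ⇒ A, (Π x : A, f @ x @ a == x) ⇒ (Π y : A, f @ a @ y == y) ⇒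
    (Π p : a == a, Π q : a == a, p • q == q • p) ⇒ Π p : a == a, Π q : a == a,
    (λ c : cCirc, f @ (circRec @ a @ p @ c) @ (circRec @ a @ q @ c)) == circRec @ a @ (p • q))
  (fn A a f r l comm p q,
    circHtpy @ (λ c : cCirc, f @ (circRec @ a @ p @ c) @ (circRec @ a @ q @ c)) @ (circRec @ a @ (p • q))
      @ (r @ a)
      @ (cong @ (fn t, t • r @ a)
           @ (congBinary @ f @ (circRec @ a @ p) @ (circRec @ a @ q) @ cLoop
              • cong2 @ (λ s : a == a, λ t : a == a, cong @ (λ x : A, f @ x @ a) @ s • cong @ (f @ a) @ t)
                  @ (circBeta @ a @ p) @ (circBeta @ a @ q))
         • conjCat @ comm @ (cong @ (λ x : A, f @ x @ a) @ p) @ (cong @ (f @ a) @ q) @ (r @ a) @ (l @ a) @ p @ q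
             @ (congNatural @ (λ x : A, f @ x @ a) @ (λ x : A, x) @ r @ p • cong @ (fn t, r @ a • t) @ (congId @ p))
             @ (congNatural @ (λ y : A, f @ a @ y) @ (λ x : A, x) @ l @ q • cong @ (fn t, l @ a • t) @ (congId @ q))
         • cong @ (fn t, r @ a • t) @ (inv @ (circBeta @ a @ (p • q)))))).

(** The addition of A is the concatenation of b = b transferred along t; its unit is
    the point sent to reflexivity. *)
Instance loopAdd : Lib := ltac:(lemma 4
  (Π A : U 0, Π B : U 0, Π b : B, Π t : A ⇒ b == b, isEquiv A (b == b) t ⇒ A ⇒ A ⇒ A)
  (fn A B b t suspEquivTy x y, einv @ suspEquivTy @ (t @ x • t @ y))).
Instance loopAddR : Lib := ltac:(lemma 4
  (Π A : U 0, Π B : U 0, Π b : B, Π t : A ⇒ b == b, Π suspEquivTy : isEquiv A (b == b) t,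
    Π a : A, t @ a == rfl ⇒ Π x : A, loopAdd @ suspEquivTy @ x @ a == x)
  (fn A B b t suspEquivTy a h x, cong @ (λ e : b == b, einv @ suspEquivTy @ (t @ x • e)) @ h • einvK @ suspEquivTy @ x)).
Instance loopAddL : Lib := ltac:(lemma 4
  (Π A : U 0, Π B : U 0, Π b : B, Π t : A ⇒ b == b, Π suspEquivTy : isEquiv A (b == b) t,
    Π a : A, t @ a == rfl ⇒ Π x : A, loopAdd @ suspEquivTy @ a @ x == x)
  (fn A B b t suspEquivTy a h x, cong @ (λ e : b == b, einv @ suspEquivTy @ (e • t @ x)) @ h
     • cong @ (fn e, einv @ suspEquivTy @ e) @ (catL @ (t @ x)) • einvK @ suspEquivTy @ x)).
Instance loopClassAdd : Lib := ltac:(lemma 3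
  (forK1 (fun A a s sE hom conn hZ => Π B : U 0, Π b : B, Π t : A ⇒ b == b,
    Π suspEquivTy : isEquiv A (b == b) t, t @ a == rfl ⇒ Π k : Zcar, Π l : Zcar,
    setIn (cCirc ⇒ A) (λ c : cCirc, loopAdd @ suspEquivTy @ (circRec @ a @ (s @ k) @ c) @ (circRec @ a @ (s @ l) @ c))
    == loopClass @ s @ (k ⊕ l)))
  (fn A a s sE hom conn hZ B b t suspEquivTy h k l,
    cong @ (λ f : cCirc ⇒ A, setIn (cCirc ⇒ A) f)
      @ (circOp @ (loopAdd @ suspEquivTy) @ (loopAddR @ suspEquivTy @ a @ h) @ (loopAddL @ suspEquivTy @ a @ h)
          @ (k1Args loopComm sE hom conn hZ) @ (s @ k) @ (s @ l)
         • cong @ (λ e : a == a, circRec @ a @ e) @ (inv @ (hom @ k @ l))))).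
Instance windingAdd : Lib := ltac:(lemma 3
  (forK1 (fun A a s sE hom conn hZ => Π f : circMaps A ⇒ circMaps A ⇒ circMaps A,
    (Π k : Zcar, Π l : Zcar, f @ (loopClass @ s @ k) @ (loopClass @ s @ l) == loopClass @ s @ (k ⊕ l)) ⇒
    Π x : circMaps A, Π y : circMaps A, k1Args winding sE hom conn hZ @ (f @ x @ y) ==
      (k1Args winding sE hom conn hZ @ x) ⊕ (k1Args winding sE hom conn hZ @ y)))
  (fn A a s sE hom conn hZ f h x y,
    let w := k1Args winding sE hom conn hZ in
    let loopClassWinding := k1Args loopClassWinding sE hom conn hZ in
    cong @ w @ (cong2 @ f @ (inv @ (loopClassWinding @ x)) @ (inv @ (loopClassWinding @ y)) • h @ (w @ x) @ (w @ y))
    • k1Args windingLoopClass sE hom conn hZ @ (w @ x ⊕ w @ y))).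

Instance setTrRec : Lib := ltac:(lemma 2
  (Π A : U 0, Π B : U 0, isSet B ⇒ (A ⇒ B) ⇒ setTr A ⇒ B)
  (fn A B h f, cTrInd @ (cS @ cO) @ A @ (fn _, B) @ (fn _ x y p q, propContr @ (h @ x @ y) @ p @ q) @ f)).
Instance evalBase : Lib := ltac:(lemma 1
  (Π A : U 0, isSet A ⇒ circMaps A ⇒ A)
  (fn A h, setTrRec @ h @ (λ f : cCirc ⇒ A, f @ cBase))).

(** A map to a set is constant, so that a class of degree 0 is the value at the base point. *)
Instance evalBaseK : Lib := ltac:(lemma 1
  (Π A : U 0, Π h : isSet A, Π x : circMaps A, setIn (cCirc ⇒ A) (λ _ : cCirc, evalBase @ h @ x) == x)
  (fn A h, setTrInd @ (λ x : circMaps A, setTrSet @ hole @ hole)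
     @ (λ f : cCirc ⇒ A, cong @ (λ f : cCirc ⇒ A, setIn (cCirc ⇒ A) f) @ (circConst @ h @ f)))).

(** The loops at a are parametrised by the connected type B, so that the class of the
    map given by a loop, being an element of a set, does not depend on the loop. *)
Instance circTriv : Lib := ltac:(lemma 4
  (Π A : U 0, Π m : cNat, Π B : U 0, Π k : cNat, isContr (cTr @ (cS @ m) @ A) ⇒ isContr (cTr @ (cS @ k) @ B) ⇒
    Π a : A, Π b : B, Π s : B ⇒ a == a, isEquiv B (a == a) s ⇒ s @ b == rfl ⇒
    Π x : circMaps A, setIn (cCirc ⇒ A) (λ _ : cCirc, a) == x)
  (fn A m B k cA cB a b s sE h,
    setTrInd @ (λ x : circMaps A, setTrSet @ hole @ hole) @ (λ f : cCirc ⇒ A,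
      truncRec @ (setTrSet @ hole @ hole)
       @ (λ r : (Σ p : a == a, circRec @ a @ p == f),
           (λ e : (Π y : B, setIn (cCirc ⇒ A) (λ _ : cCirc, a) == setIn (cCirc ⇒ A) (circRec @ a @ (s @ y))),
             e @ (einv @ sE @ (pr1 @ r))
             • cong @ (λ p : a == a, setIn (cCirc ⇒ A) (circRec @ a @ p)) @ (einvS @ sE @ (pr1 @ r))
             • cong @ (λ f : cCirc ⇒ A, setIn (cCirc ⇒ A) f) @ (pr2 @ r))
           @ (connInd @ cB
               @ (λ y : B, setIn (cCirc ⇒ A) (λ _ : cCirc, a) == setIn (cCirc ⇒ A) (circRec @ a @ (s @ y)))
               @ (λ y : B, setTrSet @ hole @ hole) @ b
               @ (inv @ (cong @ (λ p : a == a, setIn (cCirc ⇒ A) (circRec @ a @ p)) @ h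
                         • cong @ (λ f : cCirc ⇒ A, setIn (cCirc ⇒ A) f) @ (circRefl @ a)))))
       @ (circSurj @ m @ cA @ a @ f)))).

(** * The cohomology of the circle *)

(** The variables over which the theorem quantifies. *)
Record EMctx : Type := EMc {
  kK : hterm; kconn : hterm; klev : hterm; ksusp : hterm; kE : hterm; khom : hterm;
  kcup : hterm; kcz : hterm; kcl : hterm
}.

(** The hypotheses of the theorem receive names, by which they can be compared without
    being unfolded. *)
Instance emFamily : Lib := ltac:(lemma 0 ((cNat ⇒ Ptd) ⇒ cNat ⇒ Ptd) (fn K', EMspace ZRing K')).
Instance connTy : Lib := ltac:(lemma 0 ((cNat ⇒ Ptd) ⇒ U 0)
  (fn K', Π n : cNat, isContr (cTr @ n @ ty (emFamily @ K' @ n)))).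
Instance levelTy : Lib := ltac:(lemma 0 ((cNat ⇒ Ptd) ⇒ U 0)
  (fn K', Π n : cNat, hlevel 0 (cS @ (cS @ n)) (ty (emFamily @ K' @ n)))).
Instance suspTy : Lib := ltac:(lemma 0 ((cNat ⇒ Ptd) ⇒ U 0)
  (fn K', (Π n : cNat, pmap (emFamily @ K' @ n) (Loop (emFamily @ K' @ (cS @ n)))))).
Instance suspEquivTy : Lib := ltac:(lemma 0 (Π K' : cNat ⇒ Ptd, suspTy @ K' ⇒ U 0)
  (fn K' s, Π n : cNat, isPtdEquiv (emFamily @ K' @ n) (Loop (emFamily @ K' @ (cS @ n))) (s @ n))).
Instance suspHomTy : Lib := ltac:(lemma 0 (Π K' : cNat ⇒ Ptd, suspTy @ K' ⇒ U 0)
  (fn K' s, Π x : Zcar, Π y : Zcar,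
    let K := emFamily @ K' in
    let K1 := K @ (cS @ cO) in
    Id (ty (Loop K1)) (suspFun K s cO @ (x ⊕ y))
      (concat (ty K1) (pt K1) (pt K1) (pt K1) (suspFun K s cO @ x) (suspFun K s cO @ y)))).
Instance cupTy : Lib := ltac:(lemma 0 ((cNat ⇒ Ptd) ⇒ U 0) (fn K', cupType (emFamily @ K'))).
Instance cupZeroTy : Lib := ltac:(lemma 0 (Π K' : cNat ⇒ Ptd, suspTy @ K' ⇒ cupTy @ K' ⇒ U 0)
  (fn K' s c, isCupZero ZRing (emFamily @ K') s c)).
Instance cupLoopsTy : Lib := ltac:(lemma 0 (Π K' : cNat ⇒ Ptd, suspTy @ K' ⇒ cupTy @ K' ⇒ U 0)
  (fn K' s c, isCupLoops ZRing (emFamily @ K') s c)).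
Definition kSp (k : EMctx) : hterm := emFamily @ kK k.
Definition kEM (k : EMctx) : EMdata := mkEMdata (kSp k) (ksusp k) (kE k) (kcup k).
Definition forK (P : EMctx -> hterm) : hterm :=
  Π K' : cNat ⇒ Ptd, Π conn : connTy @ K', Π lev : levelTy @ K',
  Π susp : suspTy @ K', Π suspE : suspEquivTy @ K' @ susp, Π hom : suspHomTy @ K' @ susp,
  Π cup : cupTy @ K', Π cz : cupZeroTy @ K' @ susp @ cup, Π cl : cupLoopsTy @ K' @ susp @ cup,
  P (EMc K' conn lev susp suspE hom cup cz cl).
Definition lamK (P : EMctx -> hterm) : hterm :=
  fn K' conn lev susp suspE hom cup cz cl, P (EMc K' conn lev susp suspE hom cup cz cl).
Definition inK (t : hterm) (k : EMctx) : hterm :=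
  t @ kK k @ kconn k @ klev k @ ksusp k @ kE k @ khom k @ kcup k @ kcz k @ kcl k.

(** ℤ is K(ℤ,0), which is a set. *)
Instance zSet : Lib := ltac:(lemma 0
  (forK (fun k => isSet Zcar))
  (lamK (fun k => fn x y p q, pr1 @ (klev k @ cO @ x @ y @ p @ q)))).
Definition kA (k : EMctx) (n : hterm) : hterm := ty (kSp k @ n).
Definition kpt (k : EMctx) (n : hterm) : hterm := pt (kSp k @ n).
Definition ks (k : EMctx) (n : hterm) : hterm := suspFun (kSp k) (ksusp k) n.
Definition kH (k : EMctx) (n : hterm) : hterm := H (kEM k) cCirc n.

(** A statement about deloopings of ℤ, applied to K(ℤ,1). *)
Definition inK1 (t : Lib) (k : EMctx) : hterm :=
  expl t @ kA k cOne @ kpt k cOne @ ks k cO @ (kE k @ cO) @ khom k @ (kconn k @ cOne) @ inK zSet k.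
Definition constClass (k : EMctx) (x : hterm) : hterm := setIn (cochain (kEM k) cCirc cO) (λ _ : cCirc, x).
Definition kLoopClass (k : EMctx) (x : hterm) : hterm := expl loopClass @ kA k cOne @ kpt k cOne @ ks k cO @ x.
Definition kEval (k : EMctx) : hterm := evalBase @ inK zSet k.
Definition kWinding (k : EMctx) : hterm := inK1 winding k.

(** The addition of K(ℤ,0) comes from Ω K(ℤ,1), where it corresponds to that of ℤ. *)
Instance addKZero : Lib := ltac:(lemma 0
  (forK (fun k => Π x : Zcar, Π y : Zcar, Id Zcar (addK (kEM k) cO x y) (x ⊕ y)))
  (lamK (fun k => fn x y, cong @ (fn t, einv @ (kE k @ cO) @ t) @ (inv @ (khom k @ x @ y))
     • einvK @ (kE k @ cO) @ (x ⊕ y)))).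
Instance evalAdd : Lib := ltac:(lemma 0
  (forK (fun k => Π x : kH k cO, Π y : kH k cO,
     kEval k @ addH (kEM k) cCirc cO x y == (kEval k @ x) ⊕ (kEval k @ y)))
  (lamK (fun k => 
     setTrInd @ (λ x : kH k cO, propPi @ (λ y : kH k cO, inK zSet k @ hole @ hole)) @ (fn f,
       setTrInd @ (λ y : kH k cO, inK zSet k @ hole @ hole)
         @ (fn g, inK addKZero k @ (f @ cBase) @ (g @ cBase)))))).
Instance kLoopClassAdd : Lib := ltac:(lemma 0
  (forK (fun k => Π x : Zcar, Π y : Zcar,
     Id (kH k cOne) (addH (kEM k) cCirc cOne (kLoopClass k x) (kLoopClass k y)) (kLoopClass k (x ⊕ y))))
  (lamK (fun k => inK1 loopClassAdd k @ kA k (cS @ cOne) @ kpt k (cS @ cOne) @ ks k cOne @ (kE k @ cOne)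
     @ ppt (kSp k @ cOne) (Loop (kSp k @ (cS @ cOne))) (ksusp k @ cOne)))).
Instance kWindingAdd : Lib := ltac:(lemma 0
  (forK (fun k => Π x : kH k cOne, Π y : kH k cOne,
     kWinding k @ addH (kEM k) cCirc cOne x y == (kWinding k @ x) ⊕ (kWinding k @ y)))
  (lamK (fun k => inK1 windingAdd k @ (λ x : kH k cOne, λ y : kH k cOne, addH (kEM k) cCirc cOne x y) @ inK kLoopClassAdd k))).
Instance kLoopClassZero : Lib := ltac:(lemma 0
  (forK (fun k => Id (kH k cOne) (kLoopClass k z0) (zeroH (kEM k) cCirc cOne)))
  (lamK (fun k => cong @ (λ p : kpt k cOne == kpt k cOne, setIn (cochain (kEM k) cCirc cOne) (circRec @ kpt k cOne @ p))
        @ inK1 homZero k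
     • cong @ (λ f : cochain (kEM k) cCirc cOne, setIn (cochain (kEM k) cCirc cOne) f) @ (circRefl @ kpt k cOne)))).
Instance kWindingZero : Lib := ltac:(lemma 0
  (forK (fun k => kWinding k @ zeroH (kEM k) cCirc cOne == z0))
  (lamK (fun k => cong @ kWinding k @ (inv @ inK kLoopClassZero k) • inK1 windingLoopClass k @ z0))).

(** K(ℤ,n+2) is connected with connected loop space K(ℤ,n+1). *)
Instance highVanish : Lib := ltac:(lemma 0
  (forK (fun k => Π n : cNat, Π x : kH k (cS @ (cS @ n)), zeroH (kEM k) cCirc (cS @ (cS @ n)) == x))
  (lamK (fun k => fn n, circTriv @ (kconn k @ (cS @ (cS @ n))) @ (kconn k @ (cS @ n))
     @ kpt k (cS @ (cS @ n)) @ kpt k (cS @ n) @ ks k (cS @ n) @ (kE k @ (cS @ n))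
     @ ppt (kSp k @ (cS @ n)) (Loop (kSp k @ (cS @ (cS @ n)))) (ksusp k @ (cS @ n))))).

Definition kcupH (k : EMctx) (n m x y : hterm) : hterm := cupH (kEM k) cCirc n m x y.
Definition kmap (k : EMctx) (n m x : hterm) : hterm := cupMap (kSp k) (kcup k) n m x.

Instance evalCup : Lib := ltac:(lemma 0
  (forK (fun k => Π x : kH k cO, Π y : kH k cO,
     kEval k @ kcupH k cO cO x y == (kEval k @ x) ⊗ (kEval k @ y)))
  (lamK (fun k =>
     setTrInd @ (λ x : kH k cO, propPi @ (λ y : kH k cO, inK zSet k @ hole @ hole)) @ (fn f,
       setTrInd @ (λ y : kH k cO, inK zSet k @ hole @ hole)
         @ (fn g, kcz k @ cO @ (f @ cBase) @ (g @ cBase)))))).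

(** The cup product with an integer x is post-composition with a pointed map
    K(ℤ,1) → K(ℤ,1) that acts on loops as multiplication by x. *)
Instance cup01 : Lib := ltac:(lemma 0
  (forK (fun k => Π x : Zcar, Π y : Zcar,
     Id (kH k cOne) (kcupH k cO cOne (constClass k x) (kLoopClass k y)) (kLoopClass k (x ⊗ y))))
  (lamK (fun k => fn x y,
     let f := pfun (kSp k @ cOne) (kSp k @ cOne) (kmap k cO cOne x) in
     let q := ppt (kSp k @ cOne) (kSp k @ cOne) (kmap k cO cOne x) in
     let set := λ f : cochain (kEM k) cCirc cOne, setIn (cochain (kEM k) cCirc cOne) f in
     cong @ set @ (circPost @ f @ kpt k cOne @ kpt k cOne @ q @ (ks k cO @ y)
        • cong @ (λ p : kpt k cOne == kpt k cOne, circRec @ kpt k cOne @ p) @ (kcz k @ cOne @ x @ y))))).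

(** The pointed map z ↦ z ⌣ y acts on the loop of x by the product with y, read in Ω K(ℤ,1) through
    the equivalence with ℤ. *)
Instance cup10 : Lib := ltac:(lemma 0
  (forK (fun k => Π x : Zcar, Π y : Zcar,
     Id (kH k cOne) (kcupH k cOne cO (kLoopClass k x) (constClass k y)) (kLoopClass k (x ⊗ y))))
  (lamK (fun k => fn x y,
     let F := cupLeft (kSp k) (kcup k) cOne cO y in
     let f := pfun (kSp k @ cOne) (kSp k @ cOne) F in
     let q := ppt (kSp k @ cOne) (kSp k @ cOne) F in
     let set := λ f : cochain (kEM k) cCirc cOne, setIn (cochain (kEM k) cCirc cOne) f in
     cong @ set @ (circPost @ f @ kpt k cOne @ kpt k cOne @ q @ (ks k cO @ x)
        • cong @ (λ p : kpt k cOne == kpt k cOne, circRec @ kpt k cOne @ p)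
           @ (kcl k @ cOne @ cO @ x @ y • cong @ ks k cO @ (kcz k @ cO @ x @ y)))))).

Definition kCupFun (k : EMctx) : hterm :=
  λ n : cNat, λ l : cNat, λ x : kH k n, λ y : kH k l, kcupH k n l x y.
Definition constClassFun (k : EMctx) : hterm := λ x : Zcar, constClass k x.
Definition kLoopClassFun (k : EMctx) : hterm := λ x : Zcar, kLoopClass k x.
Instance windingCup01 : Lib := ltac:(lemma 0
  (forK (fun k => Π x : kH k cO, Π y : kH k cOne,
     kWinding k @ kcupH k cO cOne x y == (kEval k @ x) ⊗ (kWinding k @ y)))
  (lamK (fun k => fn x y,
     cong @ kWinding k @ (cong2 @ (kCupFun k @ cO @ cOne) @ (inv @ (evalBaseK @ inK zSet k @ x)) @ (inv @ (inK1 loopClassWinding k @ y))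
        • inK cup01 k @ (kEval k @ x) @ (kWinding k @ y))
     • inK1 windingLoopClass k @ ((kEval k @ x) ⊗ (kWinding k @ y))))).
Instance windingCup10 : Lib := ltac:(lemma 0
  (forK (fun k => Π x : kH k cOne, Π y : kH k cO,
     kWinding k @ kcupH k cOne cO x y == (kWinding k @ x) ⊗ (kEval k @ y)))
  (lamK (fun k => fn x y,
     cong @ kWinding k @ (cong2 @ (kCupFun k @ cOne @ cO) @ (inv @ (inK1 loopClassWinding k @ x)) @ (inv @ (evalBaseK @ inK zSet k @ y))
        • inK cup10 k @ (kWinding k @ x) @ (kEval k @ y))
     • inK1 windingLoopClass k @ ((kWinding k @ x) ⊗ (kEval k @ y))))).

(** Here K is written out as in the theorem instead of being named. *)
Definition emData (k : EMctx) : EMdata := mkEMdata (EMspace ZRing (kK k)) (ksusp k) (kE k) (kcup k).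
Definition kGr (k : EMctx) : grData :=
  let D := cohomologyGraded ZRing (emData k) cCirc in
  Gr (G D) (G0 D) (Gadd D) (λ n : cNat, λ l : cNat, λ x : G D @ n, λ y : G D @ l, Gmul D n l x y) (inK zSet k)
    (kEval k) rfl (inK evalAdd k) (constClassFun k) (fn x, rfl) (evalBaseK @ inK zSet k)
    (kWinding k) (inK kWindingZero k) (inK kWindingAdd k) (kLoopClassFun k) (inK1 windingLoopClass k) (inK1 loopClassWinding k)
    (inK highVanish k) (inK evalCup k) (inK windingCup01 k) (inK windingCup10 k).

(** The hypotheses are still named; they are unfolded once, in [mainEntry]. *)
Instance cohomIso : Lib := ltac:(lemma 0
  (forK (fun k => theCohomologyRing ZRing (emData k) cCirc (fun A =>
      thePolynomialRing ZRing (fun B =>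
      theQuotientRing B (mul B (polyX ZRing) (polyX ZRing)) (fun Q =>
      ringIso A Q)))))
  (lamK (fun k => inGr grIso (kGr k) @ oneH ZRing (emData k) cCirc @ rfl))).
Instance mainEntry : Lib := ltac:(lemma 0
    (forallEM ZRing (fun E =>
      theCohomologyRing ZRing E cCirc (fun A =>
      thePolynomialRing ZRing (fun B =>
      theQuotientRing B (mul B (polyX ZRing) (polyX ZRing)) (fun Q =>
      ringIso A Q)))))
    cohomIso).

(** By evaluation of the type checker on all definitions. *)
Lemma mainEntry_ok : library_ok mainEntry = true.
Proof. vm_cast_no_check (eq_refl true). Qed.

Theorem proposition5p1 :
  hott_theorem
    (forallEM ZRing (fun E =>
      theCohomologyRing ZRing E cCirc (fun A =>
      thePolynomialRing ZRing (fun B =>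
      theQuotientRing B (mul B (polyX ZRing) (polyX ZRing)) (fun Q =>
      ringIso A Q))))).
Proof. eapply library_theorem; [exact mainEntry_ok|]. vm_compute. reflexivity. Qed.
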